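(* Let $n\geq 3$ and $p\in[2,n)$. Let $\Omega\subset\mathbb{R}^n$ be a bounded domain and let $S\subset\Omega$ be a compact subset. Suppose that there is a Riemannian metric $\bar g$ on $\Omega\setminus S$ that is conformal to the Euclidean metric and is geodesically complete near $S$, and assume that $A^{(p)}[\bar g]\geq 0$ on $\Omega\setminus S$. Then the Hausdorff dimension of $S$ satisfies $$\dim_{\mathcal{H}}(S)\leq\frac{n-p}{2}.$$
   Context: Metrics are smooth. For a Riemannian metric $g$ on an $n$-manifold with Ricci tensor $Ric$ and scalar curvature $R$, the Schouten tensor is $A=\frac{1}{n-2}\left(Ric-\frac{1}{2(n-1)}R\,g\right)$, and $J=\mathrm{Tr}_g A=\frac{1}{2(n-1)}R$. For real $p$, the intermediate Schouten curvature tensor is $A^{(p)}=A^{(p)}[g]=(p-2)A+J\,g$; the condition $A^{(p)}\geq0$ means that this symmetric 2-tensor is nonnegative definite at every point. The metric $\bar g$ being conformal to the Euclidean metric $g_{\mathbb{E}}$ means $\bar g=e^{2\phi}g_{\mathbb{E}}$ for a smooth function $\phi$ on $\Omega\setminus S$. ''Geodesically complete near $S$'' means that every (locally rectifiable) curve $\gamma:[0,1)\to\Omega\setminus S$ whose Euclidean distance to $S$ tends to $0$ as $t\to1$ has infinite $\bar g$-length. *)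

(* Defs.v *)
(* R^n is 'rV[R]_n; its library norm is the sup norm, which
   induces the usual topology, but every metric notion below (distance,
   diameter, length) uses the Euclidean norm [enorm]. *)
From mathcomp Require Export all_boot all_order all_algebra.
From mathcomp Require Export all_classical all_reals all_analysis.
Export Order.TTheory GRing.Theory Num.Theory numFieldNormedType.Exports.

Set Implicit Arguments.
Unset Strict Implicit.
Unset Printing Implicit Defensive.

Local Open Scope classical_set_scope.
Local Open Scope ring_scope.

Section Euclidean.
Context {R : realType} {n : nat}.
Implicit Types (x v : 'rV[R]_n) (A M : set 'rV[R]_n) (f : 'rV[R]_n -> R).

(* B(v, v) for the bilinear form with matrix B *)
Definition qform (B : 'M[R]_n) v : R := \sum_i \sum_j B i j * v 0 i * v 0 j.

Definition enorm v : R := Num.sqrt (\sum_i v 0 i ^+ 2).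

(* Infimum in \bar R: the distance to the empty set is +oo. *)
Definition dist_to A x : \bar R := ereal_inf [set (enorm (x - y))%:E | y in A].

Definition domain A : Prop := [/\ open A, connected A & A !=set0].

Definition pderiv (i : 'I_n) f : 'rV[R]_n -> R :=
  fun x => 'D_(delta_mx 0 i) f x.

(* C^oo on the open set M: all iterated partial derivatives exist and are
   continuous at every point of M. *)
Definition smooth_on M f : Prop :=
  forall (s : seq 'I_n) x, M x ->
    {for x, continuous (foldr pderiv f s)} /\
    forall i, derivable (foldr pderiv f s) x (delta_mx 0 i).

End Euclidean.

Section Hausdorff.
Context {R : realType} {n : nat}.
Implicit Types (A U : set 'rV[R]_n) (s delta : R).

Definition diam U : \bar R :=
  ereal_sup [set (enorm (xy.1 - xy.2))%:E | xy in U `*` U].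

(* The empty set has weight 0 and, when s = 0, every nonempty set weight 1. *)
Definition diam_weight s U : \bar R :=
  if U == set0 then 0%E else poweR (diam U) s.

Definition hausdorff_premeasure s delta A : \bar R :=
  ereal_inf [set (\sum_(0 <= k <oo) diam_weight s (U k))%E
            | U in [set U : nat -> set 'rV[R]_n |
                A `<=` \bigcup_k U k /\ forall k, (diam (U k) <= delta%:E)%E]].

Definition hausdorff_measure s A : \bar R :=
  ereal_sup [set hausdorff_premeasure s delta A
            | delta in [set delta : R | 0 < delta]].

Definition hausdorff_dim A : \bar R :=
  ereal_inf [set s%:E
            | s in [set s : R | 0 <= s /\ hausdorff_measure s A = 0%E]].

End Hausdorff.

(* Tensors on an open subset of R^n are given by their components in the
   standard coordinates. *)
Section Curvature.
Context {R : realType} {n : nat}.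
Implicit Types (g h : 'rV[R]_n -> 'M[R]_n) (M : set 'rV[R]_n).

Definition riemannian_metric M g : Prop :=
  [/\ forall i j, smooth_on M (fun x => g x i j),
      forall x, M x -> (g x)^T = g x
    & forall x v, M x -> v != 0 -> 0 < qform (g x) v].

Definition euclidean_metric : 'rV[R]_n -> 'M[R]_n := fun=> 1%:M.

Definition conformal M g h : Prop :=
  exists2 phi : 'rV[R]_n -> R, smooth_on M phi &
    forall x, M x -> g x = expR (2 * phi x) *: h x.

(* christoffel g k i j = Gamma^k_{ij} *)
Definition christoffel g (k i j : 'I_n) (x : 'rV[R]_n) : R :=
  2^-1 * \sum_l invmx (g x) k l *
    (pderiv i (fun y => g y j l) x + pderiv j (fun y => g y i l) x
     - pderiv l (fun y => g y i j) x).

(* The coefficient of d_l in R(d_i, d_j) d_k, where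
   R(X, Y) Z = nabla_X nabla_Y Z - nabla_Y nabla_X Z - nabla_[X,Y] Z. *)
Definition riemann g (l k i j : 'I_n) (x : 'rV[R]_n) : R :=
  pderiv i (christoffel g l j k) x - pderiv j (christoffel g l i k) x
  + \sum_m (christoffel g l i m x * christoffel g m j k x
            - christoffel g l j m x * christoffel g m i k x).

(* Ric(Y, Z) = trace (X |-> R(X, Y) Z), positive on round spheres *)
Definition ricci g (x : 'rV[R]_n) : 'M[R]_n :=
  \matrix_(j, k) \sum_i riemann g i k i j x.

(* \tr (g^-1 B) = g^{ij} B_{ji} *)
Definition trace_wrt g (B : 'rV[R]_n -> 'M[R]_n) (x : 'rV[R]_n) : R :=
  \tr (invmx (g x) *m B x).

Definition scalar_curvature g : 'rV[R]_n -> R := trace_wrt g (ricci g).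

Definition schouten g (x : 'rV[R]_n) : 'M[R]_n :=
  (n%:R - 2)^-1 *:
    (ricci g x - (scalar_curvature g x / (2 * (n%:R - 1))) *: g x).

Definition schouten_trace g : 'rV[R]_n -> R := trace_wrt g (schouten g).

(* A^(p)[g] = (p - 2) A + J g *)
Definition intermediate_schouten (p : R) g (x : 'rV[R]_n) : 'M[R]_n :=
  (p - 2) *: schouten g x + schouten_trace g x *: g x.

Definition nonneg_tensor_on M (B : 'rV[R]_n -> 'M[R]_n) : Prop :=
  forall x v, M x -> 0 <= qform (B x) v.

End Curvature.

Section Curves.
Context {R : realType} {n : nat}.
Implicit Types (g : 'rV[R]_n -> 'M[R]_n) (gamma : R -> 'rV[R]_n) (s : seq R).

(* For a partition a = t_0 < t_1 < ... < t_m = b, with s = [:: t_1; ...; t_m]: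
   the sum over i of the norms of the chords gamma(t_{i+1}) - gamma(t_i),
   measured with the inner product g at gamma(t_i). *)
Definition chord_sum g gamma (a b : R) s : R :=
  let t := nth b (a :: s) in
  \sum_(0 <= i < size s)
    Num.sqrt (qform (g (gamma (t i))) (gamma (t i.+1) - gamma (t i))).

Definition mesh_lt (a b : R) s (delta : R) : Prop :=
  let t := nth b (a :: s) in
  forall i, (i < size s)%N -> t i.+1 - t i < delta.

Definition rectifiable gamma (a b : R) : Prop :=
  has_ubound [set chord_sum euclidean_metric gamma a b s
             | s in itv_partition a b].

(* The g-length of gamma on [a, b]: the lower limit of the chord sums as the
   mesh of the partition tends to 0.  For gamma continuous and rectifiable and
   g continuous along gamma this is a limit and is the integral of |d gamma|_g;
   for g = e^(2 phi) g_E it is the integral of e^phi with respect to Euclidean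
   arc length. *)
Definition curve_length g gamma (a b : R) : \bar R :=
  ereal_sup [set ereal_inf [set (chord_sum g gamma a b s)%:E
                           | s in [set s | itv_partition a b s /\
                                           mesh_lt a b s delta]]
            | delta in [set delta : R | 0 < delta]].

Definition curve_length01 g gamma : \bar R :=
  ereal_sup [set curve_length g gamma 0 c | c in `[0, 1[].

Definition geodesically_complete_near (Omega S : set 'rV[R]_n) g : Prop :=
  forall gamma : R -> 'rV[R]_n,
    {within `[0, 1[, continuous gamma} ->
    (forall t, 0 <= t < 1 -> (Omega `\` S) (gamma t)) ->
    (forall c, 0 <= c < 1 -> rectifiable gamma 0 c) ->
    dist_to S (gamma t) @[t --> 1^'-] --> 0%E ->
    curve_length01 g gamma = +oo%E.

End Curves.

(* Main.v *)
Require Import Defs.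
From mathcomp Require Import ring lra zify.

(** Near S write g = e^(2 phi) g_E, put N = |d phi|^2 and kappa = (n - p) / 2, and
let D be the distance to S in the sup norm.

Curvature. The Schouten tensor of g is - Hess phi + d phi (x) d phi - N/2 g_E.
Evaluating A^(p) >= 0 on the coordinate vectors and adding up bounds the
Laplacian of phi; evaluating it on the gradient of phi then bounds the
linearised operator (1 + N) Lap phi + (p - 2) Hess phi (grad phi, grad phi).
As a consequence, if F' <= t F with t < kappa, the field
F(phi) (1 + N)^((p-2)/2) grad phi has divergence at most
- (kappa - t) F(phi) (1 + N)^((p-2)/2) N ([div_flux_le]).

Completeness. For every eps there is a function eta that vanishes near S, is 1
away from S and satisfies |d eta| <= eps e^phi ([cutoff]).  It is the truncated
distance to a neighbourhood of S in the metric g; if it did not exist, points of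
S could be approached at bounded cost and a polygon of finite g-length would run
into S ([complete_no_escape]).

Energy. Pairing the divergence inequality with the n-th power of such a cutoff
and letting F grow to e^(t phi) shows that the energy, the integral of
e^(t phi) (1 + N)^((p-2)/2) N near S, is finite for every t < kappa
([energy_bound]).

Points of small energy. Put sigma = t / p and let d be such that
b = (n - p - d) / p satisfies 0 < b < sigma.  Suppose that the energy of the cube
of side l around some point y of S is O(l^d).  By the Poincare inequality the
mean of V = e^(sigma phi) over these cubes is O(l^-b).  Let theta be 1 near S,
small in mean, with |d theta| <= eps e^phi.  Where V <= M we have
e^phi <= M^(1/sigma), hence (theta - V/M)_+ has a gradient of size at most
|dV|/M + eps M^(1/sigma).  With M = l^-b' and b < b' < sigma the means of theta
over the cubes of side l and l/2 therefore differ by a power of l that can be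
summed, so that the mean of theta over small cubes is small although theta is 1
there ([good_point_absurd]).

Covering. So every point of S lies in arbitrarily small dyadic cubes of side l
whose energy exceeds C l^d.  The maximal ones are disjoint, so the sum of their
l^d is at most the total energy divided by C, and C is arbitrary: the
d-dimensional Hausdorff measure of S vanishes for kappa < d < 2 kappa
([null_above]).

Every integral is replaced by a Riemann sum over the lattice of mesh 2^-m, and
every integration by parts by a shift of that lattice.  The estimates hold for all
large m, and an ultrafilter on m decides for which cubes the sums are eventually
large. *)

Set Implicit Arguments.
Unset Strict Implicit.
Unset Printing Implicit Defensive.

Local Open Scope classical_set_scope.
Local Open Scope ring_scope.

(** * Directional derivatives and compactness *)

Section Calculus.
Context {R : realType}.

(** Near-covering compactness, applied to the filter of small radii, gives one radius
for the whole set from the local ones. *)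
Lemma compact_uniform (V : normedModType R) (K : set V) (Q : V -> R -> Prop) :
  compact K ->
  (forall x d d', Q x d -> 0 < d' <= d -> Q x d') ->
  (forall z, K z -> exists d r : R, [/\ 0 < d, 0 < r &
     forall x, K x -> `|x - z| < r -> Q x d]) ->
  exists2 d : R, 0 < d & forall x, K x -> Q x d.
Proof.
move=> /compact_near_coveringP cK Qmon loc.
have FF : ProperFilter (0^'+ : set_system R) by exact: at_right_proper_filter.
have /cK : forall x, K x ->
    \forall x' \near x & d \near (0:R)^'+, K x' -> Q x' d.
  move=> z /loc[d [r [d0 r0 Qd]]].
  exists ([set x | `|x - z| < r], [set e | 0 < e <= d]) => /=.
    split.
      apply/nbhs_ballP; exists r => //= x; rewrite -ball_normE /= distrC.
      by [].
    near=> e; apply/andP; split => //.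
    by apply/ltW; near: e; exact: nbhs_right_lt.
  by move=> [x e] /= [xr ed] Kx; exact: (Qmon _ _ _ (Qd x Kx xr) ed).
move=> H.
near (0:R)^'+ => d.
exists d => // x Kx.
have : K `<=` (fun x' => K x' -> Q x' d).
  by near: d; apply: H.
by apply.
Unshelve. all: by end_near. Qed.

Lemma is_derive_line (V W : normedModType R) (f : V -> W) (x v : V) (s : R) df :
  is_derive (s *: v + x) v f df ->
  is_derive s 1 (fun h : R => f (h *: v + x)) df.
Proof.
case=> fd fe.
have E : (fun h : R => h^-1 *: (((fun h : R => f (h *: v + x)) \o shift s) (h *: (1:R)) -
   f (s *: v + x))) =
  (fun h : R => h^-1 *: ((f \o shift (s *: v + x)) (h *: v) - f (s *: v + x))).
  apply/funext => h /=; congr (_ *: (f _ - _)).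
  by rewrite /= [h *: 1]mulr1 scalerDl addrA.
apply: DeriveDef; first by rewrite /derivable E.
by rewrite /derive E -fe.
Qed.

Lemma is_derive_of_line (V W : normedModType R) (f : V -> W) (x v : V) df :
  is_derive (0:R) 1 (fun h : R => f (h *: v + x)) df -> is_derive x v f df.
Proof.
case=> fd fe.
have E : (fun h : R => h^-1 *: (((fun h : R => f (h *: v + x)) \o shift 0) (h *: (1:R)) -
   f (0 *: v + x))) =
  (fun h : R => h^-1 *: ((f \o shift x) (h *: v) - f x)).
  apply/funext => h /=; rewrite scale0r add0r addr0.
  by rewrite [h *: 1]mulr1.
apply: DeriveDef; first by rewrite /derivable -E.
by rewrite /derive -E -fe.
Qed.

(** Only one directional derivative of f is assumed; on the line through x in that
direction the composite is a function of one variable. *)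
Lemma is_derive_chain (V : normedModType R) (f : V -> R) (g : R -> R) x v df dg :
  is_derive x v f df -> is_derive (f x) 1 g dg ->
  is_derive x v (g \o f) (dg * df).
Proof.
move=> Df Dg; apply: is_derive_of_line.
have Df' : is_derive (0:R) 1 (fun h : R => f (h *: v + x)) df.
  by apply: is_derive_line; rewrite scale0r add0r.
have Dg' : is_derive (f (0 *: v + x)) 1 g dg by rewrite scale0r add0r.
apply: DeriveDef.
  apply/derivable1_diffP.
  apply: (@differentiable_comp _ _ _ _ (fun h : R => f (h *: v + x)) g).
    by apply/derivable1_diffP; case: Df'.
  by apply/derivable1_diffP; case: Dg'.
have := @derive1_comp R (fun h : R => f (h *: v + x)) g 0.
rewrite !derive1E => ->; [|by case: Df'|by case: Dg'].
by case: Df' => _ ->; case: Dg' => _ ->.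
Qed.

(** The value of the derivative is the one prescribed by df along the segment, so
that uniform bounds for df can be used. *)
Lemma mean_value_line (V : normedModType R) (f : V -> R) (df : V -> R) x v (h : R) :
  0 < h ->
  (forall s : R, 0 <= s <= h -> is_derive (s *: v + x) v f (df (s *: v + x))) ->
  exists2 s : R, 0 <= s <= h & f (h *: v + x) - f x = h * df (s *: v + x).
Proof.
move=> h0 Hd.
have D : forall s : R, 0 <= s <= h ->
    is_derive s 1 (fun h : R => f (h *: v + x)) (df (s *: v + x)).
  by move=> s sh; apply: is_derive_line; exact: Hd.
have := @MVT R (fun h : R => f (h *: v + x)) (fun s => df (s *: v + x)) 0 h h0.
case.
- by move=> s; rewrite in_itv /= => /andP[a b]; apply: D; rewrite !ltW.
- apply: (@derivable_within_continuous _ _ _ `[0, h]) => s.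
  by rewrite in_itv /= => sh; case: (D s sh).
move=> s; rewrite in_itv /= => /andP[a b]; rewrite scale0r add0r subr0 mulrC => E.
by exists s => //; rewrite !ltW.
Qed.

End Calculus.

Lemma is_derive_comb3 (R : realType) (V : normedModType R) (f1 f2 f3 : V -> R)
    (x v : V) (a b c d1 d2 d3 : R) :
  is_derive x v f1 d1 -> is_derive x v f2 d2 -> is_derive x v f3 d3 ->
  is_derive x v (fun y => a * f1 y + b * f2 y - c * f3 y) (a * d1 + b * d2 - c * d3).
Proof.
move=> D1 D2 D3.
exact: (is_deriveB (is_deriveD (is_deriveZ a D1) (is_deriveZ b D2)) (is_deriveZ c D3)).
Qed.

(** * Curvature of a conformally flat metric *)

Section ConformalCurvature.
Context {R : realType} {n : nat}.
Implicit Types (v : 'rV[R]_n) (B : 'M[R]_n).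

Definition kron (i j : 'I_n) : R := (i == j)%:R.

Lemma kronC i j : kron i j = kron j i. Proof. by rewrite /kron eq_sym. Qed.
Lemma kronii i : kron i i = 1. Proof. by rewrite /kron eqxx. Qed.

Lemma sum_kron (F : 'I_n -> R) j : \sum_i kron i j * F i = F j.
Proof.
rewrite (bigD1 j) //= kronii mul1r big1 ?addr0 // => i /negbTE ij.
by rewrite /kron ij mul0r.
Qed.

Lemma sum_const_ord (a : R) : \sum_(i < n) a = a * n%:R.
Proof. by rewrite sumr_const card_ord mulr_natr. Qed.

Lemma tr_scalar (a : R) : \tr (a%:M : 'M[R]_n) = a * n%:R.
Proof. by rewrite mxtrace_scalar mulr_natr. Qed.

Lemma mxtraceN (A : 'M[R]_n) : \tr (- A) = - \tr A.
Proof. by rewrite -scaleN1r mxtraceZ mulN1r. Qed.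

Lemma qformD B C v : qform (B + C) v = qform B v + qform C v.
Proof.
rewrite /qform -big_split /=; apply: eq_bigr => i _.
by rewrite -big_split /=; apply: eq_bigr => j _; rewrite mxE !mulrDl.
Qed.

Lemma qformZ a B v : qform (a *: B) v = a * qform B v.
Proof.
rewrite /qform mulr_sumr; apply: eq_bigr => i _.
by rewrite mulr_sumr; apply: eq_bigr => j _; rewrite mxE !mulrA.
Qed.

Lemma qformN B v : qform (- B) v = - qform B v.
Proof. by rewrite -scaleN1r qformZ mulN1r. Qed.

Lemma qform_scalar a v : qform (a%:M) v = a * \sum_i v 0 i ^+ 2.
Proof.
rewrite /qform mulr_sumr; apply: eq_bigr => i _.
rewrite (eq_bigr (fun j => kron j i * (a * v 0 i * v 0 j))); last first.
  by move=> j _; rewrite mxE kronC /kron; case: eqP => _; rewrite ?mulr1n ?mulr0n; ring.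
by rewrite sum_kron expr2 mulrA.
Qed.

Lemma qform_tr B v : qform (B^T) v = qform B v.
Proof.
rewrite /qform exchange_big /=; apply: eq_bigr => i _; apply: eq_bigr => j _.
by rewrite mxE mulrAC.
Qed.

Definition grad_at (phi : 'rV[R]_n -> R) (x : 'rV[R]_n) : 'rV[R]_n :=
  \row_i pderiv i phi x.
Definition hess (phi : 'rV[R]_n -> R) (x : 'rV[R]_n) : 'M[R]_n :=
  \matrix_(i, j) pderiv i (pderiv j phi) x.
Definition sqgrad (phi : 'rV[R]_n -> R) (x : 'rV[R]_n) : R :=
  \sum_i pderiv i phi x ^+ 2.

Variables (M : set 'rV[R]_n) (phi : 'rV[R]_n -> R) (g : 'rV[R]_n -> 'M[R]_n).
Hypothesis oM : open M.
Hypothesis sphi : smooth_on M phi.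
Hypothesis gE : forall x, M x -> g x = expR (2 * phi x) *: 1%:M.

Local Notation e i := (delta_mx 0 i : 'rV[R]_n).

Lemma smooth_is_derive s i x : M x ->
  is_derive x (e i) (foldr pderiv phi s) (pderiv i (foldr pderiv phi s) x).
Proof. by move=> Mx; apply: derivableP; case: (sphi s Mx). Qed.

Lemma phi_is_derive i x : M x -> is_derive x (e i) phi (pderiv i phi x).
Proof. exact: (@smooth_is_derive [::]). Qed.

Lemma dphi_is_derive i j x : M x ->
  is_derive x (e i) (pderiv j phi) (pderiv i (pderiv j phi) x).
Proof. exact: (@smooth_is_derive [:: j]). Qed.

Lemma near_in (x : 'rV[R]_n) : M x -> \near x, M x.
Proof. by move=> Mx; apply: open_nbhs_nbhs. Qed.

Lemma pderiv_near (f h : 'rV[R]_n -> R) x i d :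
  M x -> (forall y, M y -> f y = h y) -> is_derive x (e i) h d ->
  pderiv i f x = d.
Proof.
move=> Mx fh [_ <-]; rewrite /pderiv; apply: near_eq_derive.
by apply: filterS (near_in Mx) => y /fh.
Qed.

Lemma pderiv_metric i j l x : M x ->
  pderiv i (fun y => g y j l) x = 2 * pderiv i phi x * expR (2 * phi x) * kron j l.
Proof.
move=> Mx.
apply: (@pderiv_near _ (fun y => kron j l *: (expR \o (2 *: phi)) y)) => //.
  by move=> y My; rewrite gE // !mxE /= mulrC.
have D := phi_is_derive i Mx.
have := is_deriveZ (kron j l) (is_derive_chain (is_deriveZ 2 D)
   (is_derive_expR ((2 *: phi) x))).
move=> H; apply: (is_derive_eq H); rewrite /= /GRing.scale /=; ring.
Qed.

Lemma invmx_metric x : M x -> invmx (g x) = (expR (2 * phi x))^-1%:M.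
Proof.
by move=> Mx; rewrite gE // scalemx1 invmx_scalar.
Qed.

Lemma christoffel_conformal k i j x : M x ->
  christoffel g k i j x =
  kron j k * pderiv i phi x + kron i k * pderiv j phi x - kron i j * pderiv k phi x.
Proof.
move=> Mx; rewrite /christoffel invmx_metric //.
rewrite (eq_bigr (fun l => kron l k * ((expR (2 * phi x))^-1 *
   (2 * pderiv i phi x * expR (2 * phi x) * kron j l +
    2 * pderiv j phi x * expR (2 * phi x) * kron i l -
    2 * pderiv l phi x * expR (2 * phi x) * kron i j)))); last first.
  move=> l _; rewrite !pderiv_metric // mxE (kronC l k) [kron k l]/kron.
  by case: (k == l); rewrite ?mulr1n ?mulr0n ?mul1r // !mul0r.
rewrite sum_kron; have : expR (2 * phi x) != 0 by rewrite gt_eqF ?expR_gt0.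
move: (expR _) (pderiv i phi x) (pderiv j phi x) (pderiv k phi x) (kron _ _) (kron _ _) (kron _ _).
by move=> a b c d k1 k2 k3 a0; field.
Qed.

Lemma pderiv_christoffel a k i j x : M x ->
  pderiv a (christoffel g k i j) x =
  kron j k * pderiv a (pderiv i phi) x + kron i k * pderiv a (pderiv j phi) x
  - kron i j * pderiv a (pderiv k phi) x.
Proof.
move=> Mx.
have D := fun l => dphi_is_derive a l Mx.
apply: (pderiv_near Mx _ (is_derive_comb3 (kron j k) (kron i k) (kron i j) (D i) (D j) (D k))).
by move=> y My; rewrite (christoffel_conformal k i j My).
Qed.

(** The conformal formula for the Ricci tensor is an identity between contractions
of the symbols Gamma^k_ij = delta_jk f_i + delta_ik f_j - delta_ij f_k and of
their derivatives; stated with f and H in place of the gradient and the Hessian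
it needs no analysis. *)
Lemma ricci_contraction (f : 'I_n -> R) (H : 'I_n -> 'I_n -> R) j k :
  let Ga k i j := kron j k * f i + kron i k * f j - kron i j * f k in
  let dGa a k i j := kron j k * H a i + kron i k * H a j - kron i j * H a k in
  let N := \sum_i f i ^+ 2 in
  \sum_i (dGa i i j k - dGa j i i k
     + \sum_m (Ga i i m * Ga m j k - Ga i j m * Ga m i k)) =
  H k j - (n%:R - 1) * H j k + (n%:R - 2) * (f j * f k)
  - (\sum_i H i i + (n%:R - 2) * N) * kron j k.
Proof.
move=> Ga dGa N.
have inner i : \sum_m (Ga i i m * Ga m j k - Ga i j m * Ga m i k) =
  (2 * f j * f k - kron j k * N) -
  (f j * f k + kron i j * (2 * f i * f k - f i * f k) + kron i k * (f i * f j)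
    - kron j k * f i ^+ 2 - kron i j * (kron i k * N)).
  rewrite (eq_bigr (fun m => kron m k * (f j * f m) + kron m j * (f m * f k) +
     - kron j k * f m ^+ 2
     + (- (kron m i * (f j * (kron m k * f i + kron m i * f k - kron i k * f m))) +
     (kron m j * (f i * (kron m k * f i + kron m i * f k - kron i k * f m))
     + - (kron m k * (kron i j * f m * f i)) + - (kron m i * (kron i j * f m * f k)) +
     kron i j * kron i k * f m ^+ 2)))); last first.
    move=> m _; rewrite /Ga !kronii (kronC k m) (kronC i m) (kronC j m) (kronC j i).
    move: (kron m k) (kron m i) (kron m j) (kron i j) (kron i k) (kron j k) (f m) (f i) (f j) (f k).
    by move=> *; ring.
  rewrite !big_split /= !sumrN -!mulr_sumr !sum_kron -/N !kronii (kronC j i).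
  move: (kron i j) (kron i k) (kron j k) (f i) (f j) (f k).
  by move=> *; ring.
rewrite (eq_bigr (fun i => kron i k * H i j + kron i j * H i k + - kron j k * H i i
   + - H j k + ((2 * f j * f k - kron j k * N) +
  (- (f j * f k) + - (kron i j * (2 * f i * f k - f i * f k)) + - (kron i k * (f i * f j))
    + kron j k * f i ^+ 2 + kron i j * (kron i k * N))))); last first.
  move=> i _; rewrite inner /dGa !kronii (kronC k i) (kronC j i).
  move: (kron i j) (kron i k) (kron j k) (f i) (f j) (f k) (H i j) (H i k) (H i i) (H j k) (H j i).
  by move=> *; ring.
rewrite !big_split /= !sumrN -!mulr_sumr !sum_kron !sum_const_ord -/N.
move: (kron j k) (f j) (f k) (H j k) (H k j) (\sum_i _) n%:R.
by move=> *; ring.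
Qed.

(** The Hessian and its transpose are kept apart; they agree as quadratic forms, and
the curvature condition sees nothing else. *)
Lemma ricci_conformal x : M x ->
  ricci g x = (hess phi x)^T - (n%:R - 1) *: hess phi x
    + (n%:R - 2) *: ((grad_at phi x)^T *m grad_at phi x)
    - (\tr (hess phi x) + (n%:R - 2) * sqgrad phi x)%:M.
Proof.
move=> Mx; apply/matrixP => j k.
rewrite [LHS]mxE.
pose f i := pderiv i phi x.
pose H i j := pderiv i (pderiv j phi) x.
transitivity (H k j - (n%:R - 1) * H j k + (n%:R - 2) * (f j * f k)
  - (\sum_i H i i + (n%:R - 2) * \sum_i f i ^+ 2) * kron j k).
  rewrite -ricci_contraction; apply: eq_bigr => i _; rewrite /riemann.
  rewrite !pderiv_christoffel //; congr (_ + _); apply: eq_bigr => m _.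
  by rewrite !christoffel_conformal.
have -> : \sum_i H i i = \tr (hess phi x) by apply: eq_bigr => i _; rewrite mxE.
by rewrite !mxE big_ord1 !mxE mulr_natr.
Qed.

Lemma qform_outer (u v : 'rV[R]_n) : qform (u^T *m u) v = (\sum_i u 0 i * v 0 i) ^+ 2.
Proof.
rewrite expr2 mulr_suml; apply: eq_bigr => i _; rewrite mulr_sumr.
apply: eq_bigr => j _; rewrite !mxE big_ord1 !mxE.
by move: (u 0 i) (u 0 j) (v 0 i) (v 0 j) => *; ring.
Qed.

Lemma tr_outer (u : 'rV[R]_n) : \tr (u^T *m u) = \sum_i u 0 i ^+ 2.
Proof. by apply: eq_bigr => i _; rewrite mxE big_ord1 !mxE expr2. Qed.

(** The factors e^(2 phi) cancel: A is a covariant tensor, and J g is the trace of A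
with respect to g times g. *)
Lemma qform_intermediate_schouten p x v : (3 <= n)%N -> M x ->
  let W := \sum_i v 0 i ^+ 2 in
  let N := sqgrad phi x in
  qform (intermediate_schouten p g x) v =
  (p - 2) * (- qform (hess phi x) v + (\sum_i pderiv i phi x * v 0 i) ^+ 2
             - N * W / 2)
  + (- \tr (hess phi x) - (n%:R - 2) * N / 2) * W.
Proof.
move=> n3 Mx W N.
have n0 : n%:R - 2 != 0 :> R by rewrite subr_eq0 eqr_nat; case: (n) n3 => [|[|[]]].
have n1 : n%:R - 1 != 0 :> R by rewrite subr_eq0 pnatr_eq1; case: (n) n3 => [|[|[]]].
pose E := expR (2 * phi x).
have E0 : E != 0 by rewrite gt_eqF ?expR_gt0.
have trgg : \sum_i (grad_at phi x) 0 i ^+ 2 = N.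
  by apply: eq_bigr => i _; rewrite mxE.
have trR : \tr (ricci g x) = - (2 * n%:R - 2) * \tr (hess phi x)
   - (n%:R - 1) * (n%:R - 2) * N.
  rewrite ricci_conformal // !mxtraceD !mxtraceN !mxtraceZ mxtrace_tr.
  rewrite tr_outer trgg tr_scalar -/N.
  by move: (\tr _) n%:R => a b; ring.
have scal : scalar_curvature g x = E^-1 * \tr (ricci g x).
  by rewrite /scalar_curvature /trace_wrt invmx_metric // mul_scalar_mx mxtraceZ.
have gx : g x = E%:M by rewrite gE // scalemx1.
have qR : qform (ricci g x) v = (2 - n%:R) * qform (hess phi x) v
   + (n%:R - 2) * (\sum_i pderiv i phi x * v 0 i) ^+ 2
   - (\tr (hess phi x) + (n%:R - 2) * N) * W.
  rewrite ricci_conformal // !qformD !qformN !qformZ qform_tr qform_outer qform_scalar -/W -/N.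
  have -> : \sum_i (grad_at phi x) 0 i * v 0 i = \sum_i pderiv i phi x * v 0 i.
    by apply: eq_bigr => i _; rewrite mxE.
  by move: (qform _ _) (\tr _) (\sum_i _) n%:R => *; ring.
have Sch : schouten_trace g x * E = (2 * (n%:R - 1))^-1 * \tr (ricci g x).
  rewrite /schouten_trace /trace_wrt invmx_metric // mul_scalar_mx mxtraceZ -/E.
  rewrite /schouten mxtraceZ mxtraceD mxtraceN mxtraceZ scal gx tr_scalar.
  move: (\tr _) n%:R n0 n1 => a b ? ?.
  by field; apply/and3P; split.
rewrite /intermediate_schouten /schouten !(qformD, qformN, qformZ).
rewrite gx !qform_scalar -/W (mulrA (schouten_trace g x)) Sch scal trR qR.
move: (qform _ _) (\tr _) (\sum_i _) n%:R n0 n1 => a b e m ? ?.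
by field; apply/and3P; split.
Qed.

End ConformalCurvature.

(** * The divergence inequality *)

Section Flux.
Context {R : realType} {n : nat}.
Variables (M : set 'rV[R]_n) (phi : 'rV[R]_n -> R) (g : 'rV[R]_n -> 'M[R]_n) (p : R).
Hypothesis oM : open M.
Hypothesis sphi : smooth_on M phi.
Hypothesis gE : forall x, M x -> g x = expR (2 * phi x) *: 1%:M.
Hypothesis n3 : (3 <= n)%N.
Hypothesis p2 : 2 <= p.
Hypothesis Ap : nonneg_tensor_on M (intermediate_schouten p g).

Local Notation e i := (delta_mx 0 i : 'rV[R]_n).
Local Notation kappa := ((n%:R - p) / 2).

Lemma sqgrad_ge0 x : 0 <= sqgrad phi x.
Proof. by apply: sumr_ge0 => i _; exact: sqr_ge0. Qed.

(** The sum of A^(p)(e_i, e_i) over the coordinate vectors is (p - 2 + n) J up to the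
conformal factor, hence J >= 0. *)
Lemma laplacian_le x : M x ->
  \tr (hess phi x) <= - ((n%:R - 2) * sqgrad phi x / 2).
Proof.
move=> Mx; set N := sqgrad phi x.
have Ai i : 0 <= (p - 2) * (- hess phi x i i + pderiv i phi x ^+ 2 - N / 2)
   + (- \tr (hess phi x) - (n%:R - 2) * N / 2).
  have := Ap (e i) Mx.
  rewrite (qform_intermediate_schouten oM sphi gE _ _ n3 Mx) -/N.
  have kdE j : (e i) 0 j = kron j i by rewrite mxE eqxx.
  have -> : \sum_j (e i) 0 j ^+ 2 = 1.
    rewrite (eq_bigr (fun j => kron j i * kron j i)) ?sum_kron ?kronii // => j _.
    by rewrite kdE expr2.
  have -> : \sum_j pderiv j phi x * (e i) 0 j = pderiv i phi x.
    rewrite (eq_bigr (fun j => kron j i * pderiv j phi x)) ?sum_kron // => j _.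
    by rewrite kdE mulrC.
  have -> : qform (hess phi x) (e i) = hess phi x i i.
    rewrite /qform (eq_bigr (fun k => kron k i * hess phi x k i)) ?sum_kron // => k _.
    rewrite (eq_bigr (fun j => kron j i * (hess phi x k j * (e i) 0 k))) => [|j _].
      by rewrite sum_kron kdE mulrC.
    by rewrite !kdE mulrC.
  by rewrite !mulr1.
have S : 0 <= \sum_i ((p - 2) * (- hess phi x i i + pderiv i phi x ^+ 2 - N / 2)
   + (- \tr (hess phi x) - (n%:R - 2) * N / 2)).
  by apply: sumr_ge0 => i _.
have : 0 <= (p - 2 + n%:R) * (- \tr (hess phi x) - (n%:R - 2) * N / 2).
  apply: le_trans S _; rewrite big_split /= sum_const_ord -mulr_sumr.
  rewrite big_split /= sum_const_ord big_split /= sumrN -/N.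
  rewrite -[\sum_i hess phi x i i]/(\tr (hess phi x)) -/(sqgrad phi x) -/N.
  by move: (\tr _) n%:R => a b; rewrite le_eqVlt; apply/orP; left; apply/eqP; field.
have n3' : 3 <= n%:R :> R by rewrite (ler_nat _ 3).
have pn : 0 < p - 2 + n%:R by move: p2 n3'; move: n%:R => m; lra.
rewrite pmulr_rge0 //; move: (\tr _) n%:R => a b; lra.
Qed.

(** A^(p) >= 0 on the gradient controls N Lap phi + (p - 2) Hess phi (grad, grad); the
remaining Lap phi is controlled by [laplacian_le], whose constant (n - 2) / 2 is
at least kappa because p >= 2. *)
Lemma p_laplacian_le x : M x ->
  (1 + sqgrad phi x) * \tr (hess phi x) + (p - 2) * qform (hess phi x) (grad_at phi x)
  <= - kappa * sqgrad phi x * (1 + sqgrad phi x).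
Proof.
move=> Mx; set N := sqgrad phi x.
have := Ap (grad_at phi x) Mx.
rewrite (qform_intermediate_schouten oM sphi gE _ _ n3 Mx) -/N.
have -> : \sum_i (grad_at phi x) 0 i ^+ 2 = N by apply: eq_bigr => i _; rewrite mxE.
have -> : \sum_i pderiv i phi x * (grad_at phi x) 0 i = N.
  by apply: eq_bigr => i _; rewrite mxE expr2.
have := laplacian_le Mx; rewrite -/N.
have : 0 <= N by exact: sqgrad_ge0.
move: p2 (qform _ _) (\tr _) n%:R N => p2' q t m N N0 tN H.
have : (p - 2) * N >= 0 by rewrite mulr_ge0 // subr_ge0.
nra.
Qed.

(** The power (1 + s)^c. *)
Definition growth (c s : R) : R := expR (c * ln (1 + s)).

Variables (F dF : R -> R).
Hypothesis DF : forall s : R, is_derive s 1 F (dF s).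

Let c : R := (p - 2) / 2.

(** The field F(phi) (1 + N)^((p-2)/2) grad phi.  The summand 1 keeps the power
smooth where the gradient vanishes. *)
Definition flux (i : 'I_n) x := F (phi x) * growth c (sqgrad phi x) * pderiv i phi x.

(** The partial derivative of the i-th component of [flux] in the direction i, in
expanded form. *)
Definition dflux (i : 'I_n) x :=
  F (phi x) * growth c (sqgrad phi x) * pderiv i (pderiv i phi) x
  + pderiv i phi x * (F (phi x) *
     (growth c (sqgrad phi x) * (c / (1 + sqgrad phi x)) *
       \sum_j (2 * pderiv j phi x * pderiv i (pderiv j phi) x))
   + growth c (sqgrad phi x) * (dF (phi x) * pderiv i phi x)).

Lemma growth_is_derive (a s : R) : 0 <= s ->
  is_derive s 1 (growth a) (growth a s * (a / (1 + s))).
Proof.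
move=> s0; have s1 : 0 < 1 + s by rewrite ltr_pwDl.
have D1 : is_derive s 1 (fun s : R => 1 + s) 1.
  by have := is_deriveD (is_derive_cst (1:R) s 1) (is_derive_id s (1:R)); rewrite add0r.
have D2 := is_derive_chain D1 (is_derive1_ln s1).
have D3 := is_derive_chain (is_deriveZ a D2) (is_derive_expR (a * ln (1 + s))).
by apply: (is_derive_eq D3); rewrite /growth /GRing.scale /= mulr1.
Qed.

Lemma sqgrad_is_derive i x : M x ->
  is_derive x (e i) (sqgrad phi) (\sum_j (2 * pderiv j phi x * pderiv i (pderiv j phi) x)).
Proof.
move=> Mx.
have H := fun j => is_deriveX 2 (dphi_is_derive sphi i j Mx).
have S := is_derive_sum H.
have -> : sqgrad phi = \sum_(j < n) (pderiv j phi) ^+ 2.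
  by apply/funext => y; rewrite fct_sumE /sqgrad; apply: eq_bigr => j _; rewrite exprfctE.
by apply: (is_derive_eq S); apply: eq_bigr => j _; rewrite expr1.
Qed.

Lemma flux_is_derive i x : M x -> is_derive x (e i) (flux i) (dflux i x).
Proof.
move=> Mx.
have D1 := is_derive_chain (phi_is_derive sphi i Mx) (DF (phi x)).
have D2 := is_derive_chain (sqgrad_is_derive i Mx) (growth_is_derive c (sqgrad_ge0 x)).
exact: (is_deriveM (is_deriveM D1 D2) (dphi_is_derive sphi i i Mx)).
Qed.

Lemma growth_gt0 a s : 0 < growth a s. Proof. exact: expR_gt0. Qed.

(** The divergence is the operator of [p_laplacian_le] divided by 1 + N and
multiplied by the weights, plus the term with the derivative of F. *)
Lemma div_flux_le x : M x -> 0 <= F (phi x) ->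
  \sum_i dflux i x <=
  (dF (phi x) - kappa * F (phi x)) * growth c (sqgrad phi x) * sqgrad phi x.
Proof.
move=> Mx F0; pose N := sqgrad phi x.
have N0 : 0 <= N by exact: sqgrad_ge0.
set h := growth c _; have h0 : 0 < h by exact: growth_gt0.
have -> : \sum_i dflux i x = F (phi x) * h / (1 + N) *
   ((1 + N) * \tr (hess phi x) + (p - 2) * qform (hess phi x) (grad_at phi x))
   + dF (phi x) * h * N.
  have -> : \tr (hess phi x) = \sum_i pderiv i (pderiv i phi) x.
    by apply: eq_bigr => i _; rewrite mxE.
  rewrite -[X in dF _ * h * X]/(\sum_i pderiv i phi x ^+ 2) /qform.
  rewrite mulrDr mulrA 2!mulr_sumr 2!mulr_sumr -!big_split /=; apply: eq_bigr => i _.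
  rewrite /dflux -/h -/N.
  have -> : \sum_j hess phi x i j * (grad_at phi x) 0 i * (grad_at phi x) 0 j =
    pderiv i phi x / 2 * \sum_j (2 * pderiv j phi x * pderiv i (pderiv j phi) x).
    rewrite mulr_sumr; apply: eq_bigr => j _; rewrite !mxE.
    by move: (pderiv i _ x) (pderiv j _ x) (pderiv i _ x) => *; field.
  move: (pderiv i _ x) (pderiv i _ x) (\sum_j _) (F _) (dF _) => a b s f df.
  have : 1 + N != 0 by rewrite gt_eqF // ltr_pwDl.
  by rewrite /c => N1; field.
have := p_laplacian_le Mx; rewrite -/N => H.
have FN : 0 <= F (phi x) * h / (1 + N).
  by rewrite !mulr_ge0 ?invr_ge0 ?addr_ge0 // ltW.
have := ler_wpM2l FN H.
have E : F (phi x) * h / (1 + N) * (- kappa * N * (1 + N)) = - kappa * F (phi x) * h * N.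
  have : 1 + N != 0 by rewrite gt_eqF // ltr_pwDl.
  by move: (F _) n%:R => f m N1; field.
rewrite E => H2.
have -> : (dF (phi x) - kappa * F (phi x)) * h * N =
  - kappa * F (phi x) * h * N + dF (phi x) * h * N.
  by move: (F _) (dF _) n%:R => f df m; ring.
by rewrite lerD2r.
Qed.

End Flux.

(** * Riemann sums over a lattice *)

Section LatticeSums.
Context {R : realType} {n : nat}.
Variables (B m : nat).
Implicit Types (f g Lam : 'rV[R]_n -> R) (x y : 'rV[R]_n).

Local Notation e i := (delta_mx 0 i : 'rV[R]_n).

Definition lstep : R := 2 ^- m.
Local Notation h := lstep.

Lemma lstep_gt0 : 0 < h. Proof. by rewrite invr_gt0 exprn_gt0. Qed.

(** The lattice points u 2^-m - B (1, ..., 1) fill the box [-B, B)^n. *)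
Definition lindex := {ffun 'I_n -> 'I_(2 * (B * 2 ^ m))}.

Definition lpt (u : lindex) : 'rV[R]_n := \row_i ((u i)%:R * h - B%:R).

Definition lsum f : R := h ^+ n * \sum_u f (lpt u).

Lemma lpt_ge u i : - B%:R <= lpt u 0 i.
Proof. by rewrite mxE lerBrDr addNr mulr_ge0 // ltW // lstep_gt0. Qed.

Lemma Bh : (B * 2 ^ m)%:R * h = B%:R.
Proof. by rewrite natrM natrX mulfK // expf_neq0 // pnatr_eq0. Qed.

Lemma lpt_lt u i : lpt u 0 i < B%:R.
Proof.
rewrite mxE ltrBlDr -[X in _ < X + _]Bh -[X in _ < _ + X]Bh -mulrDl.
by rewrite ltr_pM2r ?lstep_gt0 // -natrD ltr_nat addnn -mul2n.
Qed.

Lemma ler_lsum_box f g :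
  (forall x, (forall i, - B%:R <= x 0 i < B%:R) -> f x <= g x) -> lsum f <= lsum g.
Proof.
move=> fg; rewrite ler_pM2l ?exprn_gt0 ?lstep_gt0 //; apply: ler_sum => u _.
by apply: fg => i; rewrite lpt_ge lpt_lt.
Qed.

Lemma ler_lsum f g : (forall x, f x <= g x) -> lsum f <= lsum g.
Proof. by move=> fg; apply: ler_lsum_box => x _. Qed.

Lemma lsum_ge0 f : (forall x, 0 <= f x) -> 0 <= lsum f.
Proof.
by move=> f0; apply: mulr_ge0; [rewrite exprn_ge0 // ltW // lstep_gt0|exact: sumr_ge0].
Qed.

Lemma eq_lsum f g : (forall x, f x = g x) -> lsum f = lsum g.
Proof. by move=> fg; congr (_ * _); apply: eq_bigr => u _. Qed.

Lemma lsumD f g : lsum (fun x => f x + g x) = lsum f + lsum g.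
Proof. by rewrite /lsum big_split /= mulrDr. Qed.

Lemma lsumZ (a : R) f : lsum (fun x => a * f x) = a * lsum f.
Proof. by rewrite /lsum -mulr_sumr mulrCA. Qed.

Lemma lsumB f g : lsum (fun x => f x - g x) = lsum f - lsum g.
Proof. by rewrite /lsum sumrB mulrBr. Qed.

Lemma lsum_sum (I : Type) (r : seq I) (F : I -> 'rV[R]_n -> R) :
  lsum (fun x => \sum_(i <- r) F i x) = \sum_(i <- r) lsum (F i).
Proof. by rewrite /lsum exchange_big /= mulr_sumr. Qed.

Lemma lsum_norm f : `|lsum f| <= lsum (fun x => `|f x|).
Proof.
have h0 : 0 < h ^+ n by rewrite exprn_gt0 // lstep_gt0.
by rewrite /lsum normrM gtr0_norm // ler_pM2l // ler_norm_sum.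
Qed.

Lemma lsum_cst : lsum (fun=> 1) = (2 * B)%:R ^+ n.
Proof.
rewrite /lsum sumr_const card_ffun !card_ord -[_ *+ _]/(_%:R) natrX -exprMn.
by congr (_ ^+ _); rewrite mulnA natrM mulrC -mulrA natrX mulfV ?mulr1 // expf_neq0 // pnatr_eq0.
Qed.

(** Rotating the i-th index cyclically permutes the lattice, and agrees with a
translation by one step except on the last layer; this is how sums are shifted. *)
Definition lrot (i : 'I_n) (u : lindex) : lindex :=
  [ffun j => if j == i then ordS (u j) else u j].

Lemma lrot_bij i : bijective (lrot i).
Proof.
exists (fun u : lindex => [ffun j => if j == i then ord_pred (u j) else u j]).
  by move=> u; apply/ffunP => j; rewrite !ffunE; case: eqP => // _; rewrite ordSK.
by move=> u; apply/ffunP => j; rewrite !ffunE; case: eqP => // _; rewrite ord_predK.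
Qed.

Lemma lpt_rot i (u : lindex) : ((u i).+1 < 2 * (B * 2 ^ m))%N ->
  lpt (lrot i u) = lpt u + h *: e i.
Proof.
move=> lt; apply/rowP => j; rewrite !mxE ffunE eqxx /=.
case: (eqVneq j i) => [->|_] /=; last by rewrite mulr0 addr0.
by rewrite modn_small // mulr1 -natr1 mulrDl mul1r addrAC.
Qed.

Lemma lpt_rot_last i (u : lindex) : ((u i).+1 < 2 * (B * 2 ^ m))%N = false ->
  lpt (lrot i u) 0 i = - B%:R /\ (lpt u + h *: e i) 0 i = B%:R.
Proof.
move=> lt; have E : (u i).+1 = (2 * (B * 2 ^ m))%N.
  by apply/eqP; rewrite eqn_leq ltn_ord /= leqNgt lt.
rewrite !mxE ffunE !eqxx /= E modnn mul0r add0r mulr1; split=> //.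
rewrite addrAC -[X in _ + X - _]mul1r -mulrDl natr1 E mul2n -addnn natrD mulrDl Bh.
by rewrite addrK.
Qed.

Lemma lsum_rot i f : lsum f = h ^+ n * \sum_u f (lpt (lrot i u)).
Proof.
by congr (_ * _); rewrite (reindex (lrot i)) //; apply/onW_bij/lrot_bij.
Qed.

Lemma lsum_shift i f :
  (forall x, f x != 0 -> - B%:R < x 0 i < B%:R) ->
  lsum (fun x => f (x + h *: e i)) = lsum f.
Proof.
move=> f0; rewrite (lsum_rot i f); congr (_ * _); apply: eq_bigr => u _.
case: (boolP ((u i).+1 < 2 * (B * 2 ^ m))%N) => [lt|/negbTE lt].
  by rewrite lpt_rot.
have [E1 E2] := lpt_rot_last lt.
have Z x : (x 0 i == - B%:R) || (x 0 i == B%:R) -> f x = 0.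
  move=> H; apply/eqP; apply: contraTT H => /f0 /andP[a b].
  by rewrite negb_or gt_eqF // lt_eqF.
by rewrite !Z // ?E1 ?E2 eqxx ?orbT.
Qed.

Lemma lsum_shift_le i f : (forall x, 0 <= f x) ->
  (forall x, f x != 0 -> x 0 i < B%:R) ->
  lsum (fun x => f (x + h *: e i)) <= lsum f.
Proof.
move=> fge0 f0; rewrite (lsum_rot i f) ler_pM2l ?exprn_gt0 ?lstep_gt0 //.
apply: ler_sum => u _.
case: (boolP ((u i).+1 < 2 * (B * 2 ^ m))%N) => [lt|/negbTE lt].
  by rewrite lpt_rot.
have [E1 E2] := lpt_rot_last lt.
suff -> : f (lpt u + h *: e i) = 0 by [].
by apply/eqP; apply: contraTT isT => /f0; rewrite E2 ltxx.
Qed.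

Lemma coord_shift x i (t : R) : (x + t *: e i) 0 i = x 0 i + t.
Proof. by rewrite !mxE !eqxx mulr1. Qed.

Lemma coord_shift_neq x i j (t : R) : j != i -> (x + t *: e i) 0 j = x 0 j.
Proof. by move=> /negbTE ji; rewrite !mxE ji andbF mulr0 addr0. Qed.

Lemma lsum_shiftn_le i f k : (forall x, 0 <= f x) ->
  (forall x, f x != 0 -> x 0 i < B%:R) ->
  lsum (fun x => f (x + (k%:R * h) *: e i)) <= lsum f.
Proof.
move=> fge0 f0; elim: k => [|k IH].
  by apply: ler_lsum => x; rewrite mul0r scale0r addr0.
apply: le_trans IH.
rewrite (@eq_lsum _ (fun x => (fun y => f (y + (k%:R * h) *: e i)) (x + h *: e i))).
  apply: (@lsum_shift_le i (fun y => f (y + (k%:R * h) *: e i))) => // x /f0.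
  rewrite coord_shift; apply: le_lt_trans.
  by rewrite lerDl mulr_ge0 // ltW // lstep_gt0.
by move=> x /=; rewrite -addrA -scalerDl -{2}[h]mul1r -mulrDl nat1r.
Qed.

Lemma lsum_shiftn i f k :
  (forall x, f x != 0 -> - B%:R + k%:R * h < x 0 i + h /\ x 0 i < B%:R) ->
  lsum (fun x => f (x + (k%:R * h) *: e i)) = lsum f.
Proof.
elim: k => [|k IH] f0.
  by apply: eq_lsum => x; rewrite mul0r scale0r addr0.
rewrite -IH; last first.
  move=> x /f0[a b]; split=> //; apply: lt_trans a.
  by rewrite ltrD2l ltr_pM2r ?lstep_gt0 // ltr_nat.
rewrite -[RHS](@lsum_shift i).
  by apply: eq_lsum => x /=; rewrite -addrA -scalerDl -{2}[h]mul1r -mulrDl nat1r.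
move=> x /f0[]; rewrite coord_shift -natr1 mulrDl mul1r addrA ltrD2r ltrD2r => a b.
rewrite a /=; apply: le_lt_trans b.
by rewrite lerDl mulr_ge0 // ltW // lstep_gt0.
Qed.

(** The support condition keeps f away from the layer where the rotation of the
lattice is not a translation. *)
Lemma lsum_by_parts i f g :
  (forall x, f x != 0 -> - B%:R < x 0 i + h < B%:R) ->
  lsum (fun x => f x * (g (x + h *: e i) - g x)) =
  lsum (fun x => (f (x - h *: e i) - f x) * g x).
Proof.
move=> f0.
rewrite (@eq_lsum _ (fun x => f x * g (x + h *: e i) - f x * g x)) => [|x]; last exact: mulrBr.
rewrite [RHS](@eq_lsum _ (fun x => f (x - h *: e i) * g x - f x * g x)) => [|x]; last exact: mulrBl.
rewrite !lsumB; congr (_ - _).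
rewrite -(@lsum_shift i (fun x => f (x - h *: e i) * g x)).
  by apply: eq_lsum => x; rewrite addrK.
move=> x; rewrite mulf_eq0 negb_or => /andP[/f0 H _].
by move: H; rewrite -scaleNr coord_shift subrK.
Qed.

(** A bound for one difference quotient in the direction i, the discrete form of
|d_i f| <= Lam. *)
Definition lip_step i f Lam := forall x, `|f (x + h *: e i) - f x| <= h * Lam x.

Lemma lip_stepn i f Lam k x : lip_step i f Lam ->
  `|f (x + (k%:R * h) *: e i) - f x| <=
  h * \sum_(0 <= j < k) Lam (x + (j%:R * h) *: e i).
Proof.
move=> L; elim: k => [|k IH].
  by rewrite mul0r scale0r addr0 subrr normr0 big_nil mulr0.
rewrite big_nat_recr //= mulrDr [leRHS]addrC.
have -> : x + (k.+1%:R * h) *: e i = x + (k%:R * h) *: e i + h *: e i.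
  by rewrite -addrA -scalerDl -{3}[h]mul1r -mulrDl natr1.
have -> : f (x + (k%:R * h) *: e i + h *: e i) - f x =
  (f (x + (k%:R * h) *: e i + h *: e i) - f (x + (k%:R * h) *: e i)) +
  (f (x + (k%:R * h) *: e i) - f x) by rewrite addrA subrK.
by apply: le_trans (ler_normD _ _) _; apply: lerD => //; exact: L.
Qed.

(** Follow the line in the direction i up to the far face of the box, where f
vanishes; each of the 2 B 2^m steps costs at most one translate of Lam. *)
Lemma lsum_poincare i f Lam : (forall x, 0 <= Lam x) -> lip_step i f Lam ->
  (forall x, Lam x != 0 -> x 0 i < B%:R) ->
  (forall x, f x != 0 -> x 0 i < B%:R) ->
  lsum (fun x => `|f x|) <= (2 * B)%:R * lsum Lam.
Proof.
move=> L0 L LB fB; set k := (2 * B * 2 ^ m)%N.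
have kh : k%:R * h = 2 * B%:R.
  by rewrite /k -mulnA natrM -mulrA Bh.
have fx x : - B%:R <= x 0 i ->
   `|f x| <= h * \sum_(0 <= j < k) Lam (x + (j%:R * h) *: e i).
  move=> xB; have := lip_stepn k x L.
  have -> : f (x + (k%:R * h) *: e i) = 0; last by rewrite sub0r normrN.
  apply/eqP; apply: contraTT isT => /fB; rewrite coord_shift kh.
  by move: xB; rewrite mulr_natl mulr2n => xB; rewrite ltNge (le_trans _ (lerD xB (lexx _))) // addKr.
apply: (@le_trans _ _ (lsum (fun x => h * \sum_(0 <= j < k) Lam (x + (j%:R * h) *: e i)))).
  by apply: ler_lsum_box => x xB; apply: fx; case/andP: (xB i).
rewrite lsumZ lsum_sum.
apply: (@le_trans _ _ (h * \sum_(0 <= j < k) lsum Lam)).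
  rewrite ler_pM2l ?lstep_gt0 //; apply: ler_sum => j _.
  exact: lsum_shiftn_le.
by rewrite sumr_const_nat subn0 -[_ *+ k]mulr_natl mulrA [h * _]mulrC kh natrM.
Qed.

Definition lsum_on (P : pred 'rV[R]_n) f := lsum (fun x => (P x)%:R * f x).

(** Cut a box into two halves P1 and P2 in the direction i.  The sum over P2 is a
translate of the sum over P1 by w, so the two sums differ by at most w times the
sum of Lam over the box.  The predicate O describes the other directions. *)
Lemma lsum_on_halves (O : pred 'rV[R]_n) i (a : R) k f Lam :
  (forall x t, O (x + t *: e i) = O x) -> (forall x, 0 <= Lam x) -> lip_step i f Lam ->
  (0 < k)%N -> - B%:R <= a -> a + (2 * k)%:R * h <= B%:R ->
  let w := k%:R * h in
  let P1 : pred 'rV[R]_n := fun x => O x && (a <= x 0 i < a + w) in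
  let P2 : pred 'rV[R]_n := fun x => O x && (a + w <= x 0 i < a + w + w) in
  let P : pred 'rV[R]_n := fun x => O x && (a <= x 0 i < a + w + w) in
  `|2 * lsum_on P1 f - lsum_on P f| <= w * lsum_on P Lam /\
  `|2 * lsum_on P2 f - lsum_on P f| <= w * lsum_on P Lam.
Proof.
move=> OO L0 L k0 aB aB2 w P1 P2 P.
have h0 := lstep_gt0.
have w0 : 0 < w by rewrite mulr_gt0 // ltr0n.
have aww : a + w + w <= B%:R by rewrite -addrA -mulr2n -[w *+ 2]mulr_natl /w mulrA -natrM.
have PE x : (P x)%:R = (P1 x)%:R + (P2 x)%:R :> R.
  rewrite /P /P1 /P2; case: (O x) => /=; last by rewrite addr0.
  have [xw|xw] := ltP (x 0 i) (a + w).
    have -> : x 0 i < a + w + w by apply: lt_trans xw _; rewrite ltrDl.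
    by rewrite andbT addr0.
  have -> : a <= x 0 i by apply: le_trans xw; rewrite lerDl ltW.
  by rewrite add0r.
have SE : lsum_on P f = lsum_on P1 f + lsum_on P2 f.
  by rewrite /lsum_on -lsumD; apply: eq_lsum => x; rewrite PE mulrDl.
have S2 : lsum_on P2 f = lsum (fun x => (P1 x)%:R * f (x + w *: e i)).
  rewrite /lsum_on -(@lsum_shiftn i _ k).
    apply: eq_lsum => x; rewrite -/w; congr (_%:R * _).
    by rewrite /P1 /P2 OO coord_shift lerD2r ltrD2r.
  move=> x; rewrite mulf_eq0 negb_or pnatr_eq0 eqb0 negbK => /andP[/andP[_ /andP[b c]] _].
  split; last exact: lt_le_trans c aww.
  by apply: le_lt_trans (lerD aB (lexx _)) _; apply: le_lt_trans b _; rewrite ltrDl.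
have D : `|lsum_on P1 f - lsum_on P2 f| <= w * lsum_on P Lam.
  rewrite S2 /lsum_on -lsumB; apply: le_trans (lsum_norm _) _.
  apply: (@le_trans _ _ (lsum (fun x => h * \sum_(0 <= j < k)
      (P1 x)%:R * Lam (x + (j%:R * h) *: e i)))).
    apply: ler_lsum => x; rewrite -mulrBr normrM ger0_norm // distrC -mulr_sumr mulrCA.
    by apply: ler_wpM2l => //; exact: lip_stepn.
  rewrite lsumZ lsum_sum /w [_ * h]mulrC -mulrA; apply: ler_wpM2l; first exact: ltW.
  rewrite mulr_natl -[k in leRHS]subn0 -sumr_const_nat.
  apply: ler_sum_nat => j /andP[_ jk].
  apply: (@le_trans _ _ (lsum (fun x => (P (x + (j%:R * h) *: e i))%:R * Lam (x + (j%:R * h) *: e i)))).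
    apply: ler_lsum => x; apply: ler_wpM2r => //; rewrite ler_nat.
    rewrite /P /P1 OO coord_shift; case: (O x) => //=.
    case: (boolP (a <= x 0 i < a + w)) => // /andP[b c].
    have jh0 : 0 <= j%:R * h by rewrite mulr_ge0 // ltW.
    have -> : a <= x 0 i + j%:R * h by rewrite (le_trans b) // lerDl.
    by rewrite (lt_le_trans (ltrD c (_ : j%:R * h < w))) // ltr_pM2r // ltr_nat.
  apply: (lsum_shiftn_le (f := fun x => (P x)%:R * Lam x)) => [x|x]; first by rewrite mulr_ge0.
  rewrite mulf_eq0 negb_or pnatr_eq0 eqb0 negbK => /andP[/andP[_ /andP[_ c]] _].
  exact: lt_le_trans c aww.
rewrite SE; split.
  by rewrite mulr_natl mulr2n opprD addrACA subrr add0r.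
by rewrite mulr_natl mulr2n opprD addrACA subrr addr0 distrC.
Qed.

Definition dfloor (j : nat) (t : R) : int := Num.floor (2 ^+ j * t).

Definition same_cube j y : pred 'rV[R]_n :=
  fun x => [forall i, dfloor j (x 0 i) == dfloor j (y 0 i)].

Lemma dfloor_eq j (t : R) (a : int) :
  (dfloor j t == a) = (a%:~R * 2 ^- j <= t < a%:~R * 2 ^- j + 2 ^- j).
Proof.
have p0 : 0 < 2 ^+ j :> R by rewrite exprn_gt0.
rewrite -[X in _ + X]mul1r -mulrDl ler_pdivrMr // ltr_pdivlMr // [t * _]mulrC.
have -> : a%:~R + 1 = (a + 1)%:~R :> R by rewrite intrD.
by rewrite -floor_eq.
Qed.

Lemma half_pow j : 2 ^- j = 2 ^- j.+1 + 2 ^- j.+1 :> R.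
Proof.
have -> : 2 ^- j.+1 = 2^-1 * 2 ^- j :> R by rewrite exprS invfM.
by move: (2 ^- j) => u; field.
Qed.

Lemma dfloor_half j (t : R) : 
  dfloor j.+1 t = 2 * dfloor j t \/ dfloor j.+1 t = 2 * dfloor j t + 1.
Proof.
have p0 : 0 < 2 ^+ j.+1 :> R by rewrite exprn_gt0.
have : dfloor j t == dfloor j t by [].
rewrite dfloor_eq => /andP[].
set a := dfloor j t.
have E : 2 ^- j = 2 * 2 ^- j.+1 :> R by rewrite exprS invfM mulrA divff ?mul1r // pnatr_eq0.
rewrite E => a1 a2.
have [tl|tl] := ltP t (a%:~R * (2 * 2 ^- j.+1) + 2 ^- j.+1); [left|right]; apply/eqP;
  rewrite dfloor_eq ?intrD intrM.
  by rewrite -[2%:~R]/(2:R) mulrAC [_ * a%:~R]mulrC a1.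
rewrite -[2%:~R]/(2:R) -[1%:~R]/(1:R) mulrDl mul1r mulrAC [_ * a%:~R]mulrC tl /=.
rewrite -addrA; have -> : 2 ^- j.+1 + 2 ^- j.+1 = 2 * 2 ^- j.+1 :> R; last by [].
by rewrite mulr_natl mulr2n.
Qed.

(** The box that has already been halved in the first c directions: it interpolates
between the cubes of levels j and j.+1. *)
Definition hybrid_cube j y c : pred 'rV[R]_n :=
  fun x => [forall i : 'I_n, if (i < c)%N then dfloor j.+1 (x 0 i) == dfloor j.+1 (y 0 i)
     else dfloor j (x 0 i) == dfloor j (y 0 i)].

Lemma dfloorS j (s t : R) : dfloor j.+1 s == dfloor j.+1 t -> dfloor j s == dfloor j t.
Proof.
move=> /eqP st.
have := dfloor_half j s; have := dfloor_half j t; rewrite st.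
by move: (dfloor j s) (dfloor j t) (dfloor j.+1 t) => a b c; lia.
Qed.

Lemma hybrid_sub j y c x : hybrid_cube j y c x -> same_cube j y x.
Proof.
move=> /forallP H; apply/forallP => i; have := H i.
by case: ifP => // _; exact: dfloorS.
Qed.

(** Halve the cube one direction after the other by [lsum_on_halves]; the error of
every later step is bounded by the sum over the original cube. *)
Lemma cube_halving j y f Lam :
  (j < m)%N -> (forall i, - B%:R + 1 <= y 0 i /\ y 0 i + 1 <= B%:R) ->
  (forall x, 0 <= Lam x) -> (forall i, lip_step i f Lam) ->
  `|2 ^+ n * lsum_on (same_cube j.+1 y) f - lsum_on (same_cube j y) f| <=
  2 ^+ n * 2 ^- j.+1 * lsum_on (same_cube j y) Lam.
Proof.
move=> jm yB L0 L.
set T := lsum_on (same_cube j y) Lam.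
have T0 : 0 <= T by apply: lsum_ge0 => x; rewrite mulr_ge0.
pose w : R := 2 ^- j.+1.
have w0 : 0 < w by rewrite invr_gt0 exprn_gt0.
have E : 2 ^- j = w + w :> R.
  exact: half_pow.
have E1 : w + w <= 1 by rewrite -E invf_le1 ?exprn_gt0 // exprn_ege1 // ler1n.
have wk : w = (2 ^ (m - j.+1))%:R * h.
  rewrite /w /lstep natrX; apply: (@mulIf _ (2 ^+ m)); first by rewrite expf_neq0 // pnatr_eq0.
  rewrite -mulrA mulVf ?mulr1 ?expf_neq0 ?pnatr_eq0 //.
  rewrite -{1}(subnK jm) exprD mulrC -mulrA divff ?mulr1 // expf_neq0 // pnatr_eq0.
have step c : (c < n)%N ->
  `|2 * lsum_on (hybrid_cube j y c.+1) f - lsum_on (hybrid_cube j y c) f| <= w * T.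
  move=> cn; pose i0 := Ordinal cn.
  pose O : pred 'rV[R]_n := fun x => [forall i : 'I_n, (i != i0) ==>
     if (i < c)%N then dfloor j.+1 (x 0 i) == dfloor j.+1 (y 0 i)
     else dfloor j (x 0 i) == dfloor j (y 0 i)].
  have OO x t : O (x + t *: e i0) = O x.
    apply: eq_forallb => i; case: (eqVneq i i0) => //= ii0.
    by rewrite !coord_shift_neq.
  pose a : R := (dfloor j (y 0 i0))%:~R * 2 ^- j.
  have : dfloor j (y 0 i0) == dfloor j (y 0 i0) by [].
  rewrite dfloor_eq -/a E => /andP[ay ya]; have [yB1 yB2] := yB i0.
  have aB : - B%:R <= a by move: (w) E1 ya yB1 => w' E1 ya yB1; lra.
  have aB2 : a + (2 * 2 ^ (m - j.+1))%:R * h <= B%:R.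
    by rewrite natrM -mulrA -wk; move: (w) E1 ay yB2 => w' E1 ay yB2; lra.
  have [H1 H2] := lsum_on_halves OO L0 (L i0) (expn_gt0 2 _) aB aB2.
  have splitO (P : pred 'I_n) : [forall i, P i] = [forall i, (i != i0) ==> P i] && P i0.
    apply/forallP/andP => [H|[/forallP H P0] i].
      by split; [apply/forallP => i; rewrite H implybT|exact: H].
    by case: (eqVneq i i0) => [->//|ii0]; move: (H i); rewrite ii0.
  have RE x : hybrid_cube j y c x = O x && (a <= x 0 i0 < a + w + w).
    rewrite /hybrid_cube splitO ltnn dfloor_eq -/a E addrA.
    by congr (_ && _).
  have RE1 x : hybrid_cube j y c.+1 x = O x && (dfloor j.+1 (x 0 i0) == dfloor j.+1 (y 0 i0)).
    rewrite /hybrid_cube splitO leqnn; congr (_ && _).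
    apply: eq_forallb => i; case: (eqVneq i i0) => //= ii0.
    by rewrite ltnS leq_eqVlt; case: eqP => //= ic; case/eqP: ii0; apply/val_inj.
  have onE P Q F : (forall x, P x = Q x) -> lsum_on P F = lsum_on Q F.
    by move=> PQ; apply: eq_lsum => x; rewrite PQ.
  have TT : lsum_on (hybrid_cube j y c) Lam <= T.
    apply: ler_lsum => x; apply: ler_wpM2r => //; rewrite ler_nat.
    case: (boolP (hybrid_cube j y c x)) => // /hybrid_sub ->; by [].
  rewrite -wk in H1 H2.
  apply: (@le_trans _ _ (w * lsum_on (hybrid_cube j y c) Lam)); last by apply: ler_wpM2l => //; exact: ltW.
  rewrite (onE _ _ f RE) (onE _ _ Lam RE).
  have aE : (2 * dfloor j (y 0 i0))%:~R * 2 ^- j.+1 = a :> R.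
    by rewrite /a E -/w intrM -[2%:~R]/(2:R) mulrDr mulr_natl mulr2n mulrDl.
  have aE1 : (2 * dfloor j (y 0 i0) + 1)%:~R * 2 ^- j.+1 = a + w :> R.
    by rewrite intrD mulrDl aE mul1r.
  case: (dfloor_half j (y 0 i0)) => yE.
    rewrite (onE _ (fun x => O x && (a <= x 0 i0 < a + w)) f) // => x.
    by rewrite RE1 yE dfloor_eq aE.
  rewrite (onE _ (fun x => O x && (a + w <= x 0 i0 < a + w + w)) f) // => x.
  by rewrite RE1 yE dfloor_eq aE1.
have main c : (c <= n)%N ->
  `|2 ^+ c * lsum_on (hybrid_cube j y c) f - lsum_on (same_cube j y) f| <= (2 ^+ c - 1) * (w * T).
  elim: c => [|c IH] cn.
    have -> : lsum_on (hybrid_cube j y 0) f = lsum_on (same_cube j y) f by [].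
    by rewrite expr0 mul1r !subrr normr0 mul0r.
  have -> : 2 ^+ c.+1 * lsum_on (hybrid_cube j y c.+1) f - lsum_on (same_cube j y) f =
    2 ^+ c * (2 * lsum_on (hybrid_cube j y c.+1) f - lsum_on (hybrid_cube j y c) f)
    + (2 ^+ c * lsum_on (hybrid_cube j y c) f - lsum_on (same_cube j y) f).
    by rewrite exprS; move: (lsum_on _ f) (lsum_on _ f) (lsum_on _ f) (2 ^+ c) => *; ring.
  apply: le_trans (ler_normD _ _) _.
  have -> : (2 ^+ c.+1 - 1) * (w * T) = 2 ^+ c * (w * T) + (2 ^+ c - 1) * (w * T).
    by rewrite -mulrDl exprS; congr (_ * _); ring.
  apply: lerD; last exact: IH (ltnW cn).
  by rewrite normrM ger0_norm ?exprn_ge0 //; apply: ler_wpM2l; [exact: exprn_ge0|exact: step].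
have -> : lsum_on (same_cube j.+1 y) f = lsum_on (hybrid_cube j y n) f.
  by apply: eq_lsum => x; rewrite /hybrid_cube; congr (_%:R * _); congr (nat_of_bool _);
    apply: eq_forallb => i; rewrite ltn_ord.
apply: le_trans (main n (leqnn n)) _; rewrite -mulrA; apply: ler_wpM2r.
  by rewrite mulr_ge0 // ltW.
by rewrite gerDl oppr_le0.
Qed.

Lemma lsum_cube_finest y : (forall i, - B%:R <= y 0 i < B%:R) ->
  lsum_on (same_cube m y) (fun=> 1) = h ^+ n.
Proof.
move=> yB; rewrite /lsum_on /lsum.
have h0 := lstep_gt0.
have fl (u : lindex) i : dfloor m (lpt u 0 i) = (u i)%:Z - (B * 2 ^ m)%:Z.
  apply/eqP; rewrite dfloor_eq mxE intrB -Bh -mulrBl -/h lexx /=.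
  by rewrite ltrDl.
have rng i : (0 <= dfloor m (y 0 i) + (B * 2 ^ m)%:Z)%R /\
   (dfloor m (y 0 i) + (B * 2 ^ m)%:Z < (2 * (B * 2 ^ m))%:Z)%R.
  have := yB i; have p0 : 0 < 2 ^+ m :> R by rewrite exprn_gt0.
  rewrite -(ler_pM2l p0) -(ltr_pM2l p0) => /andP[a b].
  have BE : 2 ^+ m * B%:R = ((B * 2 ^ m)%:Z)%:~R :> R by rewrite -pmulrn natrM natrX mulrC.
  have a' : (- (B * 2 ^ m)%:Z <= dfloor m (y 0 i))%R.
    by rewrite /dfloor floor_ge_int intrN -BE -mulrN.
  have b' : (dfloor m (y 0 i) < (B * 2 ^ m)%:Z)%R.
    by rewrite /dfloor floor_lt_int -BE.
  by move: a' b'; move: (dfloor _ _) => z; lia.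
pose z i : int := dfloor m (y 0 i) + (B * 2 ^ m)%:Z.
have lt i : (`|z i|%N < 2 * (B * 2 ^ m))%N.
  by rewrite /z; have := rng i; move: (dfloor _ _) => t; lia.
pose u0 : lindex := [ffun i => Ordinal (lt i)].
rewrite (bigD1 u0) //= big1 => [|u uu0]; last first.
  suff -> : same_cube m y (lpt u) = false by rewrite mul0r.
  apply/negbTE; apply: contra uu0 => /forallP H; apply/eqP/ffunP => i; apply/val_inj.
  rewrite ffunE /= /z; have := H i; rewrite fl => /eqP <-; by rewrite subrK.
have -> : same_cube m y (lpt u0).
  apply/forallP => i; rewrite fl ffunE /= /z.
  by have := rng i; move: (dfloor _ _) => t; lia.
by rewrite addr0 !mulr1.
Qed.

(** A cube of level j is 2^n cubes of level j.+1 of equal weight, by [cube_halving]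
for a constant function; a cube of level m contains one lattice point. *)
Lemma lsum_cube j y : (j <= m)%N -> (forall i, - B%:R + 1 <= y 0 i /\ y 0 i + 1 <= B%:R) ->
  lsum_on (same_cube j y) (fun=> 1) = (2 ^- j) ^+ n.
Proof.
move=> jm yB.
have [k ->] : exists k, j = (m - k)%N by exists (m - j)%N; rewrite subKn.
elim: k => [|k IH].
  rewrite subn0 lsum_cube_finest // => i; have [a b] := yB i.
  by move: a b; move: (y 0 i) => t a b; apply/andP; split; lra.
have [mk|mk] := leqP m k.
  by have -> : (m - k.+1 = m - k)%N by lia.
have E : (m - k = (m - k.+1).+1)%N by lia.
have jlt : (m - k.+1 < m)%N by lia.
have := @cube_halving (m - k.+1) y (fun=> 1) (fun=> 0) jlt yB (fun=> lexx _).
have Z : lsum_on (same_cube (m - k.+1) y) (fun=> 0) = 0.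
  by rewrite /lsum_on (@eq_lsum _ (fun x => 0 * 0)) ?lsumZ ?mul0r // => x; rewrite !mulr0.
rewrite Z mulr0 -E IH => /(_ _)/wrap[]; first by move=> i x; rewrite subrr normr0 mulr0.
rewrite normr_le0 subr_eq0 => /eqP <-.
by rewrite E -exprMn exprS invfM mulrA divff ?mul1r // pnatr_eq0.
Qed.

End LatticeSums.

(** * Distance to a compact set *)

Section SupDistance.
Context {R : realType} {V : normedModType R}.
Variable S : set V.
Hypothesis S0 : S !=set0.
Implicit Types x y z : V.

(** The distance of the ambient norm, which on row vectors is the sup norm; it is
compared with the Euclidean distance in [polygon_dist_to]. *)
Definition sdist x : R := inf [set `|x - y| | y in S].

Let lb x : has_lbound [set `|x - y| | y in S].
Proof. by exists 0 => _ [y _ <-]. Qed.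

Lemma sdist_le x y : S y -> sdist x <= `|x - y|.
Proof. by move=> Sy; apply: ge_inf => //; exists y. Qed.

Lemma sdist_ge x c : (forall y, S y -> c <= `|x - y|) -> c <= sdist x.
Proof.
case: S0 => y0 Sy0 H; apply: lb_le_inf; first by exists `|x - y0|, y0.
by move=> _ [y Sy <-]; exact: H.
Qed.

Lemma sdist_ge0 x : 0 <= sdist x. Proof. exact: sdist_ge. Qed.

Lemma sdist_lt x c : sdist x < c -> exists2 y, S y & `|x - y| < c.
Proof.
move=> xc; apply: contrapT => H; suff : c <= sdist x by rewrite leNgt xc.
apply: sdist_ge => y Sy; rewrite leNgt; apply/negP => yc.
by apply: H; exists y.
Qed.

Lemma sdist_lip x y : sdist x <= sdist y + `|x - y|.
Proof.
rewrite -lerBlDr; apply: sdist_ge => z Sz; rewrite lerBlDr.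
apply: le_trans (sdist_le x Sz) _; rewrite [leRHS]addrC.
exact: ler_distD.
Qed.

Lemma sdist_lipN x y : `|sdist x - sdist y| <= `|x - y|.
Proof.
have := sdist_lip y x; have := sdist_lip x y; rewrite (distrC y x) ler_norml.
by move: `|_ - _| (sdist _) (sdist _) => *; apply/andP; split; lra.
Qed.

Lemma sdist_eq0 x : S x -> sdist x = 0.
Proof.
by move=> Sx; apply/eqP; rewrite eq_le sdist_ge0 (le_trans (sdist_le x Sx)) // subrr normr0.
Qed.

Lemma sdist_continuous : continuous sdist.
Proof.
move=> x; apply/cvgrPdist_lt => e e0; near=> y.
apply: le_lt_trans (sdist_lipN x y) _; near: y.
by apply: cvgr_dist_lt.
Unshelve. all: by end_near. Qed.

End SupDistance.

Section Shell.
Context {R : realType} {n : nat}.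
Variable S : set 'rV[R]_n.
Hypothesis S0 : S !=set0.
Hypothesis cS : compact S.
Local Notation D := (sdist S).

Lemma shell_compact (a b : R) (C : set 'rV[R]_n) : closed C ->
  compact ([set x | a <= D x <= b] `&` C).
Proof.
move=> cC; apply: bounded_closed_compact.
  have [M [_ HM]] := compact_bounded cS.
  exists (M + 1 + b + 1); split; first exact: num_real.
  move=> t Mt x [/andP[_ xb] _].
  have /(sdist_lt S0)[y Sy xy] : D x < b + 1 by rewrite (le_lt_trans xb) // ltrDl.
  have yM : `|y| <= M + 1 by apply: HM => //; rewrite ltrDl.
  apply/ltW/(lt_trans _ Mt); rewrite -(subrK y x).
  apply: le_lt_trans (ler_normD _ _) _; rewrite addrC -addrA; exact: ler_ltD.
apply: closedI => //.
rewrite (_ : [set x | _] = (D @^-1` [set y | a <= y]) `&` (D @^-1` [set y | y <= b])).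
  apply: closedI; apply: closed_comp => [x _|]; try exact: sdist_continuous.
    exact: closed_ge.
  exact: closed_le.
by apply/seteqP; split => x /= => [/andP[]|[-> ->]].
Qed.

End Shell.

(** * Cutoff functions from completeness *)

Section NiceRadius.
Context {R : realType} {n : nat}.
Variables (S : set 'rV[R]_n) (phi : 'rV[R]_n -> R) (r : R).
Hypothesis S0 : S !=set0.
Hypothesis cS : compact S.
Hypothesis r0 : 0 < r.
Local Notation D := (sdist S).
Hypothesis phic : forall x, 0 < D x < 4 * r -> {for x, continuous phi}.
Implicit Types x y z w : 'rV[R]_n.

(** On the ball of radius 8 s the metric is comparable to a flat one, since phi
oscillates by at most 1, and the ball stays off S.  The factor 8 leaves room for
the steps of length 2 rho below. *)
Definition nice x (s : R) := 0 <= s <= 1 /\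
  forall z z', `|z - x| < 8 * s -> `|z' - x| < 8 * s ->
    0 < D z < 4 * r /\ `|phi z - phi z'| <= 1.

(** The largest such radius: a 1-Lipschitz function, so that steps of length rho can
be compared with each other. *)
Definition rho x : R := sup [set s | nice x s].

Lemma nice0 x : nice x 0.
Proof. by split; [rewrite lexx ler01|move=> z z'; rewrite mulr0 normr_lt0]. Qed.

Let ub x : has_ubound [set s | nice x s].
Proof. by exists 1 => s [/andP[]]. Qed.

Lemma rho_ge0 x : 0 <= rho x.
Proof. by apply: (ub_le_sup (ub x)); exact: nice0. Qed.

Lemma rho_nice x : nice x (rho x).
Proof.
split.
  rewrite rho_ge0 /=; apply: ge_sup; first by exists 0; exact: nice0.
  by move=> s [/andP[]].
have key z : `|z - x| < 8 * rho x -> exists2 s, nice x s & `|z - x| < 8 * s.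
  rewrite -ltr_pdivrMl // => zx.
  have [s [ns sl]] : exists s, nice x s /\ 8^-1 * `|z - x| < s.
    apply: contrapT => H; suff : rho x <= 8^-1 * `|z - x| by rewrite leNgt zx.
    apply: ge_sup; first by exists 0; exact: nice0.
    by move=> s ns; rewrite leNgt; apply/negP => sl; apply: H; exists s.
  by exists s => //; rewrite -ltr_pdivrMl.
move=> z z' /key[s ns zs] /key[s' ns' zs'].
have [ss|ss] := leP s s'.
  by apply: (ns'.2) => //; apply: lt_le_trans zs _; rewrite ler_pM2l.
by apply: (ns.2) => //; apply: lt_trans zs' _; rewrite ltr_pM2l.
Qed.

Lemma rho_osc x z : `|z - x| < 8 * rho x -> 0 < D z < 4 * r /\ `|phi z - phi x| <= 1.
Proof.
move=> zx; apply: (rho_nice x).2 => //.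
by rewrite subrr normr0 (le_lt_trans _ zx).
Qed.

Lemma rho_lip x x' : rho x <= rho x' + `|x - x'|.
Proof.
have [xx|xx] := leP (rho x) `|x - x'|.
  by rewrite (le_trans xx) // lerDr rho_ge0.
rewrite -lerBlDr; apply: (ub_le_sup (ub x')).
have [/andP[a b] c] := rho_nice x.
split.
  by rewrite subr_ge0 ltW // (le_trans _ b) // gerBl.
have H z : `|z - x'| < 8 * (rho x - `|x - x'|) -> `|z - x| < 8 * rho x.
  move=> zx; apply: le_lt_trans (ler_distD x' _ _) _.
  rewrite (distrC x' x) -ltrBrDr; apply: lt_le_trans zx _.
  by rewrite mulrBr lerD2l lerN2 ler_peMl // ler1n.
by move=> z z' /H ? /H ?; exact: c.
Qed.

Lemma rho_le_sdist x : 8 * rho x <= D x.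
Proof.
apply: (sdist_ge S0) => y Sy; rewrite leNgt; apply/negP => yx.
have [] := @rho_osc x y; first by rewrite distrC.
by rewrite (sdist_eq0 S0 Sy) ltxx.
Qed.

Lemma rho_gt0 x : 0 < D x < 4 * r -> 0 < rho x.
Proof.
move=> xr; have /cvgrPdist_lt /(_ (2^-1)) := phic xr.
have h2 : 0 < 2^-1 :> R by rewrite invr_gt0.
move=> /(_ h2) /nbhs_ballP[e /= e0 He].
have /andP[D0 D4] := xr.
pose s : R := Num.min (Num.min 1 (e / 8)) (Num.min (D x / 8) ((4 * r - D x) / 8)).
have s0 : 0 < s by rewrite !lt_min ltr01 !divr_gt0 // subr_gt0.
have [s1 se] : s <= 1 /\ 8 * s <= e.
  by split; rewrite /s ?ge_min ?lexx // -ler_pdivlMl // mulrC !ge_min lexx ?orbT.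
have [sD sr] : 8 * s <= D x /\ 8 * s <= 4 * r - D x.
  by split; rewrite -ler_pdivlMl // mulrC /s !ge_min lexx ?orbT.
apply: (lt_le_trans s0); apply: (ub_le_sup (ub x)); split; first by rewrite ltW.
have H z : `|z - x| < 8 * s -> 0 < D z < 4 * r /\ `|phi x - phi z| < 2^-1.
  move=> zx; split; last first.
    by apply: He; rewrite -ball_normE /= distrC (lt_le_trans zx).
  have := sdist_lip S0 x z; have := sdist_lip S0 z x; rewrite (distrC x z).
  by move: zx sD sr; move: `|z - x| (8 * s) (D z) (D x) => *; apply/andP; split; lra.
move=> z z' /H[Hz zx] /H[_ zx']; split=> //.
apply: le_trans (ler_distD (phi x) _ _) _.
by rewrite (distrC (phi z)); move: zx zx'; move: `|_ - _| `|_ - _| => *; lra.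
Qed.

Lemma expR_le_near (a b : R) : `|a - b| <= 1 -> expR a <= expR 1 * expR b.
Proof.
move=> H; rewrite -expRD ler_expR -lerBlDr; apply: le_trans H; exact: ler_norm.
Qed.

(** A chain of steps of length at most rho in the collar D <= 2 r, with the cost of
a step x -> x' being e^phi(x) |x - x'|, which is its g-length up to a factor. *)
Inductive reach : 'rV[R]_n -> 'rV[R]_n -> R -> Prop :=
| reach_refl x : reach x x 0
| reach_step x x' y c : `|x - x'| <= rho x -> D x <= 2 * r -> D x' <= 2 * r ->
    reach x' y c -> reach x y (expR (phi x) * `|x - x'| + c).

Lemma reach_ge0 x y c : reach x y c -> 0 <= c.
Proof. by elim=> // *; rewrite addr_ge0 // mulr_ge0 // expR_ge0. Qed.

(** A chain that ends outside of the ball of radius rho(z)/2 has to cross the annulus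
between rho(z)/2 and 2 rho(z), because steps near z are short; the part of the
chain inside the ball costs at least the width of the ball times e^(phi(z) - 1). *)
Lemma reach_exit z x y c : 0 < rho z -> reach x y c ->
  `|x - z| <= 2 * rho z -> D x <= 2 * r -> rho z / 2 <= `|y - z| ->
  exists w c', [/\ reach w y c', rho z / 2 <= `|w - z| <= 2 * rho z, D w <= 2 * r &
    c' + expR (phi z - 1) * (rho z / 2 - `|x - z|) <= c].
Proof.
move=> rz; elim=> {x y c}.
  move=> x xz xr yz; exists x, 0; rewrite xz yz; split=> //; first exact: reach_refl.
  by rewrite add0r mulr_ge0_le0 ?expR_ge0 // subr_le0.
move=> x x' y c xx' xr x'r H IH xz _ yz.
have [xs|xs] := leP (rho z / 2) `|x - z|.
  exists x, (expR (phi x) * `|x - x'| + c); rewrite xs xz; split=> //.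
    exact: reach_step.
  by rewrite gerDl mulr_ge0_le0 ?expR_ge0 // subr_le0.
have rx : rho x <= 3 / 2 * rho z.
  by have := rho_lip x z; move: xs; move: `|_ - _| => *; lra.
have x'z : `|x' - z| <= `|x - z| + `|x - x'|.
  by rewrite [leRHS]addrC (distrC x x'); exact: ler_distD.
have [|w [c' [H1 H2 H3 H4]]] := IH _ x'r yz.
  by move: x'z xx' xs rx; move: `|_ - _| `|_ - _| `|_ - _| => *; lra.
exists w, c'; split => //.
have px : phi z - 1 <= phi x.
  have [|_] := @rho_osc z x; first by move: xs; move: `|x - z| => *; lra.
  by rewrite ler_norml => /andP[]; lra.
have ex : expR (phi z - 1) * `|x - x'| <= expR (phi x) * `|x - x'|.
  by apply: ler_wpM2r => //; rewrite ler_expR.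
have ez : expR (phi z - 1) * `|x' - z| <= expR (phi z - 1) * (`|x - z| + `|x - x'|).
  by apply: ler_wpM2l => //; exact: expR_ge0.
move: ex ez H4; rewrite !mulrBr mulrDr.
by move: (_ * `|_ - _|) (_ * `|_ - _|) (_ * `|_ - _|) (_ * `|_ - _|) (_ * (_ / _)) => *; lra.
Qed.

(** The obstruction to a cutoff: S is closer to z than a, when distances are measured by
the cost of chains. *)
Definition escapes z (a : R) :=
  forall d, 0 < d -> exists y c, [/\ reach z y c, D y < d & c < a].

(** If no point of K escaped, each would stay at some distance d from S at cost below
b, and so would its neighbours, which are one cheap step away; compactness makes d
uniform. *)
Lemma escapes_compact (K : set 'rV[R]_n) (a b : R) : compact K -> b < a ->
  (forall z, K z -> 0 < D z <= 2 * r) ->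
  (forall d, 0 < d -> exists w y c, [/\ K w, reach w y c, D y < d & c < b]) ->
  exists2 z, K z & escapes z a.
Proof.
move=> cK ba KD H; apply: contrapT => nesc.
pose Q w d := forall y c, reach w y c -> D y < d -> b <= c.
have [d d0 Hd] : exists2 d : R, 0 < d & forall w, K w -> Q w d.
  apply: compact_uniform => //.
    by move=> x d d' Qd /andP[_ dd] y c rc yd; apply: (Qd y) => //; exact: lt_le_trans dd.
  move=> z Kz; have /andP[Dz0 Dzr] := KD z Kz.
  have : ~ escapes z a by move=> ez; apply: nesc; exists z.
  move=> /existsNP[d] /not_implyP[d0 Hd].
  have rz : 0 < rho z by apply: rho_gt0; rewrite Dz0 /=; move: r0 Dzr; move: (D z) => *; lra.
  have E0 := expR_gt0 (phi z).
  exists d, (Num.min (rho z) ((a - b) / expR (phi z))); split=> //.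
    by rewrite lt_min rz divr_gt0 // subr_gt0.
  move=> w Kw; rewrite lt_min => /andP[wz]; rewrite ltr_pdivlMr // => wz2 y c rc yd.
  rewrite leNgt; apply/negP => cb; apply: Hd; exists y, (expR (phi z) * `|z - w| + c).
  have /andP[_ Dwr] := KD w Kw.
  split=> //; first by apply: reach_step => //; rewrite distrC ltW.
  by rewrite distrC mulrC; move: wz2 cb; move: (_ * expR _) => *; lra.
have [w [y [c [Kw rc yd cb]]]] := H d d0.
by have := Hd w Kw y c rc yd; rewrite leNgt cb.
Qed.

(** Every cheap chain towards S crosses the annulus around z, which is compact; a
limit point z' of the crossings still escapes, with the budget reduced by the
cost of leaving the ball around z. *)
Lemma escapes_step z a : 0 < D z <= 2 * r -> escapes z a ->
  exists z', [/\ 0 < D z' <= 2 * r, `|z' - z| <= 2 * rho z &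
    escapes z' (a - expR (phi z - 1) * rho z / 4)].
Proof.
move=> /andP[Dz0 Dzr] ez.
have rz : 0 < rho z by apply: rho_gt0; rewrite Dz0 /=; move: r0 Dzr; move: (D z) => *; lra.
have rD := rho_le_sdist z.
have DK w : `|w - z| <= 2 * rho z -> 6 * rho z <= D w.
  move=> wz; have := sdist_lip S0 z w; rewrite distrC.
  by move: wz rD; move: `|_ - _| => *; lra.
pose C : set 'rV[R]_n := [set w | rho z / 2 <= `|w - z| <= 2 * rho z].
have cC : closed C.
  have cn : continuous (fun w => `|w - z|).
    move=> w; apply: (continuous_comp (f := fun w => w - z)); last exact: norm_continuous.
    by apply: continuousB; [exact: id|exact: cst_continuous].
  rewrite (_ : C = ((fun w => `|w - z|) @^-1` [set y | rho z / 2 <= y]) `&`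
     ((fun w => `|w - z|) @^-1` [set y | y <= 2 * rho z])).
    apply: closedI; apply: closed_comp => [x _|]; try exact: cn.
      exact: closed_ge.
    exact: closed_le.
  by apply/seteqP; split => [x /andP[a1 a2]|x [a1 a2]]; [split|apply/andP].
have cK := @shell_compact R n S S0 cS 0 (2 * r) _ cC.
have E0 := expR_gt0 (phi z - 1).
have Er : 0 < expR (phi z - 1) * rho z by rewrite mulr_gt0.
have [| | |z' [z'D z'C] ez'] := @escapes_compact _ (a - expR (phi z - 1) * rho z / 4)
    (a - expR (phi z - 1) * rho z / 2) cK.
- by move: Er; move: (_ * rho z) => *; lra.
- move=> w [/andP[_ wr] /andP[_ /DK wD]]; rewrite wr andbT.
  by apply: lt_le_trans wD; rewrite mulr_gt0.
- move=> d d0; have [|y [c [rc yd ca]]] := ez (Num.min d (7 * rho z)).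
    by rewrite lt_min d0 mulr_gt0.
  have [yd1 yr] : D y < d /\ D y < 7 * rho z by apply/andP; rewrite -lt_min.
  have yz : rho z / 2 <= `|y - z|.
    have := sdist_lip S0 z y; rewrite distrC.
    by move: yr rD; move: `|_ - _| => *; lra.
  have [|w [c' [H1 H2 H3 H4]]] := reach_exit rz rc _ Dzr yz.
  + by rewrite subrr normr0 mulr_ge0 // ltW.
  + exists w, y, c'; split=> //; first by split => //=; rewrite sdist_ge0.
    move: H4; rewrite subrr normr0 subr0 mulrA.
    by move: ca; move: (_ * rho z) => *; lra.
- exists z'; split=> //; last by case/andP: z'C.
  case/andP: z'C => _ /DK wD; case/andP: z'D => _ ->; rewrite andbT.
  by apply: lt_le_trans wD; rewrite mulr_gt0.
Qed.

Lemma escapes_gt0 z a : escapes z a -> 0 < a.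
Proof.
move=> /(_ 1 ltr01)[y [c [/reach_ge0 c0 _ ca]]]; exact: le_lt_trans ca.
Qed.

(** The budgets stay positive and decrease by a multiple of e^phi rho, so these costs
have a bounded sum. *)
Lemma escapes_sequence z a : 0 < D z <= 2 * r -> escapes z a ->
  exists z_ : nat -> 'rV[R]_n, [/\ z_ 0%N = z, forall j, 0 < D (z_ j) <= 2 * r,
   forall j, `|z_ j.+1 - z_ j| <= 2 * rho (z_ j) &
   exists C, forall N, \sum_(0 <= j < N) expR (phi (z_ j)) * rho (z_ j) <= C].
Proof.
move=> Dz ez.
pose good (s : 'rV[R]_n * R) := 0 < D s.1 <= 2 * r /\ escapes s.1 s.2.
have H : forall s, exists s', good s -> [/\ good s', `|s'.1 - s.1| <= 2 * rho s.1 &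
     s'.2 = s.2 - expR (phi s.1 - 1) * rho s.1 / 4].
  move=> s; have [gs|ngs] := pselect (good s); last by exists s.
  have [z' [H1 H2 H3]] := escapes_step gs.1 gs.2.
  by exists (z', s.2 - expR (phi s.1 - 1) * rho s.1 / 4) => _; split.
have [f Hf] := choice H.
pose s_ j := iter j f (z, a).
have sS j : s_ j.+1 = f (s_ j) by [].
have gs j : good (s_ j).
  elim: j => [|j IH]; first exact: (conj Dz ez).
  by rewrite sS; have [gg _ _] := Hf _ IH.
exists (fun j => (s_ j).1); split.
- by [].
- by move=> j; have [gg _] := gs j.
- by move=> j; rewrite sS; have [_ gg _] := Hf _ (gs j).
exists (4 * expR 1 * a) => N.
have E N' : \sum_(0 <= j < N') expR (phi (s_ j).1) * rho (s_ j).1 = 4 * expR 1 * (a - (s_ N').2).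
  elim: N' => [|N' IH]; first by rewrite big_nil /= subrr mulr0.
  rewrite sS; have [_ _ ->] := Hf _ (gs N').
  rewrite big_nat_recr //= IH; move: (s_ N') => q.
  have -> : expR (phi q.1 - 1) = expR (phi q.1) / expR 1 by rewrite expRD expRN.
  have := expR_gt0 (1:R); move: (expR 1) (rho _) (expR (phi q.1)) => e1 b e2 e0.
  by field; rewrite gt_eqF.
rewrite E ler_pM2l ?mulr_gt0 ?expR_gt0 // gerBl.
by have [_ /escapes_gt0/ltW] := gs N.
Qed.

(** The function is T/L, where T is the cost of reaching the set D < d', truncated at
L; a step of length at most rho changes T by at most its cost.  If T were below L
at distance d from S for every d', then compactness would give an escaping point. *)
Lemma cutoff (d eps : R) : 0 < d -> 0 < eps ->
  (forall z a, 0 < D z <= 2 * r -> ~ escapes z a) ->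
  exists (eta : 'rV[R]_n -> R) (d' : R), [/\ 0 < d', forall x, 0 <= eta x <= 1,
    forall x, D x < d' -> eta x = 0,
    forall x, d <= D x <= 2 * r -> eta x = 1 &
    forall x x', D x <= 2 * r -> D x' <= 2 * r -> `|x - x'| <= rho x -> `|x - x'| <= rho x' ->
      `|eta x - eta x'| <= eps * expR (phi x) * `|x - x'|].
Proof.
move=> d0 e0 nesc.
(* the factor e pays for the oscillation of phi along one step *)
pose L : R := expR 1 / eps.
have L0 : 0 < L by rewrite divr_gt0 // expR_gt0.
have [d' d'0 Hd'] : exists2 d' : R, 0 < d' & forall x y c, d <= D x <= 2 * r ->
    reach x y c -> D y < d' -> L <= c.
  apply: contrapT => H.
  have cK := @shell_compact R n S S0 cS d (2 * r) setT closedT.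
  have [| | |z [/andP[zd zr] _]] := @escapes_compact _ (L + 1) L cK.
  - by rewrite ltrDl.
  - by move=> z [/andP[zd zr] _]; rewrite zr andbT (lt_le_trans d0).
  - move=> s s0; apply: contrapT => Hs; apply: H; exists s; first exact: s0.
    move=> x y c xK rc ys.
    by rewrite leNgt; apply/negP => cL; apply: Hs; exists x, y, c.
  - by apply: nesc; rewrite zr andbT (lt_le_trans d0).
pose A x : set R := [set c | c = L \/ exists2 y, reach x y c & D y < d'].
pose T x := inf (A x).
have lbA x : has_lbound (A x).
  by exists 0 => c [->|[y /reach_ge0]] //; exact: ltW.
have AL x : A x L by left.
have TL x : T x <= L by exact: ge_inf.
have Tge x c : (forall t, A x t -> c <= t) -> c <= T x.
  by move=> H; apply: lb_le_inf => //; exists L.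
have T0 x : 0 <= T x by apply: Tge => c [->|[y /reach_ge0]] //; exact: ltW.
have Tlip x x' : D x <= 2 * r -> D x' <= 2 * r -> `|x - x'| <= rho x ->
    T x <= T x' + expR (phi x) * `|x - x'|.
  move=> xr x'r xx'; rewrite -lerBlDr; apply: Tge => t [->|[y rt yd]].
    by rewrite lerBlDr (le_trans (TL x)) // lerDl mulr_ge0 // expR_ge0.
  rewrite lerBlDr addrC; apply: ge_inf => //; right; exists y => //.
  exact: reach_step.
exists (fun x => T x / L), d'; split=> //.
- by move=> x; rewrite divr_ge0 ?(ltW L0) //= ler_pdivrMr // mul1r.
- move=> x xd; suff -> : T x = 0 by rewrite mul0r.
  apply/eqP; rewrite eq_le T0 andbT; apply: ge_inf => //.
  by right; exists x => //; exact: reach_refl.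
- move=> x xd; suff -> : T x = L by rewrite divff // gt_eqF.
  apply/eqP; rewrite eq_le TL /=; apply: Tge => t [->//|[y rt yd]].
  exact: Hd' rt yd.
move=> x x' xr x'r xx xx'.
rewrite -mulrBl normrM [`|L^-1|]gtr0_norm ?invr_gt0 // ler_pdivrMr //.
have -> : eps * expR (phi x) * `|x - x'| * L = expR 1 * expR (phi x) * `|x - x'|.
  by rewrite /L; move: (expR 1) L0 (expR (phi x)) `|_ - _| => a _ b c; field; rewrite gt_eqF.
have p1 : expR (phi x) * `|x - x'| <= expR 1 * expR (phi x) * `|x - x'|.
  rewrite -mulrA ler_peMl ?mulr_ge0 ?expR_ge0 //.
  by rewrite -[1]expR0 ler_expR.
have p2 : expR (phi x') * `|x - x'| <= expR 1 * expR (phi x) * `|x - x'|.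
  have [->|ne] := eqVneq x x'; first by rewrite subrr normr0 !mulr0.
  apply: ler_wpM2r => //; apply: expR_le_near.
  have : 0 < `|x - x'| by rewrite normr_gt0 subr_eq0.
  move=> n0; apply: (rho_osc _).2; rewrite distrC.
  by move: n0 xx; move: `|_ - _| => *; lra.
rewrite ler_norml lerBlDr lerNl opprB lerBlDr.
apply/andP; split.
  rewrite addrC; apply: le_trans (Tlip x' x x'r xr _) _; rewrite distrC //.
  by rewrite lerD2l.
by rewrite addrC (le_trans (Tlip x x' xr x'r xx)) // lerD2l.
Qed.

End NiceRadius.

(** * Polygons of finite length *)

Section FinePartition.
Context {R : realType}.

Lemma fine_partition (c d : R) : 0 <= c -> 0 < d ->
  exists s, itv_partition 0 c s /\ mesh_lt 0 c s d.
Proof.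
move=> c0 d0; have [->|cn0] := eqVneq c 0.
  by exists [::]; split; [split|move=> i].
have {c0 cn0} c0 : 0 < c by rewrite lt_neqAle eq_sym cn0.
pose N := (Num.truncn (c / d)).+1.
have N0 : 0 < N%:R :> R by rewrite ltr0n.
have cN : c / N%:R < d.
  rewrite ltr_pdivrMr // mulrC -ltr_pdivrMr //.
  by have /andP[] := truncn_itv (divr_ge0 (ltW c0) (ltW d0)).
pose t (i : nat) : R := c * i%:R / N%:R.
pose s := [seq t i.+1 | i <- iota 0 N].
have tS i : t i.+1 - t i = c / N%:R.
  by rewrite /t -natr1; move: (i%:R) N%:R N0 => x y y0; field; rewrite gt_eqF.
have nthE i : (i <= N)%N -> nth c (0 :: s) i = t i.
  case: i => [|i] iN /=; first by rewrite /t mulr0 mul0r.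
  by rewrite (nth_map 0%N) ?size_iota // nth_iota.
exists s; split; last first.
  move=> i; rewrite size_map size_iota => iN.
  rewrite (nthE i (ltnW iN)) (nthE i.+1 iN) tS; exact: cN.
split; last first.
  have -> : s = rcons [seq t i.+1 | i <- iota 0 N.-1] (t N).
    by rewrite /s -{1}[N]/(N.-1.+1) -addn1 iotaD map_cat cats1.
  by rewrite last_rcons /t mulfK ?eqxx ?gt_eqF.
apply/(pathP c) => i; rewrite size_map size_iota => iN.
have := nthE i (ltnW iN); have := nthE i.+1 iN => /= -> ->.
by rewrite -subr_gt0 tS divr_gt0.
Qed.

End FinePartition.

Section EuclideanNorm.
Context {R : realType} {n : nat}.

Lemma enorm_le (v : 'rV[R]_n) : enorm v <= n%:R * `|v|.
Proof.
have -> : n%:R * `|v| = Num.sqrt ((n%:R * `|v|) ^+ 2) by rewrite sqrtr_sqr ger0_norm // mulr_ge0.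
apply: ler_wsqrtr.
apply: (@le_trans _ _ (\sum_(i < n) `|v| ^+ 2)).
  apply: ler_sum => i _; rewrite -[v 0 i ^+ 2]real_normK ?num_real //.
  rewrite lerXn2r // ?nnegrE // [leRHS]/Num.norm /= mx_normrE.
  by apply/bigmax_geP; right; exists (0, i).
rewrite sumr_const card_ord -[_ *+ n]mulr_natl exprMn; apply: ler_wpM2r; first exact: sqr_ge0.
by rewrite -natrX ler_nat; case: (n) => // m; rewrite leq_pmulr.
Qed.

Lemma qform_conformal (a : R) (v : 'rV[R]_n) :
  Num.sqrt (qform (expR (2 * a) *: 1%:M) v) = expR a * enorm v.
Proof.
have -> : qform (expR (2 * a) *: 1%:M) v = expR a ^+ 2 * \sum_i v 0 i ^+ 2.
  rewrite -expRM_natl /qform mulr_sumr; apply: eq_bigr => i _.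
  rewrite (bigD1 i) //= big1 ?addr0 => [|j /negbTE ji].
    by rewrite !mxE eqxx mulr1n mulr1 -mulrA expr2.
  by rewrite !mxE eq_sym ji mulr0n mulr0 !mul0r.
by rewrite sqrtrM ?sqr_ge0 // sqrtr_sqr ger0_norm ?expR_ge0.
Qed.

Lemma qform_euclidean (v : 'rV[R]_n) x : Num.sqrt (qform (euclidean_metric x) v) = enorm v.
Proof.
have := qform_conformal 0 v; rewrite mulr0 expR0 scale1r mul1r => <-.
by [].
Qed.

End EuclideanNorm.

Lemma clamp_lip (R : realType) (u v : R) :
  `|Num.max 0 (Num.min 1 u) - Num.max 0 (Num.min 1 v)| <= `|u - v|.
Proof.
rewrite ler_norml; have := ler_norm (u - v); have := ler_norm (v - u).
rewrite (distrC v u); move: `|_ - _| => d.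
by case: (leP 1 u) => ?; case: (leP 1 v) => ?; case: (leP 0 u) => ?;
  case: (leP 0 v) => ?; case: (leP (0 : R) 1) => ?; move=> *; apply/andP; split; lra.
Qed.

Section PolygonalCurve.
Context {R : realType} {n : nat}.
Variable z_ : nat -> 'rV[R]_n.
Implicit Types (t c : R) (N : nat).

(** An increasing map of [0, 1) onto [0, +oo); the polygon reaches its j-th vertex at
tau t = j. *)
Definition tau t : R := t / (1 - t).

(** The fraction of the j-th side that has been run through at time t. *)
Definition ramp (j : nat) t : R := Num.max 0 (Num.min 1 (tau t - j%:R)).

Definition polygon t : 'rV[R]_n :=
  let j := Num.truncn (tau t) in
  z_ j + (tau t - j%:R) *: (z_ j.+1 - z_ j).

Lemma tau_le t c : t <= c -> c < 1 -> tau t <= tau c.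
Proof.
move=> tc c1; have t1 := le_lt_trans tc c1.
rewrite /tau ler_pdivrMr ?subr_gt0 // mulrAC ler_pdivlMr ?subr_gt0 //.
by rewrite !mulrBr !mulr1 [c * t]mulrC lerD2r.
Qed.

Lemma tau_ge0 t : 0 <= t < 1 -> 0 <= tau t.
Proof. by move=> /andP[t0 t1]; rewrite divr_ge0 // subr_ge0 ltW. Qed.

Lemma tau_diff s t c : 0 <= s -> s <= t -> t <= c -> c < 1 -> t - s < (1 - c) ^+ 2 ->
  tau t - tau s <= 1.
Proof.
move=> s0 st tc c1 d.
have E : tau t - tau s = (t - s) / ((1 - t) * (1 - s)).
  rewrite /tau; have : 1 - t != 0 by rewrite gt_eqF // subr_gt0 (le_lt_trans tc).
  have : 1 - s != 0 by rewrite gt_eqF // subr_gt0 (le_lt_trans st) // (le_lt_trans tc).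
  by move=> *; field; apply/andP; split.
have p : 0 < (1 - t) * (1 - s).
  by rewrite mulr_gt0 // subr_gt0; [exact: le_lt_trans tc c1|exact: le_lt_trans (le_trans st tc) c1].
rewrite E ler_pdivrMr // mul1r (le_trans (ltW d)) // expr2.
by apply: ler_pM; rewrite ?subr_ge0 ?(ltW c1) // lerD2l lerN2 // (le_trans st).
Qed.

Lemma ramp_ge0 j t : 0 <= ramp j t. Proof. by rewrite le_max lexx. Qed.
Lemma ramp_le1 j t : ramp j t <= 1.
Proof. by rewrite ge_max ler01 ge_min lexx. Qed.

Lemma ramp_le j s t : tau s <= tau t -> ramp j s <= ramp j t.
Proof. by move=> st; apply: le_max2 => //; apply: le_min2 => //; rewrite lerD2r. Qed.

(** In this form increments of the polygon are sums of increments of the ramps, and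
these telescope along a partition. *)
Lemma polygonE N t : 0 <= t < 1 -> tau t < N%:R ->
  polygon t = z_ 0%N + \sum_(0 <= j < N) ramp j t *: (z_ j.+1 - z_ j).
Proof.
move=> t01 tN; rewrite /polygon; set j := Num.truncn _.
have /andP[jt tj] := truncn_itv (tau_ge0 t01); rewrite -/j in jt tj.
have jN : (j < N)%N by rewrite -(ltr_nat R) (le_lt_trans jt).
have E1 : \sum_(0 <= i < j) ramp i t *: (z_ i.+1 - z_ i) = z_ j - z_ 0%N.
  rewrite -telescope_sumr //; apply: eq_big_nat => i /andP[_ ij].
  suff -> : ramp i t = 1 by rewrite scale1r.
  have ij1 : i%:R + 1 <= tau t by rewrite natr1 (le_trans _ jt) // ler_nat.
  rewrite /ramp min_l; last by rewrite lerBrDr addrC.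
  by rewrite max_r.
have E2 : \sum_(j.+1 <= i < N) ramp i t *: (z_ i.+1 - z_ i) = 0.
  rewrite big_nat_cond big1 // => i /andP[/andP[ji _] _].
  suff -> : ramp i t = 0 by rewrite scale0r.
  rewrite /ramp max_l // ge_min subr_le0; apply/orP; right.
  by rewrite (le_trans (ltW tj)) // ler_nat.
have E3 : ramp j t = tau t - j%:R.
  rewrite /ramp min_r; last by rewrite lerBlDr nat1r ltW.
  by rewrite max_r // subr_ge0.
rewrite (big_cat_nat (n := j)) //=; last exact: ltnW.
by rewrite E1 (big_ltn jN) E2 E3 addr0 addrA [z_ 0%N + _]addrC subrK.
Qed.

Lemma ramp_lip j s t : `|ramp j t - ramp j s| <= `|tau t - tau s|.
Proof.
apply: le_trans (clamp_lip _ _) _; rewrite le_eqVlt; apply/orP; left; apply/eqP.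
by congr `|_|; move: (tau t) (tau s) => u v; ring.
Qed.

Lemma polygon_dist N s t : 0 <= s < 1 -> 0 <= t < 1 -> tau s < N%:R -> tau t < N%:R ->
  `|polygon t - polygon s| <= \sum_(0 <= j < N) `|ramp j t - ramp j s| * `|z_ j.+1 - z_ j|.
Proof.
move=> s01 t01 sN tN; rewrite (polygonE s01 sN) (polygonE t01 tN).
rewrite opprD addrACA subrr add0r -sumrB.
apply: le_trans (ler_norm_sum _ _ _) _; apply: ler_sum => j _.
by rewrite -scalerBl normrZ.
Qed.

Lemma tau_lt_nat t : 0 <= t < 1 -> tau t < (Num.truncn (tau t)).+1%:R.
Proof. by move=> t01; have /andP[] := truncn_itv (tau_ge0 t01). Qed.

Lemma tau_continuous t : t < 1 -> {for t, continuous tau}.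
Proof.
move=> t1; apply: continuousM; first exact: id.
apply: continuousV; first by rewrite subr_eq0 gt_eqF.
by apply: continuousB; [exact: cst_continuous|exact: id].
Qed.

Lemma polygon_continuous : {within `[0, 1[, continuous polygon}.
Proof.
apply/subspace_continuousP => t; rewrite /= in_itv /= => t01.
have /andP[t0 t1] := t01.
pose N := (Num.truncn (tau t)).+1.
have tN : tau t < N%:R by exact: tau_lt_nat.
pose C := 1 + \sum_(0 <= j < N) `|z_ j.+1 - z_ j|.
have C0 : 0 < C by rewrite ltr_pwDl // sumr_ge0.
apply/cvgrPdist_lt => e e0.
have /cvgrPdist_lt/(_ (e / C) (divr_gt0 e0 C0)) H1 := tau_continuous t1.
have /cvgrPdist_lt/(_ (N%:R - tau t)) H2 := tau_continuous t1.
have {}H2 := H2 (_ : 0 < _).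
rewrite near_withinE; near=> s => s01; rewrite /= in_itv /= in s01.
have sN : tau s < N%:R.
  have : `|tau t - tau s| < N%:R - tau t by near: s; apply: H2; rewrite subr_gt0.
  by rewrite distrC => /(le_lt_trans (ler_norm _)); rewrite ltrD2r.
apply: le_lt_trans (polygon_dist s01 t01 sN tN) _.
apply: (@le_lt_trans _ _ (\sum_(0 <= j < N) `|tau t - tau s| * `|z_ j.+1 - z_ j|)).
  by apply: ler_sum => j _; apply: ler_wpM2r => //; exact: ramp_lip.
rewrite -mulr_sumr; apply: (@le_lt_trans _ _ (`|tau t - tau s| * C)).
  by apply: ler_wpM2l => //; rewrite lerDr.
rewrite -ltr_pdivlMr //; near: s; exact: H1.
Unshelve. all: by end_near. Qed.

(** Chords are bounded by increments of the ramps, whose total is 1 for each side: a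
partition cannot use a side more than once.  The weight w carries the conformal
factor. *)
Lemma chord_telescope N c s (w : R -> R) (b : nat -> R) :
  0 <= c < 1 -> tau c < N%:R -> itv_partition 0 c s ->
  (forall j, 0 <= b j) -> 
  (forall i, (i < size s)%N ->
     w (nth c (0 :: s) i) * `|polygon (nth c (0 :: s) i.+1) - polygon (nth c (0 :: s) i)| <=
     \sum_(0 <= j < N) (ramp j (nth c (0 :: s) i.+1) - ramp j (nth c (0 :: s) i)) * b j) ->
  \sum_(0 <= i < size s)
     w (nth c (0 :: s) i) * `|polygon (nth c (0 :: s) i.+1) - polygon (nth c (0 :: s) i)|
  <= \sum_(0 <= j < N) b j.
Proof.
move=> c01 cN ps b0 H; set t := nth c (0 :: s).
apply: (@le_trans _ _ (\sum_(0 <= i < size s) \sum_(0 <= j < N)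
   (ramp j (t i.+1) - ramp j (t i)) * b j)).
  by apply: ler_sum_nat => i /andP[_ si]; exact: H.
rewrite exchange_big /=; apply: ler_sum => j _.
rewrite -mulr_suml telescope_sumr //; rewrite -[leRHS]mul1r; apply: ler_wpM2r => //.
by rewrite lerBlDr (le_trans (ramp_le1 _ _)) // lerDl ramp_ge0.
Qed.

End PolygonalCurve.

Section NoEscape.
Context {R : realType} {n : nat}.
Variables (Omega S : set 'rV[R]_n) (g : 'rV[R]_n -> 'M[R]_n) (phi : 'rV[R]_n -> R) (r : R).
Hypothesis S0 : S !=set0.
Hypothesis cS : compact S.
Hypothesis r0 : 0 < r.
Local Notation D := (sdist S).
Local Notation rho := (rho S phi r).
Hypothesis phic : forall x, 0 < D x < 4 * r -> {for x, continuous phi}.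
Hypothesis collar : forall x, D x < 4 * r -> Omega x.
Hypothesis gE : forall x, 0 < D x < 4 * r -> g x = expR (2 * phi x) *: 1%:M.
Hypothesis complete : geodesically_complete_near Omega S g.

(** On a shell away from S both factors are bounded below, since rho is 1-Lipschitz
and positive and phi is continuous. *)
Lemma cost_lower_bound (d : R) : 0 < d ->
  exists2 c : R, 0 < c & forall x, d <= D x <= 2 * r -> c <= expR (phi x) * rho x.
Proof.
move=> d0.
have cK := @shell_compact R n S S0 cS d (2 * r) setT closedT.
have [||c c0 H] := @compact_uniform R _ _ (fun x c => c <= expR (phi x) * rho x) cK.
- by move=> x e e' xe /andP[_ ee]; exact: le_trans xe.
- move=> z [/andP[zd zr] _].
  have rz : 0 < rho z.
    by apply: rho_gt0 => //; rewrite (lt_le_trans d0) //; move: zr r0; move: (D z) => *; lra.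
  exists (expR (phi z - 1) * (rho z / 2)), (rho z / 2); split.
  + by rewrite mulr_gt0 ?expR_gt0 // divr_gt0.
  + by rewrite divr_gt0.
  move=> x _ xz; apply: ler_pM; [exact: expR_ge0|by rewrite divr_ge0 // ltW| |].
    rewrite ler_expR; have [|_] := @rho_osc R n S phi r z x.
      by move: xz rz; move: `|x - z| => *; lra.
    by rewrite ler_norml => /andP[]; move: (phi x) (phi z) => *; lra.
  have := @rho_lip R n S phi r z x; rewrite distrC.
  by move: xz; move: `|x - z| => *; lra.
by exists c => // x xK; apply: H; split.
Qed.

Variable z_ : nat -> 'rV[R]_n.
Hypothesis zD : forall j, 0 < D (z_ j) <= 2 * r.
Hypothesis zS : forall j, `|z_ j.+1 - z_ j| <= 2 * rho (z_ j).
Variable C : R.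
Hypothesis zC : forall N, \sum_(0 <= j < N) expR (phi (z_ j)) * rho (z_ j) <= C.

Local Notation gam := (polygon z_).

Let rz j : 0 < rho (z_ j).
Proof.
apply: rho_gt0 => //; have /andP[-> /=] := zD j.
by move: r0; move: (D _) => *; lra.
Qed.

Let z_close j x : `|x - z_ j| <= 2 * rho (z_ j) ->
  0 < D x < 4 * r /\ `|phi x - phi (z_ j)| <= 1.
Proof.
move=> xz; apply: rho_osc; have := rz j; move: xz; move: `|_ - _| => *; lra.
Qed.

Lemma polygon_close t : 0 <= t < 1 ->
  `|gam t - z_ (Num.truncn (tau t))| <= 2 * rho (z_ (Num.truncn (tau t))).
Proof.
move=> t01; rewrite /polygon; have /andP[a b] := truncn_itv (tau_ge0 t01).
set j := Num.truncn _ in a b *.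
rewrite addrAC subrr add0r normrZ; apply: le_trans (zS j).
rewrite ler_piMl // ger0_norm ?subr_ge0 //.
by rewrite lerBlDr nat1r ltW.
Qed.

(** The costs e^phi rho tend to 0, while they are bounded below at a fixed distance
from S. *)
Lemma vertices_approach : D (z_ j) @[j --> \oo] --> 0.
Proof.
pose u j := expR (phi (z_ j)) * rho (z_ j).
have u0 j : 0 <= u j by rewrite mulr_ge0 ?expR_ge0 // ltW.
have cvgu : cvgn (series u).
  apply: nondecreasing_is_cvgn.
    apply/nondecreasing_seqP => j; rewrite /series /= big_nat_recr //= lerDl.
    exact: u0.
  by exists C => _ [N _ <-]; exact: zC.
have := cvg_series_cvg_0 cvgu => /cvgrPdist_lt ucvg.
apply/cvgrPdist_lt => e e0.
have [c c0 Hc] := cost_lower_bound e0.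
near=> j.
have : `|0 - u j| < c by near: j; exact: ucvg.
rewrite distrC subr0 (ger0_norm (u0 j)) => uc.
rewrite distrC subr0 ger0_norm; last exact: sdist_ge0.
rewrite ltNge; apply/negP => eD.
have := Hc (z_ j); rewrite eD /=; have /andP[_ ->] := zD j => /(_ isT).
by rewrite leNgt uc.
Unshelve. all: by end_near. Qed.

Lemma polygon_dist_to : dist_to S (gam t) @[t --> 1^'-] --> 0%E.
Proof.
have dle x : (0 <= dist_to S x <= (n%:R * D x)%:E)%E.
  apply/andP; split.
    by apply: le_ereal_inf_tmp => _ [y _ <-]; rewrite lee_fin sqrtr_ge0.
  apply/lee_addgt0Pr => e e0.
  have [y Sy yx] : exists2 y, S y & `|x - y| < D x + e / (n%:R + 1).
    by apply: sdist_lt => //; rewrite ltrDl divr_gt0 // ltr_wpDl.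
  apply: ge_ereal_inf; exists (enorm (x - y))%:E; first by exists y.
  rewrite -EFinD lee_fin; apply: le_trans (enorm_le _) _.
  apply: (@le_trans _ _ (n%:R * (D x + e / (n%:R + 1)))).
    by apply: ler_wpM2l => //; exact: ltW.
  rewrite mulrDr lerD2l mulrCA -[leRHS]mulr1; apply: ler_wpM2l; first exact: ltW.
  by rewrite ler_pdivrMr ?ltr_wpDl // mul1r lerDl.
apply: (squeeze_cvge (f := cst 0%E) (h := fun t => (n%:R * D (gam t))%:E)).
- by near=> t; exact: dle.
- exact: cvg_cst.
apply: cvg_EFin; first by near=> t.
rewrite -[X in _ --> X](mulr0 n%:R); apply: cvgMr.
apply/cvgrPdist_lt => e e0.
have /cvgrPdist_lt/(_ (e / 2)) := vertices_approach.
rewrite divr_gt0 // => /(_ isT) [N _ HN].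
near=> t.
have t01 : 0 <= t < 1.
  apply/andP; split; last by near: t; exact: nbhs_left_lt.
  by near: t; apply: nbhs_left_ge; rewrite ltr01.
have tN : N%:R <= tau t.
  have tN1 : N%:R / (N%:R + 1) <= t.
    near: t; apply: nbhs_left_ge.
    by rewrite ltr_pdivrMr ?ltr_wpDl // mul1r ltrDl.
  rewrite /tau ler_pdivlMr ?subr_gt0; last by case/andP: t01.
  move: tN1; rewrite ler_pdivrMr ?ltr_wpDl // mulrDr mulr1 => h.
  by rewrite mulrBr mulr1 lerBlDr addrC mulrC.
set j := Num.truncn (tau t).
have jN : (N <= j)%N by rewrite /j truncn_ge_nat //; exact: tau_ge0.
have Dge x : 0 <= D x by exact: sdist_ge0.
have nb (x : R) : 0 <= x -> `|0 - x| = x by move=> x0; rewrite distrC subr0 ger0_norm.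
have zj : `|0 - D (z_ j)| < e / 2 by exact: HN.
rewrite (nb _ (Dge (z_ j))) in zj.
rewrite (nb _ (Dge (gam t))).
have := polygon_close t01; rewrite -/j => gz.
have := sdist_lip S0 (gam t) (z_ j).
have := @rho_le_sdist R n S phi r S0 (z_ j); have := rz j.
move: gz zj; move: `|_ - _| (D _) (D _) => *; lra.
Unshelve. all: by end_near. Qed.

Lemma polygon_chord N c s t : 0 <= s -> s <= t -> t <= c -> c < 1 -> tau c < N%:R ->
  `|gam t - gam s| <= \sum_(0 <= j < N) (ramp j t - ramp j s) * `|z_ j.+1 - z_ j|.
Proof.
move=> s0 st tc c1 cN.
have t1 := le_lt_trans tc c1; have s1 := le_lt_trans st t1.
have tN := le_lt_trans (tau_le tc c1) cN.
have sN := le_lt_trans (tau_le st t1) tN.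
have s01 : 0 <= s < 1 by rewrite s0 s1.
have t01 : 0 <= t < 1 by rewrite (le_trans s0 st) t1.
apply: le_trans (polygon_dist (N := N) z_ s01 t01 sN tN) _.
apply: ler_sum => j _; rewrite ger0_norm // subr_ge0.
by apply: ramp_le; exact: tau_le.
Qed.

Lemma partition_step (c : R) s i : itv_partition 0 c s -> (i < size s)%N ->
  let t := nth c (0 :: s) in [/\ 0 <= t i, t i <= t i.+1 & t i.+1 <= c].
Proof.
move=> ps si t; have [p _] := ps; split.
- by apply: itv_partition_nth_ge => //; rewrite ltnS ltnW.
- by apply: ltW; move: p => /(pathP c)/(_ i si).
- exact: itv_partition_nth_le.
Qed.

Lemma polygon_rectifiable c : 0 <= c < 1 -> rectifiable gam 0 c.
Proof.
move=> c01; have /andP[c0 c1] := c01.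
pose N := (Num.truncn (tau c)).+1.
have cN : tau c < N%:R by exact: tau_lt_nat.
exists (n%:R * \sum_(0 <= j < N) `|z_ j.+1 - z_ j|) => _ [s ps <-].
apply: (@le_trans _ _ (n%:R * \sum_(0 <= i < size s) 
     1 * `|gam (nth c (0 :: s) i.+1) - gam (nth c (0 :: s) i)|)).
  rewrite mulr_sumr; apply: ler_sum => i _.
  by rewrite qform_euclidean /= mul1r; exact: enorm_le.
apply: ler_wpM2l => //; apply: (chord_telescope (w := fun=> 1) (b := fun j => `|z_ j.+1 - z_ j|) c01 cN ps) => // i si.
have [t0 tt tc] := partition_step ps si.
by rewrite /= mul1r; exact: polygon_chord cN.
Qed.

(** When a chord starting at gam s meets the side j, the starting point lies on the
side j or on the preceding one, and phi varies by at most 1 along each side. *)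
Lemma polygon_weight c s t j : 0 <= s -> s <= t -> t <= c -> c < 1 -> tau t - tau s <= 1 ->
  (ramp j t - ramp j s) * expR (phi (gam s)) <=
  (ramp j t - ramp j s) * expR (phi (z_ j) + 2).
Proof.
move=> s0 st tc c1 d1.
have t1 := le_lt_trans tc c1; have s1 := le_lt_trans st t1.
have s01 : 0 <= s < 1 by rewrite s0.
have tst : tau s <= tau t by exact: tau_le.
have rr := ramp_le j tst.
have [E|ne] := eqVneq (ramp j s) (ramp j t); first by rewrite E subrr !mul0r.
apply: ler_wpM2l; first by rewrite subr_ge0.
rewrite ler_expR.
have jt : j%:R < tau t.
  rewrite ltNge; apply/negP => tj; case/eqP: ne.
  rewrite /ramp !max_l // ge_min subr_le0 ?tj ?orbT //.
  by rewrite (le_trans tst) ?orbT.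
have js : tau s < j%:R + 1.
  rewrite ltNge; apply/negP => tj; case/eqP: ne.
  rewrite /ramp !min_l //; first by rewrite lerBrDr addrC (le_trans tj).
  by rewrite lerBrDr addrC.
have := polygon_close s01; have /andP[a b] := truncn_itv (tau_ge0 s01).
set k := Num.truncn _ in a b * => gk.
have [_ pk] := z_close gk.
have [kj|kj] := leqP j k.
  have -> : j = k.
    apply/eqP; rewrite eqn_leq kj -ltnS -(ltr_nat R) -natr1.
    exact: le_lt_trans a js.
  by move: pk; rewrite ler_norml => /andP[]; move: (phi (gam s)) (phi (z_ k)) => *; lra.
have jk : j = k.+1.
  apply/eqP; rewrite eqn_leq kj andbT -ltnS -(ltr_nat R) (lt_le_trans jt) //.
  by move: d1 b; rewrite -!natr1; move: (tau _) (tau _) => *; lra.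
have [_ pj] := z_close (zS k); rewrite -jk in pj.
move: pk pj; rewrite !ler_norml => /andP[_ +] /andP[+ _].
by move: (phi (gam s)) (phi (z_ k)) (phi (z_ j)) => *; lra.
Qed.

(** For partitions fine enough that tau increases by at most 1 on each piece, the
chord sums are bounded by the costs of the sides. *)
Lemma polygon_length c : 0 <= c < 1 ->
  (curve_length g gam 0 c <= (n%:R * (2 * expR 2 * C))%:E)%E.
Proof.
move=> c01; have /andP[c0 c1] := c01.
pose N := (Num.truncn (tau c)).+1.
have cN : tau c < N%:R by exact: tau_lt_nat.
apply: ge_ereal_sup => _ [d d0 <-].
(* the derivative of tau is at most (1 - c)^-2 on [0, c] *)
have [|s [ps ms]] := @fine_partition R c (Num.min d ((1 - c) ^+ 2)) c0.
  by rewrite lt_min d0 exprn_gt0 // subr_gt0.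
have ms' i : (i < size s)%N -> nth c (0 :: s) i.+1 - nth c (0 :: s) i < d /\
    nth c (0 :: s) i.+1 - nth c (0 :: s) i < (1 - c) ^+ 2.
  by move=> si; apply/andP; rewrite -lt_min; exact: ms.
apply: ge_ereal_inf; exists (chord_sum g gam 0 c s)%:E.
  by exists s => //; split=> // t i si; have [] := ms' i si.
rewrite lee_fin.
apply: (@le_trans _ _ (n%:R * \sum_(0 <= i < size s) 
     expR (phi (gam (nth c (0 :: s) i))) *
     `|gam (nth c (0 :: s) i.+1) - gam (nth c (0 :: s) i)|)).
  rewrite mulr_sumr; apply: ler_sum_nat => i /andP[_ si].
  have [t0 tt tc] := partition_step ps si.
  rewrite gE; last first.
    apply: (z_close (polygon_close _)).1.
    by rewrite t0 (le_lt_trans tt) // (le_lt_trans tc).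
  rewrite qform_conformal mulrCA; apply: ler_wpM2l; first exact: expR_ge0.
  exact: enorm_le.
apply: ler_wpM2l => //.
apply: (@le_trans _ _ (\sum_(0 <= j < N) expR (phi (z_ j) + 2) * `|z_ j.+1 - z_ j|)).
  apply: (chord_telescope (w := fun t => expR (phi (gam t)))
    (b := fun j => expR (phi (z_ j) + 2) * `|z_ j.+1 - z_ j|) c01 cN ps) => [j|i si]; last set t := nth c (0 :: s).
    by rewrite mulr_ge0 // expR_ge0.
  have [t0 tt tc] := partition_step ps si.
  have d1 : tau (t i.+1) - tau (t i) <= 1.
    by apply: (tau_diff t0 tt tc c1); have [] := ms' i si.
  apply: (@le_trans _ _ (expR (phi (gam (t i))) *
     \sum_(0 <= j < N) (ramp j (t i.+1) - ramp j (t i)) * `|z_ j.+1 - z_ j|)).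
    by apply: ler_wpM2l; [exact: expR_ge0|exact: polygon_chord cN].
  rewrite mulr_sumr; apply: ler_sum => j _.
  rewrite [leRHS]mulrA [leLHS]mulrA; apply: ler_wpM2r => //.
  by rewrite mulrC; exact: polygon_weight tc c1 d1.
apply: (@le_trans _ _ (\sum_(0 <= j < N) 2 * expR 2 * (expR (phi (z_ j)) * rho (z_ j)))).
  apply: ler_sum => j _; rewrite expRD.
  apply: (@le_trans _ _ (expR (phi (z_ j)) * expR 2 * (2 * rho (z_ j)))).
    by apply: ler_wpM2l; [rewrite mulr_ge0 ?expR_ge0|exact: zS].
  by move: (expR _) (expR _) (rho _) => *; rewrite le_eqVlt; apply/orP; left; apply/eqP; ring.
by rewrite -mulr_sumr; apply: ler_wpM2l; [rewrite mulr_ge0 ?expR_ge0|exact: zC].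
Qed.

Lemma no_finite_length : False.
Proof.
have := complete (@polygon_continuous R n z_) _ polygon_rectifiable polygon_dist_to.
have inM t : 0 <= t < 1 -> (Omega `\` S) (gam t).
  move=> /polygon_close/z_close[/andP[D0 Dr] _]; split; first exact: collar.
  by move=> /(sdist_eq0 S0) E; move: D0; rewrite E ltxx.
move=> /(_ inM) E.
suff : (curve_length01 g gam <= (n%:R * (2 * expR 2 * C))%:E)%E by rewrite E.
apply: ge_ereal_sup => _ [c + <-]; rewrite /= in_itv /= => c01.
exact: polygon_length.
Qed.

End NoEscape.

Section NoEscapeConclusion.
Context {R : realType} {n : nat}.
Variables (Omega S : set 'rV[R]_n) (g : 'rV[R]_n -> 'M[R]_n) (phi : 'rV[R]_n -> R) (r : R).
Local Notation D := (sdist S).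

(** The points of [escapes_sequence] are the vertices of a polygon that runs into S
and has finite length, against completeness. *)
Lemma complete_no_escape :
  S !=set0 -> compact S -> 0 < r ->
  (forall x, 0 < D x < 4 * r -> {for x, continuous phi}) ->
  (forall x, D x < 4 * r -> Omega x) ->
  (forall x, 0 < D x < 4 * r -> g x = expR (2 * phi x) *: 1%:M) ->
  geodesically_complete_near Omega S g ->
  forall z a, 0 < D z <= 2 * r -> ~ escapes S phi r z a.
Proof.
move=> S0 cS r0 phic collar gE complete z a Dz ez.
have [z_ [_ zD zS [C zC]]] := escapes_sequence S0 cS r0 phic Dz ez.
exact: (no_finite_length S0 cS r0 phic collar gE complete zD zS zC).
Qed.

End NoEscapeConclusion.

(** * Truncated powers of the conformal factor *)

Section LogTruncation.
Context {R : realType}.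
Variables (sig k : R).
Hypothesis sig0 : 0 <= sig.
Implicit Types s : R.

(** The logarithm of e^(sig s) / (1 + e^(s-k))^(sig+1): a function of s that behaves
like sig s below the level k and like - s above it.  Thus the weight is comparable
to e^(sig phi) where phi <= k, and times e^phi it stays bounded. *)
Definition logw s : R := sig * s - (sig + 1) * ln (1 + expR (s - k)).
Definition dlogw s : R := sig - (sig + 1) * (expR (s - k) / (1 + expR (s - k))).

Let e1 s : 1 < 1 + expR (s - k). Proof. by rewrite ltrDl expR_gt0. Qed.
Let e0 s : 0 < 1 + expR (s - k). Proof. exact: lt_trans (e1 s). Qed.

Lemma logw_is_derive s : is_derive s 1 logw (dlogw s).
Proof.
have D0 : is_derive s 1 (fun s : R => s - k) 1.
  by have := is_deriveB (is_derive_id s (1:R)) (is_derive_cst (k:R) s 1); rewrite subr0.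
have D1 := is_derive_chain D0 (is_derive_expR (s - k)).
have D2 : is_derive s 1 (fun s : R => 1 + expR (s - k)) (expR (s - k)).
  by have := is_deriveD (is_derive_cst (1:R) s 1) D1; rewrite add0r mulr1.
have D3 := is_derive_chain D2 (is_derive1_ln (e0 s)).
have D4 := is_deriveB (is_deriveZ sig (is_derive_id s (1:R))) (is_deriveZ (sig + 1) D3).
apply: (is_derive_eq D4); rewrite /dlogw /GRing.scale /= mulr1.
by congr (_ - _ * _); rewrite mulrC.
Qed.

Lemma dlogw_le s : dlogw s <= sig.
Proof. by rewrite gerBl mulr_ge0 ?addr_ge0 // divr_ge0 ?expR_ge0 // ltW. Qed.

Lemma dlogw_ge s : -1 <= dlogw s.
Proof.
have H : expR (s - k) / (1 + expR (s - k)) <= 1.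
  by rewrite ler_pdivrMr // mul1r lerDr.
have := ler_wpM2l (_ : 0 <= sig + 1) H; rewrite addr_ge0 // => /(_ isT).
by rewrite /dlogw; move: (_ * (_ / _)) => *; lra.
Qed.

Lemma ln_ge s : 0 <= ln (1 + expR (s - k)).
Proof. by apply: ln_ge0; exact: ltW. Qed.

Lemma logw_le s : logw s <= sig * s.
Proof. by rewrite gerBl mulr_ge0 ?addr_ge0 // ln_ge. Qed.

(** Below the level k the truncation costs a constant factor only. *)
Lemma logw_ge s : s <= k -> sig * s - (sig + 1) * ln 2 <= logw s.
Proof.
move=> sk; rewrite lerD2l lerN2; apply: ler_wpM2l; first exact: addr_ge0.
rewrite ler_ln ?posrE // lerD2l -expR0 ler_expR subr_le0 //.
Qed.

(** The decay above the level k compensates the factor e^phi that the cutoffs bring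
in. *)
Lemma logw_add_le s : logw s + s <= (sig + 1) * k.
Proof.
have H : s - k <= ln (1 + expR (s - k)).
  by rewrite -{1}[s - k]expRK ler_ln ?posrE ?expR_gt0 // lerDr.
have := ler_wpM2l (_ : 0 <= sig + 1) H; rewrite addr_ge0 // => /(_ isT).
by rewrite /logw mulrBr; move: ((sig + 1) * ln _) => *; lra.
Qed.

End LogTruncation.

(** * Uniform estimates on shells around the compact set *)

Section ShellAnalysis.
Context {R : realType} {n : nat}.
Variables (S : set 'rV[R]_n) (r : R).
Hypothesis S0 : S !=set0.
Hypothesis cS : compact S.
Hypothesis r0 : 0 < r.
Local Notation D := (sdist S).
Local Notation e i := (delta_mx 0 i : 'rV[R]_n).

Lemma shell_in d x : 0 < d -> d <= D x <= 2 * r -> 0 < D x < 4 * r.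
Proof.
by move=> d0 /andP[a b]; move: r0 d0 a b; move: (D x) => *; apply/andP; split; lra.
Qed.

(** Shells d <= D <= 2 r are compact and lie inside the open collar where phi is
smooth. *)
Lemma shell_uniform d (Q : 'rV[R]_n -> R -> Prop) : 0 < d ->
  (forall x e e', Q x e -> 0 < e' <= e -> Q x e') ->
  (forall z, 0 < D z < 4 * r -> exists e s : R, [/\ 0 < e, 0 < s &
     forall x, `|x - z| < s -> Q x e]) ->
  exists2 e : R, 0 < e & forall x, d <= D x <= 2 * r -> Q x e.
Proof.
move=> d0 Qm Ql.
have cK := @shell_compact R n S S0 cS d (2 * r) setT closedT.
have [//||e0 e00 H] := @compact_uniform R _ _ Q cK.
  move=> z [zd _]; have [e1 [s [a b c]]] := Ql z (shell_in d0 zd).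
  by exists e1, s; split=> // x _; exact: c.
by exists e0 => // x xd; apply: H; split.
Qed.

Lemma bounded_on_shell d (f : 'rV[R]_n -> R) : 0 < d ->
  (forall x, 0 < D x < 4 * r -> {for x, continuous f}) ->
  exists2 C, 0 <= C & forall x, d <= D x <= 2 * r -> `|f x| <= C.
Proof.
move=> d0 fc.
have [||c c0 H] := @shell_uniform d (fun x e => `|f x| <= e^-1) d0.
- move=> x a b fa /andP[b0 ba]; apply: le_trans fa _.
  by rewrite lef_pV2 ?posrE // (lt_le_trans b0).
- move=> z zK; have /cvgrPdist_lt/(_ 1 ltr01)/nbhs_ballP[s /= s0 Hs] := fc z zK.
  have fz : 0 < `|f z| + 1 by rewrite ltr_wpDl.
  exists (`|f z| + 1)^-1, s; split; rewrite ?invr_gt0 // => x xz; rewrite invrK.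
  have H : `|f z - f x| < 1 by apply: Hs; rewrite -ball_normE /= distrC.
  rewrite -(subKr (f z) (f x)); apply: le_trans (ler_normB _ _) _.
  by rewrite lerD2l ltW.
by exists c^-1; rewrite ?invr_ge0 ?ltW.
Qed.

Lemma near_shell d : 0 < d -> exists2 h0 : R, 0 < h0 & forall x y, d <= D x <= 2 * r ->
  `|y - x| <= h0 -> 0 < D y < 4 * r.
Proof.
move=> d0; exists (Num.min (d / 2) r); first by rewrite lt_min r0 divr_gt0.
move=> x y /andP[xd xr]; rewrite le_min => /andP[yx yr].
have := sdist_lip S0 y x; have := sdist_lip S0 x y; rewrite (distrC x y).
move: r0 d0 xd xr yx yr; move: (D x) (D y) `|_ - _| => *; apply/andP; split; lra.
Qed.

Lemma norm_step (h : R) i : 0 <= h -> `|h *: e i| = h.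
Proof.
move=> h0; rewrite normrZ ger0_norm // -[RHS]mulr1; congr (_ * _).
rewrite /Num.norm /= mx_normrE; apply/eqP; rewrite eq_le; apply/andP; split.
  apply/bigmax_leP; split; first exact: ler01.
  by move=> [a b] _ /=; rewrite mxE; case: (_ && _); rewrite ?normr1 ?normr0 ?ler01.
by apply/bigmax_geP; right; exists (0, i) => //=; rewrite mxE !eqxx normr1.
Qed.

(** The mean value theorem with the uniform continuity of df on the shell: one step
bound serves all lattice points. *)
Lemma uniform_step d (f df : 'rV[R]_n -> R) i (eps : R) : 0 < d -> 0 < eps ->
  (forall x, 0 < D x < 4 * r -> is_derive x (e i) f (df x)) ->
  (forall x, 0 < D x < 4 * r -> {for x, continuous df}) ->
  exists2 h0 : R, 0 < h0 & forall x h, d <= D x <= 2 * r -> 0 < h <= h0 ->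
    `|f (x + h *: e i) - f x - h * df x| <= h * eps.
Proof.
move=> d0 eps0 fd dfc.
have [h1 h10 Hn] := near_shell d0.
have [||h2 h20 H2] := @shell_uniform d
   (fun x a => forall y, `|y - x| <= a -> `|df y - df x| <= eps) d0.
- by move=> x a b H /andP[_ ba] y yx; apply: H; exact: le_trans ba.
- move=> z zK; have /cvgrPdist_lt/(_ (eps / 2)) := dfc z zK.
  rewrite divr_gt0 // => /(_ isT)/nbhs_ballP[s /= s0 Hs].
  have s40 : 0 < s / 4 by rewrite divr_gt0.
  exists (s / 4), (s / 4); split=> // x xz y yx.
  have A : `|df z - df x| < eps / 2.
    apply: Hs; rewrite -ball_normE /= distrC.
    by move: xz s40; move: `|_ - _| => *; lra.
  have A' : `|df z - df y| < eps / 2.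
    apply: Hs; rewrite -ball_normE /= distrC.
    have := ler_distD x y z; move: xz yx s40; move: `|_ - _| `|_ - _| `|_ - _| => *; lra.
  have := ler_distD (df z) (df y) (df x); rewrite (distrC (df y) (df z)).
  by move: A A'; move: `|_ - _| `|_ - _| `|_ - _| => *; lra.
exists (Num.min h1 h2); first by rewrite lt_min h10.
move=> x h xd /andP[h0]; rewrite le_min => /andP[hh1 hh2].
have near s : 0 <= s <= h -> `|(s *: e i + x) - x| <= h.
  by move=> /andP[a b]; rewrite addrK norm_step.
have [|s sh E] := @mean_value_line R _ f df x (e i) h h0.
  by move=> s sh; apply: fd; apply: (Hn x _ xd); apply: le_trans hh1; exact: near.
rewrite [x + _]addrC E -mulrBr normrM gtr0_norm //; apply: ler_wpM2l; first exact: ltW.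
by apply: (H2 x xd); apply: le_trans hh2; exact: near.
Qed.

End ShellAnalysis.

(** * Inequalities for the energy estimate *)

Section RealInequalities.
Context {R : realType}.
Implicit Types a b c s : R.

Lemma growth_le c s1 s2 : 0 <= c -> 0 <= s1 -> s1 <= s2 -> growth c s1 <= growth c s2.
Proof.
move=> c0 s10 s12; rewrite ler_expR; apply: ler_wpM2l => //.
by rewrite ler_ln ?posrE ?ltr_pwDl // ?lerD2l // (le_trans s10).
Qed.

Lemma norm_diff0r a b s : 0 <= s -> `|a * 0 - b * 0| <= s.
Proof. by rewrite !mulr0 subrr normr0. Qed.

Lemma norm_diff0l a b s : 0 <= s -> `|0 * a - 0 * b| <= s.
Proof. by rewrite !mul0r subrr normr0. Qed.

Lemma powerX_diff (k : nat) a b : 0 <= a <= 1 -> 0 <= b <= 1 ->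
  `|a ^+ k - b ^+ k| <= k%:R * `|a - b|.
Proof.
move=> /andP[a0 a1] /andP[b0 b1]; elim: k => [|k IH].
  by rewrite !expr0 subrr normr0 mul0r.
have -> : a ^+ k.+1 - b ^+ k.+1 = a * (a ^+ k - b ^+ k) + (a - b) * b ^+ k.
  by rewrite !exprS; ring.
apply: le_trans (ler_normD _ _) _; rewrite !normrM -nat1r mulrDl mul1r addrC.
apply: lerD; first by rewrite ler_piMr // ger0_norm ?exprn_ge0 // exprn_ile1.
apply: le_trans IH; rewrite (ger0_norm a0); exact: ler_piMl.
Qed.

Lemma powerX_convex (k : nat) a b : 0 <= b -> b <= a ->
  a ^+ k.+1 - b ^+ k.+1 <= k.+1%:R * a ^+ k * (a - b).
Proof.
move=> b0 ba; have a0 := le_trans b0 ba; elim: k => [|k IH].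
  by rewrite !expr1 expr0 mulr1 mul1r.
have -> : a ^+ k.+2 - b ^+ k.+2 = a * (a ^+ k.+1 - b ^+ k.+1) + (a - b) * b ^+ k.+1.
  by rewrite !(exprS _ k.+1); move: (a ^+ _) (b ^+ _) => u v; ring.
have -> : k.+2%:R * a ^+ k.+1 * (a - b) =
  a * (k.+1%:R * a ^+ k * (a - b)) + (a - b) * a ^+ k.+1.
  have -> : k.+2%:R = k.+1%:R + 1 :> R by rewrite natr1.
  by rewrite exprS; move: (a ^+ k) (k.+1%:R) => u v; ring.
apply: lerD; first exact: ler_wpM2l.
by apply: ler_wpM2l; rewrite ?subr_ge0 //; apply: lerXn2r.
Qed.

(** The linear coefficient is the derivative at a even when b is the larger point, at
the price of a quadratic term: [young_growth] needs the factor a^k. *)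
Lemma powerX_diff_sharp (k : nat) a b : 0 <= a <= 1 -> 0 <= b <= 1 ->
  `|b ^+ k.+1 - a ^+ k.+1| <= k.+1%:R * (a ^+ k + k%:R * `|b - a|) * `|b - a|.
Proof.
move=> a01 b01; have /andP[a0 a1] := a01; have /andP[b0 b1] := b01.
have [ba|ab] := leP b a.
  have ab : b ^+ k.+1 <= a ^+ k.+1 by apply: lerXn2r.
  rewrite [`|_ ^+ _ - _|]distrC (distrC b) !ger0_norm ?subr_ge0 //.
  apply: le_trans (powerX_convex k b0 ba) _; apply: ler_wpM2r; first by rewrite subr_ge0.
  by apply: ler_wpM2l => //; rewrite lerDl mulr_ge0 // subr_ge0.
have ab' : a ^+ k.+1 <= b ^+ k.+1 by apply: lerXn2r => //; exact: ltW.
rewrite ger0_norm ?subr_ge0 //; apply: le_trans (powerX_convex k a0 (ltW ab)) _.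
rewrite (ger0_norm (_ : 0 <= b - a)) ?subr_ge0 ?(ltW ab) //.
apply: ler_wpM2r; first by rewrite subr_ge0 ltW.
apply: ler_wpM2l => //; rewrite -lerBlDl; apply: le_trans (ler_norm _) _.
apply: le_trans (powerX_diff k b01 a01) _.
by rewrite ger0_norm // subr_ge0 ltW.
Qed.

(** If L <= d a y the left side is below the first term.  Otherwise a y <= l = L / d,
and a^(n-2) (1 + y^2)^c <= (a^2 (1 + y^2))^c <= (1 + l^2)^c; this is where the power
n of the cutoff and the inequality 2 c <= n - 2 are used. *)
Lemma young_growth (n : nat) c a (L d y : R) : (2 <= n)%N -> 0 <= c -> 2 * c <= n%:R - 2 ->
  0 <= a <= 1 -> 0 <= L -> 0 < d -> 0 <= y ->
  a ^+ n.-1 * L * (growth c (y ^+ 2) * y) <=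
  d * (a ^+ n * (growth c (y ^+ 2) * y ^+ 2)) + d * ((L / d) ^+ 2 * growth c ((L / d) ^+ 2)).
Proof.
move=> n2 c0 cn /andP[a0 a1] L0 d0 y0.
have g0 s : 0 <= growth c s by exact: expR_ge0.
have R0 : 0 <= d * ((L / d) ^+ 2 * growth c ((L / d) ^+ 2)).
  by apply: mulr_ge0; [exact: ltW|apply: mulr_ge0; [exact: sqr_ge0|exact: g0]].
have R1 : 0 <= d * (a ^+ n * (growth c (y ^+ 2) * y ^+ 2)).
  by apply: mulr_ge0; [exact: ltW|rewrite mulr_ge0 ?exprn_ge0 // mulr_ge0 ?sqr_ge0 ?g0].
have [an0|an0] := eqVneq a 0.
  rewrite an0 in R1 *; case: n n2 cn R1 => [|[|n]] // _ _ R1.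
  by rewrite [0 ^+ _.+1]exprS !mul0r addr_ge0.
have ap : 0 < a by rewrite lt_neqAle eq_sym an0.
have E : a ^+ n = a ^+ n.-1 * a by rewrite -exprSr prednK // (leq_trans _ n2).
have [Ly|Ly] := leP L (d * (a * y)).
  rewrite -[leLHS]addr0; apply: lerD => //; rewrite E.
  have -> : d * (a ^+ n.-1 * a * (growth c (y ^+ 2) * y ^+ 2)) =
    a ^+ n.-1 * (d * (a * y)) * (growth c (y ^+ 2) * y).
    by move: (a ^+ n.-1) (growth _ _) => u v; ring.
  apply: ler_wpM2r; first by rewrite mulr_ge0.
  by apply: ler_wpM2l => //; exact: exprn_ge0.
rewrite -[leLHS]add0r; apply: lerD => //.
set l := L / d; have l0 : 0 <= l by rewrite divr_ge0 // ltW.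
have ayl : a * y <= l by rewrite /l ler_pdivlMr // mulrC ltW.
have LE : L = d * l by rewrite /l mulrC divfK // gt_eqF.
have key : a ^+ n.-2 * growth c (y ^+ 2) <= growth c (l ^+ 2).
  have -> : a ^+ n.-2 = expR (n.-2%:R * ln a) by rewrite expRM_natl lnK // posrE.
  rewrite /growth -expRD ler_expR.
  apply: (@le_trans _ _ (2 * c * ln a + c * ln (1 + y ^+ 2))).
    rewrite lerD2r; apply: ler_wnM2r; first exact: ln_le0.
    by rewrite -subn2 natrB.
  have y1 : 0 < 1 + y ^+ 2 by rewrite ltr_pwDl // sqr_ge0.
  have -> : 2 * c * ln a + c * ln (1 + y ^+ 2) = c * ln (a ^+ 2 * (1 + y ^+ 2)).
    rewrite lnM ?posrE ?exprn_gt0 // lnXn // -[ln a *+ 2]mulr_natl mulrDr.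
    by congr (_ + _); rewrite mulrCA mulrA.
  apply: ler_wpM2l => //; rewrite ler_ln ?posrE; last first.
  - by rewrite ltr_pwDl // sqr_ge0.
  - by rewrite mulr_gt0 // exprn_gt0.
  rewrite mulrDr mulr1 -exprMn; apply: lerD; first by rewrite expr_le1.
  by apply: lerXn2r => //; rewrite nnegrE // mulr_ge0.
have -> : a ^+ n.-1 * L * (growth c (y ^+ 2) * y) =
   L * (a * y) * (a ^+ n.-2 * growth c (y ^+ 2)).
  have -> : n.-1 = n.-2.+1 by case: (n) n2 => [|[|]].
  by rewrite exprS; move: (a ^+ n.-2) (growth _ _) => u v; ring.
apply: (@le_trans _ _ (L * l * growth c (l ^+ 2))).
  apply: ler_pM; rewrite ?mulr_ge0 ?exprn_ge0 //.
  exact: ler_wpM2l.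
by rewrite {1}LE le_eqVlt; apply/orP; left; apply/eqP; ring.
Qed.

(** This is the size of the error term when |d eta| is of order e^phi: (1 + e^(2s))^c
is at most 2^c e^(2cs) for s >= 0, and p = 2 + 2 c is exactly the power of e^s that
the truncated weight can absorb. *)
Lemma weight_bound (sig k c p s : R) : 0 <= sig -> 0 <= k -> 0 <= c -> p = 2 + 2 * c ->
  expR (p * logw sig k s) * (expR s ^+ 2 * growth c (expR s ^+ 2)) <=
  expR (p * (sig + 1) * k + c * ln 2).
Proof.
move=> sig0 k0 c0 pE.
have p0 : 0 < p by rewrite pE ltr_pwDl ?mulr_ge0.
have E2 : expR s ^+ 2 = expR (2 * s) by rewrite -expRM_natl.
rewrite E2 /growth -!expRD ler_expR.
have H1 := logw_add_le k sig0 s.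
have H2 := logw_le k sig0 s.
have pk : 0 <= p * ((sig + 1) * k) by rewrite !mulr_ge0 ?addr_ge0 // ltW.
have [s0|s0] := leP 0 s.
  have : ln (1 + expR (2 * s)) <= ln 2 + 2 * s.
    rewrite -[2 * s in leRHS]expRK -lnM ?posrE ?expR_gt0 //.
    rewrite ler_ln ?posrE ?mulr_gt0 ?addr_gt0 ?expR_gt0 //.
    have : 1 <= expR (2 * s) by rewrite -[1]expR0 ler_expR mulr_ge0.
    by move: (expR (2 * s)) => *; lra.
  move=> /(ler_wpM2l c0); have := ler_wpM2l (ltW p0) H1.
  by rewrite pE; move: (logw _ _ _) (ln 2) (ln _) => x y z; nra.
have : ln (1 + expR (2 * s)) <= ln 2.
  rewrite ler_ln ?posrE ?addr_gt0 ?expR_gt0 //.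
  have : expR (2 * s) <= 1 by rewrite -[1]expR0 ler_expR mulr_ge0_le0 // ltW.
  by move: (expR (2 * s)) => *; lra.
move=> /(ler_wpM2l c0).
have : p * logw sig k s <= 0.
  by rewrite mulr_ge0_le0 ?(ltW p0) // (le_trans H2) // mulr_ge0_le0 // ltW.
by move: pk s0; move: (logw _ _ _) (ln 2) (ln _) => x y z; lra.
Qed.

End RealInequalities.

(** * Compactly supported cutoffs *)

Section Cutoffs.
Context {R : realType} {n : nat}.
Variables (S : set 'rV[R]_n) (r : R) (phi : 'rV[R]_n -> R).
Hypothesis S0 : S !=set0.
Hypothesis cS : compact S.
Hypothesis r0 : 0 < r.
Local Notation D := (sdist S).
Hypothesis phic : forall x, 0 < D x < 4 * r -> {for x, continuous phi}.

Definition zeta x : R := Num.max 0 (Num.min 1 (3 - 2 / r * D x)).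

Lemma zeta_01 x : 0 <= zeta x <= 1.
Proof. by rewrite /zeta le_max lexx ge_max ler01 ge_min lexx. Qed.

Lemma zeta_in x : D x <= r -> zeta x = 1.
Proof.
move=> xr; have H : 1 <= 3 - 2 / r * D x.
  have : 2 / r * D x <= 2 by rewrite mulrAC ler_pdivrMr // ler_pM2l.
  by move: (2 / r * D x) => *; lra.
by rewrite /zeta min_l // max_r.
Qed.

Lemma zeta_out x : 3 / 2 * r <= D x -> zeta x = 0.
Proof.
move=> xr; have H : 3 - 2 / r * D x <= 0.
  have : 3 <= 2 / r * D x by rewrite mulrAC ler_pdivlMr //; move: xr; move: (D x) => *; lra.
  by move: (2 / r * D x) => *; lra.
by rewrite /zeta max_l // ge_min H orbT.
Qed.

Lemma zeta_lip x y : `|zeta x - zeta y| <= 2 / r * `|x - y|.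
Proof.
apply: le_trans (clamp_lip _ _) _.
rewrite opprD addrACA subrr add0r opprK addrC -mulrBr normrM ger0_norm ?divr_ge0 ?(ltW r0) //.
apply: ler_wpM2l; first by rewrite divr_ge0 // ltW.
by rewrite distrC; exact: (sdist_lipN S0).
Qed.

(** The conclusion of [cutoff]: eta vanishes near S, is 1 at distance at least d, and
its g-gradient is at most eps at the scale rho. *)
Record cutoff_spec (d eps : R) (eta : 'rV[R]_n -> R) (d' : R) : Prop := CutoffSpec {
  cut_gt0 : 0 < d';
  cut_01 : forall x, 0 <= eta x <= 1;
  cut_near : forall x, D x < d' -> eta x = 0;
  cut_far : forall x, d <= D x <= 2 * r -> eta x = 1;
  cut_lip : forall x x', D x <= 2 * r -> D x' <= 2 * r ->
    `|x - x'| <= rho S phi r x -> `|x - x'| <= rho S phi r x' ->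
    `|eta x - eta x'| <= eps * expR (phi x) * `|x - x'| }.

(** The slope of zeta eta: the first summand comes from zeta and lives where phi is
bounded independently of eta, the second one from eta. *)
Definition cut_slope (eps d' : R) (x : 'rV[R]_n) : R :=
  (d' / 2 <= D x <= 7 / 4 * r)%R%:R * (2 / r * (r / 2 <= D x)%R%:R + eps * expR (phi x)).

Lemma rho_shell d : 0 < d -> exists2 h0 : R, 0 < h0 &
  forall x, d <= D x <= 2 * r -> h0 <= rho S phi r x.
Proof.
move=> d0; have [||h0 h00 H] := @shell_uniform R n S r S0 cS r0 d
   (fun x a => a <= rho S phi r x) d0.
- by move=> x a b H /andP[_ ba]; exact: le_trans H.
- move=> z zK; have rz := @rho_gt0 R n S phi r S0 phic z zK.
  exists (rho S phi r z / 2), (rho S phi r z / 2); split; rewrite ?divr_gt0 //.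
  move=> x xz; have := @rho_lip R n S phi r z x; rewrite distrC.
  by move: xz; move: `|_ - _| => *; lra.
by exists h0.
Qed.

Lemma cutoff_steps d eps eta d' : 0 < eps -> cutoff_spec d eps eta d' ->
  exists2 h0 : R, 0 < h0 & forall x x', d' / 4 <= D x <= 2 * r -> D x' <= 2 * r ->
    `|x' - x| <= h0 -> `|eta x' - eta x| <= eps * expR (phi x) * `|x' - x|.
Proof.
move=> eps0 [d'0 e01 en ef el].
have [h0 h00 Hh] := rho_shell (divr_gt0 d'0 (ltr0n R 8 : 0 < 8)).
exists (Num.min h0 (d' / 8)); first by rewrite lt_min h00 divr_gt0.
move=> x x' /andP[xd xr] x'r; rewrite le_min distrC [`|eta _ - _|]distrC => /andP[H1 H2].
apply: (el x x' xr x'r); apply: le_trans H1 (Hh _ _); rewrite ?xr ?x'r andbT.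
  by move: xd d'0; move: (D x) => *; lra.
have := sdist_lip S0 x x'; move: xd H2 d'0; move: (D x) (D x') `|_ - _| => *; lra.
Qed.

(** One step bound h0 works everywhere: on the support of zeta eta the radius rho is
bounded below, and elsewhere the product vanishes at both ends of the step. *)
Lemma prod_cutoff_step d eps eta d' : 0 < eps -> cutoff_spec d eps eta d' ->
  exists2 h0 : R, 0 < h0 & forall x x', `|x' - x| <= h0 ->
    `|zeta x' * eta x' - zeta x * eta x| <= `|x' - x| * cut_slope eps d' x.
Proof.
move=> eps0 sp; have [h0 h00 Hh] := cutoff_steps eps0 sp.
case: sp => d'0 e01 en ef el.
exists (Num.min h0 (Num.min (d' / 4) (r / 8))).
  by rewrite !lt_min h00 !divr_gt0.
move=> x x'; rewrite !le_min => /and3P[H1 H2 H3].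
have xx' : D x <= D x' + `|x' - x| by rewrite distrC; exact: sdist_lip.
have x'x : D x' <= D x + `|x' - x| by exact: sdist_lip.
have L0 : 0 <= `|x' - x| * cut_slope eps d' x.
  by rewrite !mulr_ge0 ?addr_ge0 ?mulr_ge0 ?expR_ge0 ?invr_ge0 // ?(ltW r0) ?(ltW eps0).
have [A|A] := ltP (D x) (d' / 2).
  have E1 : D x' < d' by lra.
  have E2 : D x < d' by lra.
  by rewrite (en x' E1) (en x E2); exact: norm_diff0r.
have [C|C] := ltP (7 / 4 * r) (D x).
  have E1 : 3 / 2 * r <= D x' by lra.
  have E2 : 3 / 2 * r <= D x by lra.
  by rewrite (zeta_out E1) (zeta_out E2); exact: norm_diff0l.
rewrite /cut_slope A C /= mul1r.
have -> : zeta x' * eta x' - zeta x * eta x =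
  (zeta x' - zeta x) * eta x' + zeta x * (eta x' - eta x).
  by move: (zeta x') (zeta x) (eta x') (eta x) => *; ring.
apply: le_trans (ler_normD _ _) _; rewrite !normrM mulrDr; apply: lerD.
  have [E|E] := ltP (D x) (r / 2).
    have E1 : D x' <= r by lra.
    have E2 : D x <= r by lra.
    by rewrite !zeta_in // subrr normr0 mul0r !mulr0.
  have /andP[e0 e1] := e01 x'; rewrite mulr1 (ger0_norm e0) mulrC [leRHS]mulrC.
  by apply: le_trans (zeta_lip x' x); exact: ler_piMl.
have /andP[z0 z1] := zeta_01 x; rewrite (ger0_norm z0) [leRHS]mulrC.
apply: (@le_trans _ _ `|eta x' - eta x|); first exact: ler_piMl.
apply: Hh => //.
  by apply/andP; split; lra.
by lra.
Qed.

Lemma prod_cutoff_supp d eps eta d' x : cutoff_spec d eps eta d' ->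
  zeta x * eta x != 0 -> d' <= D x <= 3 / 2 * r.
Proof.
case=> d'0 e01 en ef el; rewrite mulf_eq0 negb_or => /andP[z0 e0]; apply/andP; split.
  by rewrite leNgt; apply: contra e0 => /en ->.
by rewrite leNgt; apply: contra z0 => /ltW/zeta_out ->.
Qed.

End Cutoffs.

(** * The energy bound *)

Section ContinuityTools.
Context {R : realType} {V : normedModType R}.
Implicit Types (f g : V -> R) (x : V).

Lemma cont_comp (h : R -> R) f x : {for x, continuous f} -> {for (f x), continuous h} ->
  {for x, continuous (fun y => h (f y))}.
Proof. by move=> cf ch; apply: continuous_comp. Qed.

Lemma cont_mul f g x : {for x, continuous f} -> {for x, continuous g} ->
  {for x, continuous (fun y => f y * g y)}.
Proof. by move=> cf cg; apply: continuousM. Qed.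

Lemma cont_add f g x : {for x, continuous f} -> {for x, continuous g} ->
  {for x, continuous (fun y => f y + g y)}.
Proof. by move=> cf cg; apply: continuousD. Qed.

Lemma cont_cst (a : R) x : {for x, continuous (fun _ : V => a)}.
Proof. exact: cst_continuous. Qed.

Lemma cont_sum (I : Type) (s : seq I) (F : I -> V -> R) x :
  (forall i, {for x, continuous (F i)}) -> {for x, continuous (fun y => \sum_(i <- s) F i y)}.
Proof.
move=> H; elim: s => [|i s IH].
  rewrite (_ : (fun y => _) = (fun _ => 0)); first exact: cont_cst.
  by apply/funext => y; rewrite big_nil.
rewrite (_ : (fun y => _) = (fun y => F i y + \sum_(j <- s) F j y)); first exact: cont_add.
by apply/funext => y; rewrite big_cons.
Qed.

Lemma derivable_cont (h : R -> R) (s d : R) : is_derive s 1 h d -> {for s, continuous h}.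
Proof. by case=> + _ => /derivable1_diffP/differentiable_continuous. Qed.

End ContinuityTools.

Section Energy.
Context {R : realType} {n : nat}.
Variables (S : set 'rV[R]_n) (r : R) (phi : 'rV[R]_n -> R) (g : 'rV[R]_n -> 'M[R]_n).
Variables (p : R) (B : nat).
Hypothesis S0 : S !=set0.
Hypothesis cS : compact S.
Hypothesis r0 : 0 < r.
Local Notation D := (sdist S).
Local Notation collar := [set x : 'rV[R]_n | 0 < D x < 4 * r].
Hypothesis sphi : smooth_on collar phi.
Hypothesis gE : forall x, collar x -> g x = expR (2 * phi x) *: 1%:M.
Hypothesis n3 : (3 <= n)%N.
Hypothesis p2 : 2 <= p.
Hypothesis pn : p < n%:R.
Hypothesis Ap : nonneg_tensor_on collar (intermediate_schouten p g).
Hypothesis Hbox : forall x i, D x < 4 * r -> `|x 0 i| + 2 <= B%:R.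
Hypothesis Hcut : forall d eps, 0 < d -> 0 < eps ->
  exists eta d', cutoff_spec S r phi d eps eta d'.
Local Notation e i := (delta_mx 0 i : 'rV[R]_n).
Local Notation kappa := ((n%:R - p) / 2).
Local Notation c := ((p - 2) / 2).
Local Notation N := (sqgrad phi).

Variable t : R.
Hypothesis t0 : 0 < t.
Hypothesis tk : t < kappa.
Let sig := t / p.

Lemma open_collar : open collar.
Proof.
have cD : continuous D by exact: sdist_continuous.
rewrite (_ : collar = (D @^-1` [set y | 0 < y]) `&` (D @^-1` [set y | y < 4 * r])).
  apply: openI; apply: open_comp => [x _|]; try exact: cD.
    exact: open_gt.
  exact: open_lt.
by apply/seteqP; split => [x /andP[a b]|x [a b]]; [split|apply/andP].
Qed.

Lemma phi_cont x : collar x -> {for x, continuous phi}.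
Proof. by move=> cx; have [] := sphi [::] cx. Qed.

Lemma dphi_cont i x : collar x -> {for x, continuous (pderiv i phi)}.
Proof. by move=> cx; have [] := sphi [:: i] cx. Qed.

Lemma ddphi_cont i j x : collar x -> {for x, continuous (pderiv i (pderiv j phi))}.
Proof. by move=> cx; have [] := sphi [:: i; j] cx. Qed.

Lemma sqgrad_cont x : collar x -> {for x, continuous N}.
Proof.
move=> cx; apply: cont_sum => i; apply: (cont_comp (h := fun u => u ^+ 2)).
  exact: dphi_cont.
exact: exprn_continuous.
Qed.

Lemma growth_cont x : collar x -> {for x, continuous (fun y => growth c (N y))}.
Proof.
move=> cx; apply: cont_comp; first exact: sqgrad_cont.
exact: (derivable_cont (growth_is_derive c (sqgrad_ge0 phi x))).
Qed.

(** The weight F of the flux: the p-th power of the truncated power of the conformal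
factor, which increases to e^(t phi) as k grows. *)
Definition wt (k s : R) : R := expR (p * logw sig k s).
Definition dwt (k s : R) : R := wt k s * (p * dlogw sig k s).

Lemma p_gt0 : 0 < p. Proof. exact: lt_le_trans p2. Qed.

Lemma sig_gt0 : 0 < sig. Proof. by rewrite divr_gt0 // p_gt0. Qed.

Let sig0 : 0 <= sig. Proof. exact: ltW sig_gt0. Qed.

Lemma psig : p * sig = t. Proof. by rewrite /sig mulrC divfK // gt_eqF // p_gt0. Qed.

Lemma wt_gt0 k s : 0 < wt k s. Proof. exact: expR_gt0. Qed.

Lemma wt_is_derive k (s : R) : is_derive s 1 (wt k) (dwt k s).
Proof.
have D1 := is_deriveZ p (logw_is_derive sig k s).
exact: (is_derive_chain D1 (is_derive_expR (p * logw sig k s))).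
Qed.

Lemma wt_cont k (s : R) : {for s, continuous (wt k)}.
Proof. exact: derivable_cont (wt_is_derive k s). Qed.

Lemma dwt_cont k (s : R) : {for s, continuous (dwt k)}.
Proof.
apply: (@cont_mul R R); first exact: wt_cont.
apply: (@cont_mul R R); first exact: cont_cst.
apply: (@cont_add R R); first exact: cont_cst.
apply: (cont_comp (h := -%R)); last exact: opp_continuous.
apply: (@cont_mul R R); first exact: cont_cst.
have E : {for s, continuous (fun s : R => expR (s - k))}.
  apply: (cont_comp (h := expR)); last exact: continuous_expR.
  by apply: (@cont_add R R); [exact: id|exact: cont_cst].
apply: (@cont_mul R R) => //.
apply: continuousV; last by apply: (@cont_add R R); [exact: cont_cst|].
by rewrite gt_eqF // addr_gt0 // expR_gt0.
Qed.

Lemma dwt_le k s : dwt k s <= t * wt k s.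
Proof.
rewrite /dwt mulrC; apply: ler_wpM2r; first exact: ltW (wt_gt0 _ _).
by rewrite -psig; apply: ler_wpM2l; [exact: ltW p_gt0|exact: dlogw_le].
Qed.

Lemma wt_le k s : wt k s <= expR (t * s).
Proof.
by rewrite ler_expR -psig -mulrA; apply: ler_wpM2l; [exact: ltW p_gt0|exact: logw_le].
Qed.

Lemma wt_ge k s : s <= k -> expR (t * s) <= expR (p * ((sig + 1) * ln 2)) * wt k s.
Proof.
move=> sk; rewrite -expRD ler_expR -mulrDr -psig -mulrA.
apply: ler_wpM2l; first exact: ltW p_gt0.
by rewrite addrC -lerBlDr; exact: logw_ge.
Qed.

Definition fluxk k := flux phi p (wt k).
Definition dfluxk k := dflux phi p (wt k) (dwt k).

Lemma dfluxk_cont k i x : collar x -> {for x, continuous (dfluxk k i)}.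
Proof.
move=> cx.
have cw : {for x, continuous (fun y => wt k (phi y))}.
  by apply: cont_comp; [exact: phi_cont|exact: wt_cont].
have cdw : {for x, continuous (fun y => dwt k (phi y))}.
  by apply: cont_comp; [exact: phi_cont|exact: dwt_cont].
have cg := growth_cont cx.
have cN := sqgrad_cont cx.
apply: cont_add; first by apply: cont_mul; [exact: cont_mul|exact: ddphi_cont].
apply: cont_mul; first exact: dphi_cont.
apply: cont_add.
  apply: cont_mul => //; apply: cont_mul.
    apply: cont_mul => //; apply: cont_mul; first exact: cont_cst.
    apply: continuousV; first by rewrite gt_eqF // ltr_pwDl // sqgrad_ge0.
    by apply: cont_add => //; exact: cont_cst.
  apply: cont_sum => j; apply: cont_mul; last exact: ddphi_cont.
  by apply: cont_mul; [exact: cont_cst|exact: dphi_cont].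
by apply: cont_mul => //; apply: cont_mul => //; exact: dphi_cont.
Qed.

Lemma fluxk_is_derive k i x : collar x -> is_derive x (e i) (fluxk k i) (dfluxk k i x).
Proof. by move=> cx; exact: (flux_is_derive p sphi (wt_is_derive k) i cx). Qed.

Lemma fluxk_cont k i x : collar x -> {for x, continuous (fluxk k i)}.
Proof.
move=> cx; apply: cont_mul; last exact: dphi_cont.
apply: cont_mul; last exact: growth_cont.
by apply: cont_comp; [exact: phi_cont|exact: wt_cont].
Qed.

Lemma div_fluxk_le k x : collar x ->
  \sum_i dfluxk k i x <= - (kappa - t) * (wt k (phi x) * (growth c (N x) * N x)).
Proof.
move=> cx.
have := div_flux_le open_collar sphi gE n3 p2 Ap (dwt k) cx (ltW (wt_gt0 k (phi x))).
move/le_trans; apply.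
rewrite -mulrA [leRHS]mulrA; apply: ler_wpM2r.
  by rewrite mulr_ge0 ?sqgrad_ge0 // ltW // growth_gt0.
by rewrite [- (kappa - t)]opprB [leRHS]mulrBl lerD2r; exact: dwt_le.
Qed.

Lemma sum_flux_le k x :
  \sum_i `|fluxk k i x| <= n%:R * (wt k (phi x) * (growth c (N x) * Num.sqrt (N x))).
Proof.
apply: (@le_trans _ _ (\sum_(i < n) wt k (phi x) * (growth c (N x) * Num.sqrt (N x)))).
  2: by rewrite sumr_const card_ord mulr_natl.
apply: ler_sum => i _; rewrite /fluxk /flux !normrM (ger0_norm (ltW (wt_gt0 _ _))) (ger0_norm (ltW (growth_gt0 _ _))).
rewrite -mulrA; apply: ler_wpM2l; first exact: ltW (wt_gt0 _ _).
apply: ler_wpM2l; first exact: ltW (growth_gt0 _ _).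
rewrite -sqrtr_sqr; apply: ler_wsqrtr; rewrite /sqgrad (bigD1 i) //= lerDl.
by apply: sumr_ge0 => j _; exact: sqr_ge0.
Qed.

(** The energy density e^(t phi) (1 + N)^((p-2)/2) N. *)
Definition edens x : R := expR (t * phi x) * (growth c (N x) * N x).

Lemma edens_ge0 x : 0 <= edens x.
Proof. by rewrite mulr_ge0 ?expR_ge0 // mulr_ge0 ?sqgrad_ge0 // ltW // growth_gt0. Qed.

Let d0 : R := (kappa - t) / 2.
Let d00 : 0 < d0. Proof. by rewrite divr_gt0 // subr_gt0. Qed.
Let p0 : 0 < p := p_gt0.
Let c0 : 0 <= c. Proof. by rewrite divr_ge0 // subr_ge0. Qed.
Let n0 : 0 < n%:R :> R. Proof. by rewrite ltr0n (leq_trans _ n3). Qed.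

(** The quotient L / d in [young_growth]; one factor n comes from the exponent of the
cutoff, the other from the number of components of the flux. *)
Definition young_ratio (eps d' : R) x : R := n%:R ^+ 2 * cut_slope S r phi eps d' x / d0.

(** The second term of [young_growth], with the weight of the flux. *)
Definition young_error (eps d' : R) k x : R :=
  wt k (phi x) * (d0 * (young_ratio eps d' x ^+ 2 * growth c (young_ratio eps d' x ^+ 2))).

Lemma cut_slope_ge0 eps d' x : 0 <= eps -> 0 <= cut_slope S r phi eps d' x.
Proof.
move=> e0; apply: mulr_ge0; first exact: ler0n.
by rewrite addr_ge0 // mulr_ge0 ?expR_ge0 // divr_ge0 // ltW.
Qed.

(** The bound C0 must not depend on the truncation k.  On the outer shell the error
depends on the geometry only; near S the slope of the cutoff is eps e^phi, the
error is at most eps^2 times a constant depending on k, and eps is chosen after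
k. *)
Lemma young_error_bound : exists2 C0 : R, 0 <= C0 & forall k, 0 <= k ->
  exists2 eps : R, 0 < eps & forall d' x, young_error eps d' k x <= C0.
Proof.
have rr : 0 < r / 2 by rewrite divr_gt0.
have [Ph Ph0 HPh] := bounded_on_shell S0 cS r0 rr phi_cont.
pose Ls : R := 2 / r + expR Ph.
have Ls0 : 0 < Ls by rewrite addr_gt0 ?divr_gt0 ?expR_gt0.
pose ls := n%:R ^+ 2 * Ls / d0.
have ls0 : 0 <= ls by apply: divr_ge0; [apply: mulr_ge0; [exact: exprn_ge0|exact: ltW]|exact: ltW].
have g0 s : 0 <= growth c s by exact: expR_ge0.
pose Csh := expR (t * Ph) * (d0 * (ls ^+ 2 * growth c (ls ^+ 2))).
have Csh0 : 0 <= Csh.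
  apply: mulr_ge0; first exact: expR_ge0.
  by apply: mulr_ge0; [exact: ltW|apply: mulr_ge0; [exact: sqr_ge0|exact: g0]].
exists (Csh + 1); first exact: addr_ge0.
move=> k k0.
pose Bk := expR (p * (sig + 1) * k + c * ln 2).
have Bk0 : 0 < Bk by exact: expR_gt0.
have dB : 0 < d0 * Bk := mulr_gt0 d00 Bk0.
pose e1 : R := Num.min 1 (d0 * Bk)^-1.
have e10 : 0 < e1 by rewrite lt_min ltr01 invr_gt0.
have e11 : e1 <= 1 by rewrite ge_min lexx.
have e1B : d0 * (e1 ^+ 2 * Bk) <= 1.
  have : e1 <= (d0 * Bk)^-1 by rewrite ge_min lexx orbT.
  rewrite -[_^-1]mul1r ler_pdivlMr // => H.
  have -> : d0 * (e1 ^+ 2 * Bk) = e1 * (e1 * (d0 * Bk)).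
    by move: (d0) (e1) (Bk) => u v w; ring.
  apply: (@le_trans _ _ (e1 * 1)); last by rewrite mulr1.
  by apply: ler_wpM2l => //; exact: ltW.
pose eps := Num.min 1 (e1 * d0 / n%:R ^+ 2).
have eps0 : 0 < eps.
  by rewrite lt_min ltr01 divr_gt0 ?exprn_gt0 //; exact: mulr_gt0.
have eps1 : eps <= 1 by rewrite ge_min lexx.
have epsE : n%:R ^+ 2 * eps / d0 <= e1.
  rewrite ler_pdivrMr // mulrC -ler_pdivlMr ?exprn_gt0 //.
  by rewrite ge_min lexx orbT.
exists eps => // d' x.
rewrite /young_error /young_ratio /cut_slope.
case: (boolP (d' / 2 <= D x <= 7 / 4 * r)) => [/andP[xd xr]|_]; last first.
  rewrite mul0r mulr0 mul0r expr0n /= mul0r !mulr0; exact: addr_ge0.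
rewrite mul1r.
have [xs|xs] := leP (r / 2) (D x).
  apply: (@le_trans _ _ Csh); last by rewrite lerDl.
  have xsh : r / 2 <= D x <= 2 * r by rewrite xs /=; lra.
  have px : phi x <= Ph by apply: le_trans (ler_norm _) _; exact: HPh.
  have lx : n%:R ^+ 2 * (2 / r * true%:R + eps * expR (phi x)) / d0 <= ls.
    rewrite ler_pM2r ?invr_gt0 // ler_pM2l ?exprn_gt0 // mulr1 lerD2l.
    apply: (@le_trans _ _ (expR (phi x))); last by rewrite ler_expR.
    by rewrite ler_piMl // expR_ge0.
  have lx0 : 0 <= n%:R ^+ 2 * (2 / r * true%:R + eps * expR (phi x)) / d0.
    apply: divr_ge0; last exact: ltW.
    apply: mulr_ge0; first exact: exprn_ge0.
    by rewrite mulr1 addr_ge0 ?divr_ge0 ?(ltW r0) // mulr_ge0 ?expR_ge0 // ltW.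
  move: (_ / d0) lx lx0 => l lx lx0.
  have l2 : l ^+ 2 <= ls ^+ 2 by apply: lerXn2r.
  apply: ler_pM; [exact: ltW (wt_gt0 _ _)| | |].
  - by apply: mulr_ge0; [exact: ltW|apply: mulr_ge0; [exact: sqr_ge0|exact: g0]].
  - by apply: le_trans (wt_le _ _) _; rewrite ler_expR; apply: ler_wpM2l => //; exact: ltW.
  apply: ler_wpM2l; first exact: ltW.
  by apply: ler_pM => //; [exact: sqr_ge0|apply: growth_le => //; exact: sqr_ge0].
apply: (@le_trans _ _ 1); last by rewrite lerDr.
rewrite mulr0 add0r.
have q0 := expR_gt0 (phi x).
have lx : n%:R ^+ 2 * (eps * expR (phi x)) / d0 <= e1 * expR (phi x).
  by rewrite mulrA mulrAC; apply: ler_wpM2r => //; exact: ltW.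
have lx0 : 0 <= n%:R ^+ 2 * (eps * expR (phi x)) / d0.
  apply: divr_ge0; last exact: ltW.
  by apply: mulr_ge0; [exact: exprn_ge0|apply: mulr_ge0; exact: ltW].
have WB := @weight_bound R sig k c p (phi x) sig0 k0 c0.
have {}WB := WB (_ : p = 2 + 2 * c).
move: (_ / d0) lx lx0 => l lx lx0.
apply: le_trans e1B.
rewrite mulrCA; apply: ler_wpM2l; first exact: ltW.
have l2 : l ^+ 2 <= e1 ^+ 2 * expR (phi x) ^+ 2.
  by rewrite -exprMn; apply: lerXn2r => //; rewrite nnegrE mulr_ge0 // ltW.
have l2' : l ^+ 2 <= expR (phi x) ^+ 2.
  apply: le_trans l2 _; rewrite ler_piMl ?sqr_ge0 //.
  by rewrite expr_le1 // ltW.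
apply: (@le_trans _ _ (wt k (phi x) * (e1 ^+ 2 * expR (phi x) ^+ 2 * growth c (expR (phi x) ^+ 2)))).
  apply: ler_wpM2l; first exact: ltW (wt_gt0 _ _).
  by apply: ler_pM => //; [exact: sqr_ge0|apply: growth_le => //; exact: sqr_ge0].
rewrite -[X in _ * X]mulrA mulrCA; apply: ler_wpM2l; first exact: sqr_ge0.
by apply: WB; lra.
Qed.

Lemma finite_lower_bound (F : 'I_n -> R) : (forall i, 0 < F i) ->
  exists2 h : R, 0 < h & forall i, h <= F i.
Proof.
move=> F0; have S1 : 0 < 1 + \sum_i (F i)^-1.
  by rewrite ltr_pwDl // sumr_ge0 // => i _; rewrite invr_ge0 ltW.
exists (1 + \sum_i (F i)^-1)^-1; first by rewrite invr_gt0.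
move=> i; rewrite -[leRHS]invrK lef_pV2 ?posrE ?invr_gt0 // (bigD1 i) //=.
rewrite addrCA lerDl addr_ge0 // sumr_ge0 // => j _; by rewrite invr_ge0 ltW.
Qed.

Lemma lstep_small (h : R) : 0 < h -> exists m0, forall m, (m0 <= m)%N -> lstep m <= h.
Proof.
move=> h0; exists (Num.truncn h^-1).+1 => m mm.
rewrite /lstep -[leRHS]invrK lef_pV2 ?posrE ?invr_gt0 ?exprn_gt0 //.
have hi : 0 < h^-1 by rewrite invr_gt0.
have /andP[_ /ltW/le_trans] := truncn_itv (ltW hi); apply; apply: (@le_trans _ _ m%:R); first by rewrite ler_nat.
by rewrite -natrX ler_nat ltnW // ltn_expl.
Qed.

Lemma step_in_box (u v b : R) : 0 < u -> u <= 1 -> `|v| + 2 <= b -> - b < v + u < b.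
Proof.
move=> u0 u1; have := ler_norm v; have := ler_norm (- v); rewrite normrN.
by move: `|v| => w *; apply/andP; split; lra.
Qed.

(** Sum a^n times the increments of the flux, a being a cutoff, over the lattice and
shift the lattice.  On one side the divergence inequality yields - (kappa - t)
times the weighted energy; on the other side the increments of a^n are paid for by
half of that energy and the error of [young_error_bound].  The truncation level k
is taken above the maximum of phi on the given shell, so that the weight is
comparable to e^(t phi) there and the bound E is independent of the shell. *)
Lemma energy_bound : exists E : R, forall d, 0 < d -> exists m0, forall m, (m0 <= m)%N ->
  lsum B m (fun x => (d <= D x <= r)%R%:R * edens x) <= E.
Proof.
have [C0 C00 HC0] := young_error_bound.
pose V : R := (2 * B)%:R ^+ n.
pose K2 := expR (p * ((sig + 1) * ln 2)).
exists (K2 * ((C0 + 1) * V / d0)) => d dpos.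
have [k k0 Hk] := bounded_on_shell S0 cS r0 dpos phi_cont.
have [eps eps0 Heps] := HC0 k k0.
have [eta [d' sp]] := Hcut dpos eps0.
have d'0 := cut_gt0 sp.
pose a x := zeta S r x * eta x.
have a01 x : 0 <= a x <= 1.
  have /andP[z0 z1] := zeta_01 S r x; have /andP[e0 e1] := cut_01 sp x.
  by rewrite mulr_ge0 //= -[1]mulr1 ler_pM.
have [h1 h10 H1] := prod_cutoff_step S0 cS r0 phi_cont eps0 sp.
pose L := cut_slope S r phi eps d'.
have L0 x : 0 <= L x by apply: cut_slope_ge0; exact: ltW.
have d4 : 0 < d' / 4 by rewrite divr_gt0.
have [P2 P20 HP2] := bounded_on_shell S0 cS r0 d4 phi_cont.
pose LK := 2 / r + eps * expR P2.
have Lsupp x : L x != 0 -> d' / 4 <= D x <= 2 * r.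
  rewrite /L /cut_slope; case: (boolP (d' / 2 <= D x <= 7 / 4 * r)) => [/andP[xa xb] _|_].
    by apply/andP; split; lra.
  by rewrite mul0r eqxx.
have r20 : 0 <= 2 / r by rewrite divr_ge0 // ltW.
have LK0 : 0 <= LK by apply: addr_ge0 => //; apply: mulr_ge0; [exact: ltW|exact: expR_ge0].
have LKx x : L x <= LK.
  have [->|Lx] := eqVneq (L x) 0; first exact: LK0.
  have px : phi x <= P2 by apply: le_trans (ler_norm _) _; exact: HP2 (Lsupp x Lx).
  rewrite /L /cut_slope; apply: (@le_trans _ _ (2 / r * (r / 2 <= D x)%R%:R + eps * expR (phi x))).
    rewrite ler_piMl ?lern1 ?leq_b1 //; apply: addr_ge0; first exact: mulr_ge0.
    by apply: mulr_ge0; [exact: ltW|exact: expR_ge0].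
  apply: lerD; first by rewrite ler_piMr ?lern1 ?leq_b1.
  by apply: ler_wpM2l; [exact: ltW|rewrite ler_expR].
have [CF CF0 HCF] : exists2 CF : R, 0 <= CF & forall x, d' / 4 <= D x <= 2 * r ->
    \sum_i `|fluxk k i x| <= CF.
  have H i : exists C : R, forall x, d' / 4 <= D x <= 2 * r -> `|fluxk k i x| <= C.
    by have [C _ HC] := bounded_on_shell S0 cS r0 d4 (@fluxk_cont k i); exists C.
  have [C HC] := choice H.
  exists (\sum_i `|C i|); first by apply: sumr_ge0.
  by move=> x xd; apply: ler_sum => i _; apply: le_trans (HC i x xd) (ler_norm _).
have [h2 h20 H2] : exists2 h2 : R, 0 < h2 & forall i x h, d' / 4 <= D x <= 2 * r -> 0 < h <= h2 ->
    `|fluxk k i (x + h *: e i) - fluxk k i x - h * dfluxk k i x| <= h * (2 * n%:R)^-1.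
  have e1 : 0 < (2 * n%:R)^-1 :> R by rewrite invr_gt0 mulr_gt0.
  have H i : exists h : R, 0 < h /\ forall x h', d' / 4 <= D x <= 2 * r -> 0 < h' <= h ->
    `|fluxk k i (x + h' *: e i) - fluxk k i x - h' * dfluxk k i x| <= h' * (2 * n%:R)^-1.
    have [h0 h00 Hh] := uniform_step S0 cS r0 d4 e1 (@fluxk_is_derive k i) (@dfluxk_cont k i).
    by exists h0.
  have [F HF] := choice H.
  have [h0 h00 Hh] := @finite_lower_bound F (fun i => (HF i).1).
  exists h0 => // i x h xd /andP[hp hh]; apply: (HF i).2 => //.
  by rewrite hp (le_trans hh).
pose err := n%:R ^+ 2 * LK ^+ 2 * CF.
have err0 : 0 <= err by rewrite !mulr_ge0 ?sqr_ge0.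
have hs : 0 < Num.min (Num.min h1 h2) (Num.min 1 (2 * (err + 1))^-1).
  by rewrite !lt_min h10 h20 ltr01 invr_gt0 mulr_gt0 // ltr_wpDl.
have [m0 Hm0] := lstep_small hs.
exists m0 => m mm; have := Hm0 m mm; rewrite !le_min => /andP[/andP[hh1 hh2] /andP[hl1 hle]].
have hp : 0 < lstep m :> R by exact: lstep_gt0.
set h := lstep m in hp hh1 hh2 hl1 hle *.
have herr : h * err <= 2^-1.
  have e1 : 0 < err + 1 by rewrite ltr_wpDl.
  have : h * (2 * (err + 1)) <= 1 by rewrite -ler_pdivlMr ?mul1r // mulr_gt0.
  move: hp err0; move: (h) (err) => u v; nra.
pose W x := a x ^+ n * (wt k (phi x) * (growth c (N x) * N x)).
have gN0 x : 0 <= growth c (N x) * N x.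
  by apply: mulr_ge0; [exact: ltW (growth_gt0 _ _)|exact: sqgrad_ge0].
have W0 x : 0 <= W x.
  apply: mulr_ge0; first by apply: exprn_ge0; case/andP: (a01 x).
  by apply: mulr_ge0 => //; exact: ltW (wt_gt0 _ _).
have Vc : @lsum R n B m (fun=> 1) = V by exact: lsum_cst.
have V0 : 0 <= V by apply: exprn_ge0.
have zn : 0 ^+ n = 0 :> R by rewrite expr0n; case: (n) n3.
have nE : n = n.-1.+1 by case: (n) n3.
have nE2 : n.-1 = n.-2.+1 by case: (n) n3 => [|[|]].
(* Young's inequality pays for the difference of the cutoff with half of the
   good term, which is what makes d0 half of kappa - t; the step h absorbs
   the quadratic remainder *)
have RHSb x : - (h * (d0 * W x + (C0 + 2^-1))) <=
    \sum_i (a (x - h *: e i) ^+ n - a x ^+ n) * fluxk k i x.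
  have step i : `|a (x - h *: e i) ^+ n - a x ^+ n| <=
      h * (n%:R * a x ^+ n.-1 * L x + n%:R ^+ 2 * h * L x ^+ 2).
    have dist1 : `|(x - h *: e i) - x| = h.
      by rewrite addrAC subrr add0r normrN norm_step // ltW.
    have al : `|a (x - h *: e i) - a x| <= h * L x.
      by have := H1 x (x - h *: e i); rewrite dist1 => /(_ hh1).
    have := powerX_diff_sharp n.-1 (a01 x) (a01 (x - h *: e i)); rewrite -nE => /le_trans; apply.
    have hL0 : 0 <= h * L x by rewrite mulr_ge0 // ltW.
    have an0 : 0 <= a x ^+ n.-1 by apply: exprn_ge0; case/andP: (a01 x).
    have nn : (n.-1)%:R <= n%:R :> R by rewrite ler_nat leq_pred.
    apply: (@le_trans _ _ (n%:R * (a x ^+ n.-1 + n%:R * (h * L x)) * (h * L x))).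
      apply: ler_pM => //; first by rewrite mulr_ge0 // addr_ge0 // mulr_ge0.
      apply: ler_wpM2l => //; rewrite lerD2l; exact: ler_pM.
    rewrite le_eqVlt; apply/orP; left; apply/eqP.
    by move: (a x ^+ _) (L x) (h) n%:R => u v w z; ring.
  have sumb : `|\sum_i (a (x - h *: e i) ^+ n - a x ^+ n) * fluxk k i x| <=
      h * (d0 * W x + (C0 + 2^-1)).
    pose Mx := n%:R * a x ^+ n.-1 * L x + n%:R ^+ 2 * h * L x ^+ 2.
    have an0 : 0 <= a x ^+ n.-1 by apply: exprn_ge0; case/andP: (a01 x).
    apply: (@le_trans _ _ (h * (Mx * \sum_i `|fluxk k i x|))).
      apply: le_trans (ler_norm_sum _ _ _) _; rewrite mulr_sumr mulr_sumr.
      apply: ler_sum => i _; rewrite normrM mulrA; apply: ler_wpM2r => //; exact: step.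
    apply: ler_wpM2l; first exact: ltW.
    have [Lx|Lx] := eqVneq (L x) 0.
      rewrite /Mx Lx !mulr0 expr0n /= mulr0 addr0 mul0r.
      by apply: addr_ge0; [apply: mulr_ge0 => //; exact: ltW|rewrite addr_ge0].
    rewrite /Mx mulrDl addrA; apply: lerD; last first.
      apply: le_trans herr; rewrite /err.
      have -> : h * (n%:R ^+ 2 * LK ^+ 2 * CF) = n%:R ^+ 2 * h * LK ^+ 2 * CF.
        by move: (h) (LK) (CF) n%:R => *; ring.
      apply: ler_pM => //.
      - by rewrite mulr_ge0 ?sqr_ge0 // mulr_ge0 ?sqr_ge0 // ltW.
      - exact: sumr_ge0.
      - apply: ler_wpM2l; first by rewrite mulr_ge0 ?sqr_ge0 // ltW.
        by apply: lerXn2r; rewrite ?nnegrE; [exact: L0|exact: LK0|exact: LKx].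
      exact: HCF (Lsupp x Lx).
    apply: (@le_trans _ _ (n%:R * a x ^+ n.-1 * L x *
       (n%:R * (wt k (phi x) * (growth c (N x) * Num.sqrt (N x)))))).
      by apply: ler_wpM2l; [rewrite mulr_ge0 // mulr_ge0|exact: sum_flux_le].
    have cn : 2 * c <= n%:R - 2 by move: pn; move: n%:R => z; lra.
    have L20 : 0 <= n%:R ^+ 2 * L x by rewrite mulr_ge0 // sqr_ge0.
    have := young_growth (ltnW n3) c0 cn (a01 x) L20 d00 (sqrtr_ge0 (N x)).
    rewrite sqr_sqrtr ?sqgrad_ge0 // => Y.
    have := ler_wpM2l (ltW (wt_gt0 k (phi x))) Y.
    have -> : wt k (phi x) * (a x ^+ n.-1 * (n%:R ^+ 2 * L x) *
       (growth c (N x) * Num.sqrt (N x))) = n%:R * a x ^+ n.-1 * L x *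
       (n%:R * (wt k (phi x) * (growth c (N x) * Num.sqrt (N x)))).
      move: (wt _ _) (a x ^+ _) (L x) (growth _ _) (Num.sqrt _) n%:R => u1 u2 u3 u4 u5 u6.
      by ring.
    move/le_trans; apply; rewrite mulrDr; apply: lerD.
      rewrite /W le_eqVlt; apply/orP; left; apply/eqP.
      by move: (wt _ _) (a x ^+ _) (d0) (N x) (growth _ _) => *; ring.
    exact: (Heps d' x).
  by move: sumb; rewrite ler_norml => /andP[].
(* the difference quotient of the flux is its divergence up to 1/2, uniformly
   on the shell that carries the cutoff *)
have LHSb x : \sum_i a x ^+ n * (fluxk k i (x + h *: e i) - fluxk k i x) <=
    h * (2^-1 - 2 * d0 * W x).
  have [ax|ax] := eqVneq (a x) 0.
    rewrite /W ax zn !mul0r big1 => [|i _]; last by rewrite !mul0r.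
    by rewrite mulr0 subr0 mulr_ge0 // ltW.
  have xs : d' / 4 <= D x <= 2 * r.
    by have /andP[xa xb] := prod_cutoff_supp r0 sp ax; apply/andP; split; lra.
  have cx : collar x by exact: (shell_in r0 d4 xs).
  have an0 : 0 <= a x ^+ n by apply: exprn_ge0; case/andP: (a01 x).
  have an1 : a x ^+ n <= 1 by apply: exprn_ile1; case/andP: (a01 x).
  rewrite -mulr_sumr.
  have St : \sum_i (fluxk k i (x + h *: e i) - fluxk k i x) <=
     h * (2^-1 - 2 * d0 * (wt k (phi x) * (growth c (N x) * N x))).
    apply: (@le_trans _ _ (\sum_i (h * dfluxk k i x + h * (2 * n%:R)^-1))).
      apply: ler_sum => i _; rewrite -lerBlDl.
      apply: le_trans (ler_norm _) _; apply: H2 => //; by rewrite hp.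
    have cs : \sum_(i < n) h * (2 * n%:R)^-1 = h * 2^-1.
      rewrite sumr_const card_ord -[_ *+ n]mulr_natr.
      by move: n0; move: n%:R (h) => z u z0; field; rewrite gt_eqF.
    rewrite big_split /= cs -mulr_sumr.
    rewrite -mulrDr; apply: ler_wpM2l; first exact: ltW.
    rewrite addrC lerD2l.
    have -> : 2 * d0 = kappa - t by rewrite /d0; move: n%:R => z; field.
    by rewrite -mulNr; exact: div_fluxk_le.
  apply: le_trans (ler_wpM2l an0 St) _.
  rewrite mulrCA; apply: ler_wpM2l; first exact: ltW.
  rewrite mulrBr; apply: lerB; first by rewrite ler_piMl.
  rewrite /W le_eqVlt; apply/orP; left; apply/eqP.
  by move: (wt _ _) (a x ^+ _) (d0) (N x) (growth _ _) => *; ring.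
have parts : lsum B m (fun x => \sum_i a x ^+ n * (fluxk k i (x + h *: e i) - fluxk k i x)) =
    lsum B m (fun x => \sum_i (a (x - h *: e i) ^+ n - a x ^+ n) * fluxk k i x).
  rewrite !lsum_sum; apply: eq_bigr => i _.
  apply: (@lsum_by_parts _ _ B m i (fun x => a x ^+ n) (fluxk k i)) => x ax.
  have ax' : a x != 0 by apply: contra ax => /eqP ->; rewrite zn.
  have /andP[xa xb] := prod_cutoff_supp r0 sp ax'.
  have := Hbox i (_ : D x < 4 * r); have Dx : D x < 4 * r by lra.
  by move=> /(_ Dx); exact: step_in_box.
pose T := lsum B m W.
have E1 : lsum B m (fun x => \sum_i a x ^+ n * (fluxk k i (x + h *: e i) - fluxk k i x)) <=
    h * (2^-1 * V - 2 * d0 * T).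
  apply: le_trans (ler_lsum _ _ LHSb) _.
  rewrite lsumZ lsumB lsumZ; have -> : @lsum R n B m (fun=> 2^-1) = 2^-1 * V; last by [].
  by rewrite -Vc -lsumZ; apply: eq_lsum => x; rewrite mulr1.
have E2 : - (h * (d0 * T + (C0 + 2^-1) * V)) <=
  lsum B m (fun x => \sum_i (a (x - h *: e i) ^+ n - a x ^+ n) * fluxk k i x).
  apply: le_trans (ler_lsum _ _ RHSb).
  rewrite (@eq_lsum _ _ B m _ (fun x => - h * (d0 * W x + (C0 + 2^-1) * 1))).
    by rewrite lsumZ lsumD !lsumZ Vc mulNr.
  by move=> x; rewrite mulr1 mulNr.
have TE : d0 * T <= (C0 + 1) * V.
  move: E1 E2; rewrite parts => E1 E2; have := le_trans E2 E1.
  rewrite -mulrN ler_pM2l // opprD.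
  by move: (d0) (C0) (V) (T) => x1 x2 x3 x4; lra.
apply: (@le_trans _ _ (K2 * T)); last first.
  apply: ler_wpM2l; first exact: expR_ge0.
  by rewrite ler_pdivlMr // mulrC.
rewrite -lsumZ; apply: ler_lsum => x.
case: (boolP (d <= D x <= r)) => [/andP[xd xr]|_]; last first.
  by rewrite mul0r; apply: mulr_ge0; [exact: expR_ge0|exact: W0].
have xs : d <= D x <= 2 * r by rewrite xd /=; lra.
have ax1 : a x = 1 by rewrite /a zeta_in // (cut_far sp) // mulr1.
rewrite mul1r /edens /W ax1 expr1n mul1r [leRHS]mulrA; apply: ler_wpM2r => //.
by apply: wt_ge; apply: le_trans (ler_norm _) _; exact: Hk.
Qed.

End Energy.

(** * The functions V and theta *)

Section Barriers.
Context {R : realType} {n : nat}.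
Variables (S : set 'rV[R]_n) (r : R) (phi : 'rV[R]_n -> R).
Variables (p : R).
Hypothesis S0 : S !=set0.
Hypothesis cS : compact S.
Hypothesis r0 : 0 < r.
Local Notation D := (sdist S).
Local Notation collar := [set x : 'rV[R]_n | 0 < D x < 4 * r].
Hypothesis sphi : smooth_on collar phi.
Hypothesis p2 : 2 <= p.
Local Notation e i := (delta_mx 0 i : 'rV[R]_n).
Local Notation N := (sqgrad phi).

Variable t : R.
Hypothesis t0 : 0 < t.
Local Notation sig := (t / p).
Local Notation dens := (edens phi p t).

Let p0 : 0 < p. Proof. exact: lt_le_trans p2. Qed.
Let s0 : 0 < sig. Proof. by rewrite divr_gt0. Qed.

(** Up to the factor sig, the length of the gradient of e^(sig phi). *)
Definition wgrad x : R := expR (sig * phi x) * Num.sqrt (N x).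

Lemma wgrad_ge0 x : 0 <= wgrad x.
Proof. by rewrite mulr_ge0 ?expR_ge0 ?sqrtr_ge0. Qed.

(** The p-th power of [wgrad] is at most the energy density, since N^(p/2) is at most
(1 + N)^((p-2)/2) N; the statement is the linearisation w <= A + A^(1-p) w^p with
A = e^nu, which replaces Hoelder's inequality. *)
Lemma wgrad_young x nu : wgrad x <= expR nu + expR ((1 - p) * nu) * dens x.
Proof.
have E0 : 0 <= dens x by exact: edens_ge0.
have [H|H] := leP (wgrad x) (expR nu).
  by apply: le_trans H _; rewrite lerDl mulr_ge0 // expR_ge0.
have N0 : 0 < N x.
  rewrite lt_neqAle sqgrad_ge0 andbT eq_sym; apply/eqP => N0.
  by move: H; rewrite /wgrad N0 sqrtr0 mulr0 ltNge expR_ge0.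
have c0 : 0 <= (p - 2) / 2 by rewrite divr_ge0 // subr_ge0.
pose om := sig * phi x + 2^-1 * ln (N x).
have sE : Num.sqrt (N x) = expR (2^-1 * ln (N x)).
  apply/eqP; rewrite -(eqrXn2 (ltn0Sn 1)) ?sqrtr_ge0 ?expR_ge0 //.
  by rewrite sqr_sqrtr ?(ltW N0) // -expRM_natl mulrA mulfV ?pnatr_eq0 // mul1r lnK ?posrE.
have wE : wgrad x = expR om by rewrite /wgrad sE -expRD.
have nuom : nu <= om by move: H; rewrite wE ltr_expR => /ltW.
have edE : expR (p * om) <= dens x.
  rewrite /edens -[X in _ * (_ * X)]lnK ?posrE // /growth -!expRD ler_expR /om mulrDr.
  have -> : p * (sig * phi x) = t * phi x by move: (phi x) => u; field; rewrite gt_eqF.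
  rewrite lerD2l.
  have : ln (N x) <= ln (1 + N x) by rewrite ler_ln ?posrE ?addr_gt0 // lerDr.
  move=> /(ler_wpM2l c0); move: (ln (N x)) (ln (1 + N x)) => u v; lra.
rewrite wE; apply: (@le_trans _ _ (expR ((1 - p) * nu) * dens x)).
  2: by rewrite lerDr expR_ge0.
apply: (@le_trans _ _ (expR ((1 - p) * nu) * expR (p * om))).
  2: by apply: ler_wpM2l => //; exact: expR_ge0.
rewrite -expRD ler_expR.
have p1 : 0 <= p - 1 by move: p2; lra.
have := ler_wpM2l p1 nuom; lra.
Qed.

(** The power e^(sig phi), truncated as in [logw]. *)
Definition tpow k (s : R) : R := expR (logw sig k s).
Definition dtpow k (s : R) : R := tpow k s * dlogw sig k s.

Lemma tpow_is_derive k (s : R) : is_derive s 1 (tpow k) (dtpow k s).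
Proof. exact: (is_derive_chain (logw_is_derive sig k s) (is_derive_expR (logw sig k s))). Qed.

Lemma tpow_gt0 k s : 0 < tpow k s. Proof. exact: expR_gt0. Qed.

Lemma tpow_le k s : tpow k s <= expR (sig * s).
Proof. by rewrite ler_expR; apply: logw_le; exact: ltW. Qed.

Lemma tpow_exp_le k s : tpow k s * expR s <= expR ((sig + 1) * k).
Proof. by rewrite -expRD ler_expR; apply: logw_add_le; exact: ltW. Qed.

Lemma tpow_ge k s : s <= k -> expR (sig * s) <= expR ((sig + 1) * ln 2) * tpow k s.
Proof.
move=> sk; rewrite -expRD ler_expR addrC -lerBlDr; apply: logw_ge => //; exact: ltW.
Qed.

Lemma dtpow_norm k s : `|dtpow k s| <= (1 + sig) * expR (sig * s).
Proof.
rewrite normrM (ger0_norm (ltW (tpow_gt0 k s))) mulrC; apply: ler_pM => //.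
- exact: ltW (tpow_gt0 _ _).
- have H1 := dlogw_le k (ltW s0) s; have H2 := dlogw_ge k (ltW s0) s.
  by rewrite ler_norml; move: s0 H1 H2; move: (sig) (dlogw _ _ _) => u v *; apply/andP; split; lra.
- exact: tpow_le.
Qed.

(** The function V: the truncated power of the conformal factor, cut off at the outer
scale and near S. *)
Definition barrier k (eta2 : 'rV[R]_n -> R) x : R := zeta S r x * eta2 x * tpow k (phi x).

(** A bound for the difference quotients of V: the gradient of the conformal power plus
the contribution C1 of the cutoffs. *)
Definition slopeV (d3 C1 : R) x : R :=
  (d3 / 2 <= D x <= 7 / 4 * r)%R%:R * ((1 + sig) * wgrad x + C1).

Lemma tpow_step k d3 i (eps : R) : 0 < d3 -> 0 < eps ->
  exists2 h0 : R, 0 < h0 & forall x h, d3 <= D x <= 2 * r -> 0 < h <= h0 ->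
   `|tpow k (phi (x + h *: e i)) - tpow k (phi x)| <= h * ((1 + sig) * wgrad x + eps).
Proof.
move=> d30 eps0.
pose df x := dtpow k (phi x) * pderiv i phi x.
have Hd x : collar x -> is_derive x (e i) (fun y => tpow k (phi y)) (df x).
  by move=> cx; exact: (is_derive_chain (phi_is_derive sphi i cx) (tpow_is_derive k (phi x))).
have Hc x : collar x -> {for x, continuous df}.
  move=> cx; apply: cont_mul; last exact: (dphi_cont sphi).
  apply: (cont_comp (h := dtpow k)); first exact: (phi_cont sphi).
  apply: (@cont_mul R R); first exact: derivable_cont (tpow_is_derive k _).
  apply: (@cont_add R R); first exact: cont_cst.
  apply: (cont_comp (h := -%R)); last exact: opp_continuous.
  apply: (@cont_mul R R); first exact: cont_cst.
  have E : {for (phi x), continuous (fun s : R => expR (s - k))}.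
    apply: (cont_comp (h := expR)); last exact: continuous_expR.
    by apply: (@cont_add R R); [exact: id|exact: cont_cst].
  apply: (@cont_mul R R) => //.
  apply: continuousV; last by apply: (@cont_add R R); [exact: cont_cst|].
  by rewrite gt_eqF // addr_gt0 // expR_gt0.
have [h0 h00 H] := uniform_step S0 cS r0 d30 eps0 Hd Hc.
exists h0 => // x h xd hh; have := H x h xd hh.
have /andP[hp _] := hh.
have dfb : `|df x| <= (1 + sig) * wgrad x.
  rewrite /df normrM mulrA; apply: ler_pM => //; first exact: dtpow_norm.
  rewrite -sqrtr_sqr; apply: ler_wsqrtr; rewrite /sqgrad (bigD1 i) //= lerDl.
  by apply: sumr_ge0 => j _; exact: sqr_ge0.
set u := tpow _ _ - tpow _ _ => Hu.
rewrite -(subrK (h * df x) u) mulrDr addrC; apply: le_trans (ler_normD _ _) _.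
apply: lerD => //; rewrite normrM gtr0_norm //; apply: ler_wpM2l => //; exact: ltW.
Qed.

(** The constant C1 does not depend on k or on the cutoff: the slope eps e^phi of eta2
is multiplied by the truncated power, and their product is at most 1 for
eps = e^(-(sig+1) k). *)
Lemma barrier_step : exists2 C1 : R, 0 <= C1 & forall k, exists2 eps : R, 0 < eps &
  forall d eta2 d3, cutoff_spec S r phi d eps eta2 d3 ->
  exists2 h0 : R, 0 < h0 & forall i x h, 0 < h <= h0 ->
    `|barrier k eta2 (x + h *: e i) - barrier k eta2 x| <= h * slopeV d3 C1 x.
Proof.
have phic := @phi_cont R n S r phi sphi.
have rr : 0 < r / 2 by rewrite divr_gt0.
have [Ph Ph0 HPh] := bounded_on_shell S0 cS r0 rr phic.
have r20 : 0 <= 2 / r by rewrite divr_ge0 // ltW.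
(* one summand each for zeta, for eta2 and for the error of the difference quotient *)
exists (2 / r * expR (sig * Ph) + 1 + 1).
  by rewrite !addr_ge0 // mulr_ge0 // expR_ge0.
move=> k; exists (expR (- ((sig + 1) * k))); first exact: expR_gt0.
set eps := expR _ => d eta2 d3 sp.
have eps0 : 0 < eps by exact: expR_gt0.
have d30 := cut_gt0 sp.
pose a x := zeta S r x * eta2 x.
have a01 x : 0 <= a x <= 1.
  have /andP[z0 z1] := zeta_01 S r x; have /andP[e0 e1] := cut_01 sp x.
  by rewrite mulr_ge0 //= -[1]mulr1 ler_pM.
have [h1 h10 H1] := prod_cutoff_step S0 cS r0 phic eps0 sp.
have d34 : 0 < d3 / 2 by rewrite divr_gt0.
have H i : exists h : R, 0 < h /\ forall x h', d3 / 2 <= D x <= 2 * r -> 0 < h' <= h ->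
   `|tpow k (phi (x + h' *: e i)) - tpow k (phi x)| <= h' * ((1 + sig) * wgrad x + 1).
  by have [h0 h00 Hh] := tpow_step k i d34 ltr01; exists h0.
have [F HF] := choice H.
have [h2 h20 Hh2] := finite_lower_bound (fun i => (HF i).1).
exists (Num.min h1 h2); first by rewrite lt_min h10.
move=> i x h /andP[hp]; rewrite le_min => /andP[hh1 hh2].
set x' := x + h *: e i.
have dist1 : `|x' - x| = h by rewrite addrAC subrr add0r norm_step // ltW.
have al : `|a x' - a x| <= h * cut_slope S r phi eps d3 x.
  by rewrite -dist1; apply: H1; rewrite dist1.
have -> : barrier k eta2 x' - barrier k eta2 x =
   (a x' - a x) * tpow k (phi x) + a x' * (tpow k (phi x') - tpow k (phi x)).
  have VE y : barrier k eta2 y = a y * tpow k (phi y) by [].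
  by rewrite !VE; move: (a x) (a x') (tpow _ _) (tpow _ _) => *; ring.
rewrite /slopeV; case: (boolP (d3 / 2 <= D x <= 7 / 4 * r)) => [/andP[xa xb]|xn]; last first.
  move: al; rewrite /cut_slope (negbTE xn) mul0r mulr0 normr_le0 subr_eq0 => /eqP ax.
  have ax0 : a x = 0.
    apply/eqP; apply: contraNT xn => /(prod_cutoff_supp r0 sp)/andP[u v].
    by apply/andP; split; lra.
  by rewrite ax ax0 subrr !mul0r addr0 normr0 mulr0.
rewrite mul1r.
have GL : cut_slope S r phi eps d3 x * tpow k (phi x) <= 2 / r * expR (sig * Ph) + 1.
  rewrite /cut_slope xa xb /= mul1r mulrDl; apply: lerD; last first.
    rewrite -mulrA [expR _ * tpow _ _]mulrC.
    apply: (@le_trans _ _ (eps * expR ((sig + 1) * k))).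
      by apply: ler_wpM2l; [exact: ltW|exact: tpow_exp_le].
    by rewrite /eps -expRD addNr expR0.
  have [xs|xs] := leP (r / 2) (D x); last first.
    by rewrite mulr0 mul0r mulr_ge0 // expR_ge0.
  rewrite mulr1; apply: ler_wpM2l => //; apply: le_trans (tpow_le _ _) _.
  rewrite ler_expR; apply: ler_wpM2l; first exact: ltW.
  apply: le_trans (ler_norm _) _; apply: HPh; rewrite xs /=; lra.
apply: le_trans (ler_normD _ _) _.
rewrite (normrM (a x' - a x)) (normrM (a x')) (gtr0_norm (tpow_gt0 k (phi x))).
have /andP[a0 a1] := a01 x'; rewrite (ger0_norm a0).
apply: (@le_trans _ _ (h * (2 / r * expR (sig * Ph) + 1) + h * ((1 + sig) * wgrad x + 1))).
  apply: lerD.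
    apply: (@le_trans _ _ (h * cut_slope S r phi eps d3 x * tpow k (phi x))).
      by apply: ler_wpM2r => //; exact: ltW (tpow_gt0 _ _).
    by rewrite -mulrA; apply: ler_wpM2l => //; exact: ltW.
  apply: (@le_trans _ _ (1 * (h * ((1 + sig) * wgrad x + 1)))); last by rewrite mul1r.
  apply: ler_pM => //; apply: (HF i).2.
    by rewrite xa /=; lra.
  by rewrite hp (le_trans hh2).
rewrite -mulrDr ler_pM2l //.
by move: (2 / r * _) ((1 + sig) * _) => *; lra.
Qed.

Lemma barrier_ge0 k eta2 x d eps d3 : cutoff_spec S r phi d eps eta2 d3 -> 0 <= barrier k eta2 x.
Proof.
move=> sp; rewrite mulr_ge0 //; last exact: ltW (tpow_gt0 _ _).
by have /andP[z0 _] := zeta_01 S r x; have /andP[e0 _] := cut_01 sp x; rewrite mulr_ge0.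
Qed.

Lemma barrier_supp k eta2 x d eps d3 : cutoff_spec S r phi d eps eta2 d3 ->
  barrier k eta2 x != 0 -> D x <= 3 / 2 * r.
Proof.
move=> sp; rewrite mulf_eq0 negb_or => /andP[H _].
by have /andP[] := prod_cutoff_supp r0 sp H.
Qed.

(** The function 1 - eta near S.  It is extended by 0, since nothing is known about
eta at distance more than 2 r. *)
Definition theta (eta1 : 'rV[R]_n -> R) x : R := if D x < r / 2 then 1 - eta1 x else 0.

Lemma theta_01 d eps eta1 d1 x : cutoff_spec S r phi d eps eta1 d1 -> 0 <= theta eta1 x <= 1.
Proof.
move=> sp; rewrite /theta; case: ifP => _; last by rewrite lexx ler01.
by have /andP[a b] := cut_01 sp x; rewrite subr_ge0 b gerBl.
Qed.

Lemma theta_far eps eta1 d1 x : cutoff_spec S r phi (r / 4) eps eta1 d1 ->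
  r / 4 <= D x -> theta eta1 x = 0.
Proof.
move=> sp xr; rewrite /theta; case: ltP => // xr2.
by rewrite (cut_far sp) ?subrr // xr /=; lra.
Qed.

Lemma theta_near eps eta1 d1 x : cutoff_spec S r phi (r / 4) eps eta1 d1 ->
  D x < d1 -> D x <= 2 * r -> theta eta1 x = 1.
Proof.
move=> sp xd xr; have e0 := cut_near sp xd; rewrite /theta e0 subr0.
case: ltP => // xr2; have := cut_far sp (x := x); rewrite e0 xr andbT.
have -> : r / 4 <= D x by lra.
by move=> /(_ isT)/eqP; rewrite eq_sym oner_eq0.
Qed.

Lemma theta_step eps eta1 d1 : 0 < eps -> cutoff_spec S r phi (r / 4) eps eta1 d1 ->
  exists2 h0 : R, 0 < h0 & forall x x', `|x' - x| <= h0 -> theta eta1 x' != theta eta1 x ->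
    [/\ d1 / 4 <= D x <= r / 2, d1 / 4 <= D x' <= r / 2 &
     `|theta eta1 x' - theta eta1 x| <= eps * expR (phi x) * `|x' - x|].
Proof.
move=> eps0 sp.
have phic := @phi_cont R n S r phi sphi.
have [h1 h10 H1] := cutoff_steps S0 cS r0 phic eps0 sp.
have d10 := cut_gt0 sp.
exists (Num.min h1 (Num.min (d1 / 8) (r / 8))); first by rewrite !lt_min h10 !divr_gt0.
move=> x x'; rewrite !le_min => /and3P[hh1 hd hr] ne.
have xx' : D x <= D x' + `|x' - x| by rewrite distrC; exact: sdist_lip.
have x'x : D x' <= D x + `|x' - x| by exact: sdist_lip.
have [xr x'r] : D x < r / 2 /\ D x' < r / 2.
  have [xr|xr] := ltP (D x) (r / 4); first by split; lra.
  have [x'r|x'r] := ltP (D x') (r / 4); first by split; lra.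
  by move: ne; rewrite (theta_far sp xr) (theta_far sp x'r) eqxx.
have both : D x < d1 -> D x' < d1 -> False.
  move=> A A'; have E1 : D x <= 2 * r by lra.
  have E2 : D x' <= 2 * r by lra.
  by move: ne; rewrite (theta_near sp A E1) (theta_near sp A' E2) eqxx.
have xd : d1 / 2 <= D x.
  by rewrite leNgt; apply/negP => A; apply: both; lra.
have x'd : d1 / 2 <= D x'.
  by rewrite leNgt; apply/negP => A; apply: both; lra.
split; [by apply/andP; split; lra|by apply/andP; split; lra|].
have -> : theta eta1 x' - theta eta1 x = - (eta1 x' - eta1 x).
  by rewrite /theta xr x'r; move: (eta1 x) (eta1 x') => u v; ring.
rewrite normrN; apply: H1 => //; last by lra.
by apply/andP; split; lra.
Qed.

(** The function through which theta is compared on cubes of consecutive levels: it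
differs from theta by at most V / M, M = e^mu, and vanishes wherever V >= M. *)
Definition Phi (theta V : 'rV[R]_n -> R) (mu : R) x : R :=
  Num.max 0 (theta x - V x * expR (- mu)).

(** A bound for phi at the points where V <= e^mu; see [conformal_factor_le]. *)
Definition level (mu : R) : R := ((sig + 1) * ln 2 + mu) / sig.

(** The same for [Phi]: the slope of V / M, and that of theta with e^phi replaced by its
bound at the points where V <= M. *)
Definition slopePhi (d3 C1 eps mu : R) x : R :=
  slopeV d3 C1 x * expR (- mu) + (D x <= r / 2)%R%:R * (eps * expR (level mu)).

Lemma posp_lip (u v : R) : `|Num.max 0 u - Num.max 0 v| <= `|u - v|.
Proof.
rewrite ler_norml; have := ler_norm (u - v); have := ler_norm (v - u).
rewrite (distrC v u); move: `|_ - _| => d.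
by case: (leP 0 u) => ?; case: (leP 0 v) => ?; move=> *; apply/andP; split; lra.
Qed.

Lemma slopeV_ge0 d3 C1 x : 0 <= C1 -> 0 <= slopeV d3 C1 x.
Proof.
move=> C10; rewrite mulr_ge0 // addr_ge0 // mulr_ge0 ?wgrad_ge0 //.
by rewrite addr_ge0 // ltW.
Qed.

Lemma slopePhi_ge0 d3 C1 eps mu x : 0 <= C1 -> 0 <= eps -> 0 <= slopePhi d3 C1 eps mu x.
Proof.
move=> C10 eps0; rewrite addr_ge0 // mulr_ge0 ?expR_ge0 ?slopeV_ge0 //.
by rewrite mulr_ge0 // expR_ge0.
Qed.

(** Here v is the value of V and z that of theta; [Phi] is positive only where V is
below M, and there the power e^(sig phi) is at most a constant times M. *)
Lemma conformal_factor_le k (u mu v z : R) : u <= k -> v = 1 * tpow k u ->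
  0 < Num.max 0 (z - v * expR (- mu)) -> z <= 1 -> expR u <= expR (level mu).
Proof.
move=> uk ->; rewrite lt_max ltxx /= subr_gt0 mul1r => H z1.
have {H z1} H : tpow k u < expR mu.
  have := lt_le_trans H z1; rewrite expRN -ltr_pdivlMr ?invr_gt0 ?expR_gt0 //.
  by rewrite invrK mul1r.
rewrite ler_expR /level ler_pdivlMr // mulrC -(ler_expR (sig * u)).
apply: le_trans (tpow_ge uk) _; rewrite expRD.
by apply: ler_wpM2l; [exact: expR_ge0|exact: ltW].
Qed.

(** The order of the choices matters.  First theta, with the given eps; then k above
the maximum of phi where theta varies; then, depending on k, the cutoff of V, which
is 1 there.  So V is an honest power of the conformal factor wherever theta varies. *)
Lemma barriers :
  (forall d eps, 0 < d -> 0 < eps -> exists eta d', cutoff_spec S r phi d eps eta d') ->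
  exists2 C1 : R, 0 <= C1 & forall eps : R, 0 < eps ->
  exists (th V : 'rV[R]_n -> R) (d3 q h0 : R),
    [/\ 0 < d3, 0 < q & 0 < h0] /\
    [/\ forall x, 0 <= th x <= 1, forall x, r / 4 <= D x -> th x = 0,
        forall x, D x < q -> th x = 1, forall x, 0 <= V x &
        forall x, V x != 0 -> D x <= 3 / 2 * r] /\
    forall i x h, 0 < h <= h0 ->
      `|V (x + h *: e i) - V x| <= h * slopeV d3 C1 x /\
      forall mu, `|Phi th V mu (x + h *: e i) - Phi th V mu x| <= h * slopePhi d3 C1 eps mu x.
Proof.
move=> Hcut; have [C1 C10 HV] := barrier_step.
exists C1 => // eps eps0.
have r40 : 0 < r / 4 by rewrite divr_gt0.
have [eta1 [d1 sp1]] := Hcut (r / 4) eps r40 eps0.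
have d10 := cut_gt0 sp1.
have d140 : 0 < d1 / 4 by rewrite divr_gt0.
have [h1 h10 Hth] := theta_step eps0 sp1.
have [k k0 Hk] := bounded_on_shell S0 cS r0 d140 (@phi_cont R n S r phi sphi).
have [eps2 eps20 Hsp2] := HV k.
have [eta2 [d3 sp2]] := Hcut (d1 / 4) eps2 d140 eps20.
have [h2 h20 HVs] := Hsp2 _ _ _ sp2.
have d30 := cut_gt0 sp2.
exists (theta eta1), (barrier k eta2), d3, (Num.min d1 (2 * r)), (Num.min h1 h2).
split; first by split; rewrite ?lt_min ?d30 ?d10 ?h10 ?h20 ?mulr_gt0.
split.
  split.
  - by move=> x; exact: theta_01 sp1.
  - by move=> x; exact: (theta_far sp1).
  - by move=> x; rewrite lt_min => /andP[xd /ltW xr]; exact: (theta_near sp1).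
  - by move=> x; exact: barrier_ge0 sp2.
  - by move=> x; exact: (barrier_supp sp2).
move=> i x h /andP[hp]; rewrite le_min => /andP[hh1 hh2].
have HVx : `|barrier k eta2 (x + h *: e i) - barrier k eta2 x| <= h * slopeV d3 C1 x.
  by apply: HVs; rewrite hp hh2.
split=> // mu.
set x' := x + h *: e i in HVx *.
have dist1 : `|x' - x| = h by rewrite addrAC subrr add0r norm_step // ltW.
have em : 0 < expR (- mu) by exact: expR_gt0.
have Vpart : `|barrier k eta2 x' * expR (- mu) - barrier k eta2 x * expR (- mu)| <=
    h * (slopeV d3 C1 x * expR (- mu)).
  rewrite -mulrBl normrM (gtr0_norm em) [leRHS]mulrA.
  by apply: ler_wpM2r HVx; exact: ltW.
have R2 : 0 <= h * ((D x <= r / 2)%R%:R * (eps * expR (level mu))).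
  by rewrite !mulr_ge0 ?expR_ge0 // ltW.
rewrite /slopePhi mulrDr.
have [E|ne] := eqVneq (theta eta1 x') (theta eta1 x).
  apply: (@le_trans _ _ (h * (slopeV d3 C1 x * expR (- mu)))); last by rewrite lerDl.
  apply: le_trans (posp_lip _ _) _; rewrite E.
  by rewrite opprD addrACA subrr add0r opprK addrC distrC.
have d1h : `|x' - x| <= h1 by rewrite dist1.
have [/andP[xa xb] /andP[xa' xb'] Hd] := Hth x x' d1h ne.
have d1h' : `|x - x'| <= h1 by rewrite distrC.
have ne' : theta eta1 x != theta eta1 x' by rewrite eq_sym.
have [_ _ Hd'] := Hth x' x d1h' ne'.
have VE z : d1 / 4 <= D z -> D z <= r / 2 -> phi z <= k /\ barrier k eta2 z = 1 * tpow k (phi z).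
  move=> za zb; have zs : d1 / 4 <= D z <= 2 * r by rewrite za /=; lra.
  split; first by apply: le_trans (ler_norm _) _; exact: Hk.
  by rewrite /barrier zeta_in // ?(cut_far sp2 zs) ?mulr1 //; lra.
have th1 z : theta eta1 z <= 1 by have /andP[] := theta_01 z sp1.
have Sum u : 0 <= u -> u <= expR (level mu) ->
   `|theta eta1 x' - theta eta1 x| <= eps * u * h ->
   `|Phi (theta eta1) (barrier k eta2) mu x' - Phi (theta eta1) (barrier k eta2) mu x| <=
   h * (slopeV d3 C1 x * expR (- mu)) + h * ((D x <= r / 2)%R%:R * (eps * expR (level mu))).
  move=> u0 ul Hu; apply: le_trans (posp_lip _ _) _.
  rewrite opprD addrACA opprK addrC; apply: le_trans (ler_normD _ _) _.
  apply: lerD; first by rewrite addrC distrC.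
  apply: le_trans Hu _; rewrite xb mul1r mulrC; apply: ler_wpM2l; first exact: ltW.
  by apply: ler_wpM2l => //; exact: ltW.
have [px|px] := ltP 0 (Phi (theta eta1) (barrier k eta2) mu x).
  have [pk ve] := VE x xa xb.
  apply: (Sum (expR (phi x))); rewrite ?expR_ge0 //; last by rewrite -dist1.
  exact: (conformal_factor_le pk ve px (th1 x)).
have [px'|px'] := ltP 0 (Phi (theta eta1) (barrier k eta2) mu x').
  have [pk ve] := VE x' xa' xb'.
  apply: (Sum (expR (phi x'))); rewrite ?expR_ge0 //.
    exact: (conformal_factor_le pk ve px' (th1 x')).
  by rewrite distrC -dist1 (distrC x').
have P0 z : Phi (theta eta1) (barrier k eta2) mu z <= 0 -> Phi (theta eta1) (barrier k eta2) mu z = 0.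
  by move=> H; apply/eqP; rewrite eq_le H /= /Phi le_max lexx.
rewrite (P0 _ px) (P0 _ px') subrr normr0.
apply: addr_ge0 => //; apply: mulr_ge0; first exact: ltW.
by apply: mulr_ge0; [exact: slopeV_ge0|exact: ltW].
Qed.

End Barriers.

(** * Powers of two and telescoping chains *)

Section PowersOfTwo.
Context {R : realType}.
Implicit Types a b s : R.

(** Real powers of 2, for sides of dyadic cubes raised to real exponents. *)
Definition e2 s : R := expR (s * ln 2).

Lemma e2D a b : e2 (a + b) = e2 a * e2 b. Proof. by rewrite /e2 mulrDl expRD. Qed.
Lemma e2_gt0 a : 0 < e2 a. Proof. exact: expR_gt0. Qed.
Lemma e2_ge0 a : 0 <= e2 a. Proof. exact: expR_ge0. Qed.
Lemma e20 : e2 0 = 1. Proof. by rewrite /e2 mul0r expR0. Qed.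

Lemma ln2_gt0 : 0 < ln 2 :> R. Proof. by apply: ln_gt0; rewrite ltr1n. Qed.

Lemma e2_le a b : (e2 a <= e2 b) = (a <= b).
Proof. by rewrite ler_expR ler_pM2r // ln2_gt0. Qed.

Lemma e2_lt a b : (e2 a < e2 b) = (a < b).
Proof. by rewrite ltr_expR ltr_pM2r // ln2_gt0. Qed.

Lemma e2_nat (j : nat) : e2 j%:R = 2 ^+ j.
Proof. by rewrite /e2 expRM_natl lnK // posrE. Qed.

Lemma e2_natN (j : nat) : e2 (- j%:R) = 2 ^- j.
Proof. by rewrite /e2 mulNr expRN -/(e2 _) e2_nat. Qed.

Lemma e2_ge1 a : 0 <= a -> 1 <= e2 a. Proof. by rewrite -e20 e2_le. Qed.

Lemma e2_small a (eps : R) : 0 < a -> 0 < eps ->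
  exists j0 : nat, forall j, (j0 <= j)%N -> e2 (- (j%:R * a)) <= eps.
Proof.
move=> a0 e0; exists (Num.truncn (eps^-1 / (a * ln 2))).+1 => j jj.
have al : 0 < a * ln 2 by rewrite mulr_gt0 // ln2_gt0.
have ei : 0 <= eps^-1 / (a * ln 2) by rewrite divr_ge0 ?invr_ge0 //; exact: ltW.
have /andP[_ /ltW H] := truncn_itv ei.
have jr : eps^-1 <= j%:R * (a * ln 2).
  by rewrite -ler_pdivrMr // (le_trans H) // ler_nat.
rewrite /e2 mulNr expRN -[eps]invrK lef_pV2 ?posrE ?expR_gt0 ?invr_gt0 //.
apply: le_trans jr _; rewrite mulrA; apply: le_trans (expR_ge1Dx _).
by rewrite lerDr.
Qed.

Lemma chain_growth (A : nat -> R) (K b X : R) (j0 J : nat) : 0 < b -> 0 <= K -> 0 <= X ->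
  A j0 <= X ->
  (forall j, (j0 <= j < J)%N -> A j.+1 <= A j + K * e2 (j%:R * b)) ->
  forall j, (j0 <= j <= J)%N -> A j <= (X + K / (e2 b - 1)) * e2 (j%:R * b).
Proof.
move=> b0 K0 X0 A0 step j /andP[j0j jJ].
have eb : 0 < e2 b - 1 by rewrite subr_gt0 -e20 e2_lt.
set Y := K / (e2 b - 1).
have Y0 : 0 <= Y by rewrite divr_ge0 // ltW.
have main i : (j0 + i <= J)%N -> A (j0 + i)%N <= X + Y * e2 ((j0 + i)%:R * b).
  elim: i => [|i IH] iJ.
    by rewrite addn0; apply: le_trans A0 _; rewrite lerDl mulr_ge0 // e2_ge0.
  rewrite addnS; apply: le_trans (step _ _) _; first by rewrite leq_addr /= -addnS.
  have iJ' : (j0 + i <= J)%N by apply: leq_trans iJ; rewrite leq_add2l.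
  have := IH iJ'.
  have -> : (j0 + i).+1%:R * b = (j0 + i)%:R * b + b by rewrite -natr1 mulrDl mul1r.
  rewrite e2D => H; have E : Y * e2 b = Y + K.
    by rewrite /Y; move: eb; move: (e2 b) => u u1; field; rewrite gt_eqF.
  have -> : Y * (e2 ((j0 + i)%:R * b) * e2 b) = (Y + K) * e2 ((j0 + i)%:R * b).
    by rewrite -E; ring.
  by rewrite mulrDl addrA lerD2r.
have := main (j - j0)%N; rewrite subnKC // => /(_ jJ)/le_trans; apply.
by rewrite mulrDl lerD2r ler_peMr // e2_ge1 // mulr_ge0 // ltW.
Qed.

Lemma chain_decay (T : nat -> R) (K w : R) (j0 J : nat) : 0 < w -> 0 <= K ->
  (forall j, (j0 <= j < J)%N -> T j.+1 <= T j + K * e2 (- (j%:R * w))) -> (j0 <= J)%N ->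
  T J <= T j0 + K / (1 - e2 (- w)) * e2 (- (j0%:R * w)).
Proof.
move=> w0 K0 step j0J.
have ew : 0 < 1 - e2 (- w) by rewrite subr_gt0 -e20 e2_lt oppr_lt0.
set Y := K / (1 - e2 (- w)).
have Y0 : 0 <= Y by rewrite divr_ge0 // ltW.
have main i : (j0 + i <= J)%N ->
   T (j0 + i)%N <= T j0 + Y * (e2 (- (j0%:R * w)) - e2 (- ((j0 + i)%:R * w))).
  elim: i => [|i IH] iJ; first by rewrite addn0 subrr mulr0 addr0.
  rewrite addnS; apply: le_trans (step _ _) _; first by rewrite leq_addr /= -addnS.
  have iJ' : (j0 + i <= J)%N by apply: leq_trans iJ; rewrite leq_add2l.
  have := IH iJ'.
  have -> : - ((j0 + i).+1%:R * w) = - ((j0 + i)%:R * w) + - w by rewrite -natr1 mulrDl mul1r opprD.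
  rewrite [e2 (_ + - w)]e2D => H.
  have E : Y * e2 (- w) = Y - K.
    by rewrite /Y; move: ew; move: (e2 (- w)) => u u1; field; rewrite gt_eqF.
  have -> : Y * (e2 (- (j0%:R * w)) - e2 (- ((j0 + i)%:R * w)) * e2 (- w)) =
     Y * (e2 (- (j0%:R * w)) - e2 (- ((j0 + i)%:R * w))) + K * e2 (- ((j0 + i)%:R * w)).
    have -> : Y * (e2 (- (j0%:R * w)) - e2 (- ((j0 + i)%:R * w)) * e2 (- w)) =
      Y * e2 (- (j0%:R * w)) - Y * e2 (- w) * e2 (- ((j0 + i)%:R * w)) by ring.
    by rewrite E; ring.
  by rewrite addrA lerD2r.
have := main (J - j0)%N; rewrite subnKC // => /(_ (leqnn _))/le_trans; apply.
by rewrite lerD2l; apply: ler_wpM2l => //; rewrite gerBl e2_ge0.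
Qed.

End PowersOfTwo.

(** * Means over dyadic cubes *)

Section CubeAverages.
Context {R : realType} {n : nat}.
Variables (B m : nat).
Implicit Types (f Lam : 'rV[R]_n -> R) (x y : 'rV[R]_n).
Local Notation e i := (delta_mx 0 i : 'rV[R]_n).

(** The mean over the cube of level j around y, whose volume is 2^(-j n). *)
Definition cavg j y f : R := e2 (j%:R * n%:R) * lsum_on B m (same_cube j y) f.

Lemma same_cube_dist j y x : same_cube j y x -> `|x - y| <= 2 ^- j.
Proof.
have p0 : 0 <= 2 ^- j :> R by rewrite invr_ge0 exprn_ge0.
move=> /forallP H; rewrite /Num.norm /= mx_normrE; apply/bigmax_leP; split=> //.
move=> [a i] _ /=; rewrite [a]ord1 !mxE.
have := H i; rewrite dfloor_eq => /andP[x1 x2].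
have : dfloor j (y 0 i) == dfloor j (y 0 i) by [].
rewrite dfloor_eq => /andP[y1 y2]; rewrite ler_norml.
by move: x1 x2 y1 y2; move: (2 ^- j) (_%:~R * _) => u v *; apply/andP; split; lra.
Qed.

Lemma ler_cavg j y f g : (forall x, same_cube j y x -> f x <= g x) ->
  cavg j y f <= cavg j y g.
Proof.
move=> fg; apply: ler_wpM2l; first exact: e2_ge0.
apply: ler_lsum => x; case: (boolP (same_cube j y x)) => [/fg|_]; first by rewrite !mul1r.
by rewrite !mul0r.
Qed.

Lemma cavgD j y f g : cavg j y (fun x => f x + g x) = cavg j y f + cavg j y g.
Proof.
rewrite /cavg -mulrDr; congr (_ * _); rewrite /lsum_on -lsumD.
by apply: eq_lsum => x; rewrite mulrDr.
Qed.

Lemma cavgZ j y a f : cavg j y (fun x => a * f x) = a * cavg j y f.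
Proof.
rewrite /cavg [RHS]mulrCA; congr (_ * _); rewrite /lsum_on -lsumZ.
by apply: eq_lsum => x; rewrite mulrCA.
Qed.

Lemma cavg1 j y : (j <= m)%N -> (forall i, - B%:R + 1 <= y 0 i /\ y 0 i + 1 <= B%:R) ->
  cavg j y (fun=> 1) = 1.
Proof.
move=> jm yB; rewrite /cavg lsum_cube //.
by rewrite mulrC -e2_natN /e2 -expRM_natl mulrA -expRD -mulrDl mulrN [n%:R * _]mulrC addNr mul0r expR0.
Qed.

Lemma cavg_cst j y a : (j <= m)%N -> (forall i, - B%:R + 1 <= y 0 i /\ y 0 i + 1 <= B%:R) ->
  cavg j y (fun=> a) = a.
Proof.
move=> jm yB; rewrite -[RHS]mulr1 -(cavg1 jm yB) -cavgZ; congr (_ * _).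
by apply: eq_lsum => x; rewrite mulr1.
Qed.

(** The discrete Poincare inequality between a cube and one of its halves. *)
Lemma cavg_halving j y f Lam : (j < m)%N ->
  (forall i, - B%:R + 1 <= y 0 i /\ y 0 i + 1 <= B%:R) ->
  (forall x, 0 <= Lam x) -> (forall i, lip_step m i f Lam) ->
  `|cavg j.+1 y f - cavg j y f| <= 2 ^+ n / 2 * e2 (- j%:R) * cavg j y Lam.
Proof.
move=> jm yB L0 L.
have := cube_halving jm yB L0 L.
set S' := lsum_on _ _ _ f; set S := lsum_on _ _ _ f; set T := lsum_on _ _ _ Lam => H.
have E : e2 (j.+1%:R * n%:R) = e2 (j%:R * n%:R) * 2 ^+ n :> R.
  by rewrite -natr1 mulrDl mul1r e2D e2_nat.
rewrite /cavg -/S' -/S -/T E -mulrA -mulrBr normrM (gtr0_norm (e2_gt0 _)).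
have := ler_wpM2l (e2_ge0 (j%:R * n%:R)) H => /le_trans; apply.
rewrite e2_natN exprS invfM le_eqVlt; apply/orP; left; apply/eqP.
by move: (e2 _) (T) (2 ^+ n) (2 ^- j) => *; ring.
Qed.

End CubeAverages.

(** * Points of small energy *)

Section GoodPoint.
Context {R : realType} {n : nat}.
Variables (S : set 'rV[R]_n) (r : R) (phi : 'rV[R]_n -> R).
Variables (p : R) (B : nat).
Hypothesis S0 : S !=set0.
Hypothesis cS : compact S.
Hypothesis r0 : 0 < r.
Local Notation D := (sdist S).
Local Notation collar := [set x : 'rV[R]_n | 0 < D x < 4 * r].
Hypothesis sphi : smooth_on collar phi.
Hypothesis p2 : 2 <= p.
Hypothesis n0 : (0 < n)%N.
Hypothesis Hbox : forall x i, D x < 4 * r -> `|x 0 i| + 2 <= B%:R.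
Hypothesis Hcut : forall d eps, 0 < d -> 0 < eps ->
  exists eta d', cutoff_spec S r phi d eps eta d'.
Local Notation e i := (delta_mx 0 i : 'rV[R]_n).
Local Notation N := (sqgrad phi).

Variable t : R.
Hypothesis t0 : 0 < t.
Local Notation sig := (t / p).
Local Notation dens := (edens phi p t).
Local Notation wg := (wgrad phi p t).
Local Notation LV := (slopeV S r phi p t).
Local Notation LP := (slopePhi S r phi p t).

Variable E : R.
Hypothesis HE : forall d, 0 < d -> exists m0, forall m, (m0 <= m)%N ->
  lsum B m (fun x => (d <= D x <= r)%R%:R * dens x) <= E.

Let p0 : 0 < p. Proof. exact: lt_le_trans p2. Qed.
Let s0 : 0 < sig. Proof. by rewrite divr_gt0. Qed.
Let vol : R := (2 * B)%:R ^+ n.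

Let edens0 x : 0 <= dens x. Proof. exact: edens_ge0. Qed.

Lemma supp_box x i : D x <= 2 * r -> x 0 i < B%:R.
Proof.
move=> xr; have H : D x < 4 * r by move: r0 xr; move: (D x) => u; lra.
by have := Hbox i H; have := ler_norm (x 0 i); move: (x 0 i) `|_| => *; lra.
Qed.

(** By [wgrad_young] at nu = 0 the slope is controlled by the energy for D <= r; beyond
r it is bounded because phi is.  The bound A has to be independent of d3, which is
chosen later. *)
Lemma lsum_slopeV (C1 : R) : 0 <= C1 -> exists2 A : R, 0 <= A & forall d3, 0 < d3 ->
  exists m0, forall m, (m0 <= m)%N -> lsum B m (LV d3 C1) <= A.
Proof.
move=> C10.
have phic := @phi_cont R n S r phi sphi.
have wc x : collar x -> {for x, continuous wg}.
  move=> cx; apply: cont_mul.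
    apply: (cont_comp (h := expR)); last exact: continuous_expR.
    by apply: cont_mul; [exact: cont_cst|exact: phic].
  apply: (cont_comp (h := Num.sqrt)); first exact: (sqgrad_cont sphi).
  exact: sqrt_continuous.
have [W W0 HW] := bounded_on_shell S0 cS r0 r0 wc.
exists (((1 + sig) * (1 + W) + C1) * vol + (1 + sig) * `|E|).
  have v0 : 0 <= vol by exact: exprn_ge0.
  have sg : 0 <= 1 + sig by rewrite addr_ge0 // ltW.
  by rewrite addr_ge0 ?mulr_ge0 // addr_ge0 // mulr_ge0 // addr_ge0.
move=> d3 d30; have d32 : 0 < d3 / 2 by rewrite divr_gt0.
have [m0 Hm] := HE d32; exists m0 => m mm.
have sg : 0 <= 1 + sig by rewrite addr_ge0 // ltW.
apply: (@le_trans _ _ (lsum B m (fun x => ((1 + sig) * (1 + W) + C1) * 1 +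
   (1 + sig) * ((d3 / 2 <= D x <= r)%R%:R * dens x)))).
  apply: ler_lsum => x; rewrite mulr1 /slopeV.
  have R0 : 0 <= (1 + sig) * ((d3 / 2 <= D x <= r)%R%:R * dens x).
    by rewrite mulr_ge0 // mulr_ge0.
  have L0 : 0 <= (1 + sig) * (1 + W) + C1.
    by rewrite addr_ge0 // mulr_ge0 // addr_ge0.
  case: (boolP (d3 / 2 <= D x <= 7 / 4 * r)) => [/andP[xa xb]|_]; last by rewrite mul0r addr_ge0.
  rewrite mul1r.
  have [xr|xr] := leP (D x) r.
    rewrite xa /= mul1r.
    have := wgrad_young phi p2 t x 0; rewrite mulr0 expR0 mul1r => H.
    have H1 := ler_wpM2l sg H; have H2 := mulr_ge0 sg W0.
    move: H1 H2; rewrite !mulrDr mulr1.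
    by move: (1 + sig) ((1 + sig) * W) ((1 + sig) * wg x) ((1 + sig) * dens x) => u4 u1 u2 u3 *; lra.
  have H : wg x <= W.
    by apply: le_trans (ler_norm _) _; apply: HW; rewrite (ltW xr) /=; lra.
  have H' := ler_wpM2l sg H; move: H'; rewrite andbF mul0r mulr0 addr0 (mulrDr (1 + sig) 1 W) mulr1.
  by move: sg; move: (1 + sig) ((1 + sig) * W) ((1 + sig) * wg x) => u4 u1 u2; lra.
rewrite lsumD !lsumZ lsum_cst; apply: lerD => //.
by apply: ler_wpM2l => //; apply: le_trans (Hm m mm) (ler_norm _).
Qed.

(** Apply [wgrad_young] with e^nu = 2^(j(b+1)): this balances its two terms, since the
mean of the energy is at most C 2^(j(n-d)) = C 2^(j p (b+1)). *)
Lemma cavg_slopeV (C1 C d b : R) m j (d3 : R) (y : 'rV[R]_n) : 0 <= C1 -> 0 <= C ->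
  p * (b + 1) = n%:R - d -> 0 <= b -> (j <= m)%N ->
  (forall i, - B%:R + 1 <= y 0 i /\ y 0 i + 1 <= B%:R) ->
  (forall x, same_cube j y x -> D x <= r) ->
  lsum_on B m (same_cube j y) (fun x => (d3 / 2 <= D x <= r)%R%:R * dens x) <=
    C * e2 (- (j%:R * d)) ->
  cavg B m j y (LV d3 C1) <= ((1 + sig) * (1 + C) + C1) * e2 (j%:R * (b + 1)).
Proof.
move=> C10 C0 bE b0 jm yB Qr HC.
have sg : 0 <= 1 + sig by rewrite addr_ge0 // ltW.
pose nu := j%:R * (b + 1) * ln 2.
have nuE : expR nu = e2 (j%:R * (b + 1)) by [].
have nu1 : expR ((1 - p) * nu) = e2 (j%:R * ((1 - p) * (b + 1))).
  by rewrite /e2 /nu; congr expR; ring.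
pose ee x := (d3 / 2 <= D x <= r)%R%:R * dens x.
apply: (@le_trans _ _ (cavg B m j y (fun x => ((1 + sig) * e2 (j%:R * (b + 1)) + C1) +
   (1 + sig) * e2 (j%:R * ((1 - p) * (b + 1))) * ee x))).
  apply: ler_cavg => x /Qr xr; rewrite /slopeV /ee.
  have e2p := e2_ge0 (R := R).
  case: (boolP (d3 / 2 <= D x <= 7 / 4 * r)) => [/andP[xa xb]|_]; last first.
    have Q0 : 0 <= (d3 / 2 <= D x <= r)%R%:R * dens x by rewrite mulr_ge0.
    rewrite mul0r; apply: addr_ge0; last by rewrite mulr_ge0 // mulr_ge0.
    by rewrite addr_ge0 // mulr_ge0.
  rewrite xa xr /= !mul1r.
  have := wgrad_young phi p2 t x nu; rewrite nuE nu1.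
  move: (wg x) (dens x) (e2 (j%:R * ((1 - p) * (b + 1)))) (e2 (j%:R * (b + 1))) => w q u v H.
  by have := ler_wpM2l sg H; rewrite mulrDr mulrA; move: (_ * w) (_ * q) (_ * v) => *; lra.
rewrite cavgD cavgZ cavg_cst //.
have HC' : cavg B m j y ee <= C * e2 (j%:R * (n%:R - d)).
  rewrite /cavg; apply: le_trans (ler_wpM2l (e2_ge0 _) HC) _.
  by rewrite mulrCA -e2D mulrBr.
have := ler_wpM2l (_ : 0 <= (1 + sig) * e2 (j%:R * ((1 - p) * (b + 1)))) HC'.
rewrite mulr_ge0 ?e2_ge0 // => /(_ isT) H.
have EE : (1 + sig) * e2 (j%:R * ((1 - p) * (b + 1))) * (C * e2 (j%:R * (n%:R - d))) =
   (1 + sig) * C * e2 (j%:R * (b + 1)).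
  rewrite mulrACA -e2D -mulrDr -bE; congr (_ * e2 (_ * _)); ring.
rewrite EE in H.
have : C1 <= C1 * e2 (j%:R * (b + 1)).
  by rewrite ler_peMr // e2_ge1 // mulr_ge0 // addr_ge0.
move: H; rewrite !mulrDl.
by move: (cavg _ _ _ _ _) (e2 _) (e2 _) (sig) => *; lra.
Qed.

End GoodPoint.

Lemma center_in_box {R : realType} {n : nat} (S : set 'rV[R]_n) (r : R) (B : nat) (y : 'rV[R]_n) :
  0 < r -> (forall (x : 'rV[R]_n) i, sdist S x < 4 * r -> `|x 0 i| + 2 <= B%:R) -> S !=set0 -> compact S -> S y ->
  forall i, - B%:R + 1 <= y 0 i /\ y 0 i + 1 <= B%:R.
Proof.
move=> r0 Hbox S0 cS Sy i.
have Dy : sdist S y < 4 * r.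
  have -> : sdist S y = 0 by apply/eqP; rewrite sdist_eq0.
  by rewrite mulr_gt0.
have := Hbox y i Dy => H; have := ler_norm (y 0 i); have := ler_norm (- y 0 i).
by rewrite normrN; move: (y 0 i) `|_| H => *; split; lra.
Qed.

Section Chains.
Context {R : realType} {n : nat}.
Variables (S : set 'rV[R]_n) (r : R) (phi : 'rV[R]_n -> R).
Variables (p : R) (B : nat).
Hypothesis S0 : S !=set0.
Hypothesis cS : compact S.
Hypothesis r0 : 0 < r.
Local Notation D := (sdist S).
Local Notation collar := [set x : 'rV[R]_n | 0 < D x < 4 * r].
Hypothesis sphi : smooth_on collar phi.
Hypothesis p2 : 2 <= p.
Hypothesis n0 : (0 < n)%N.
Hypothesis Hbox : forall (x : 'rV[R]_n) i, D x < 4 * r -> `|x 0 i| + 2 <= B%:R.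
Local Notation e i := (delta_mx 0 i : 'rV[R]_n).

Variable t : R.
Hypothesis t0 : 0 < t.
Local Notation sig := (t / p).
Local Notation dens := (edens phi p t).
Local Notation LV := (slopeV S r phi p t).
Local Notation LP := (slopePhi S r phi p t).
Local Notation lev := (level p t).

Let p0 : 0 < p. Proof. exact: lt_le_trans p2. Qed.
Let s0 : 0 < sig. Proof. by rewrite divr_gt0. Qed.
Let vol : R := (2 * B)%:R ^+ n.

Variables (th V : 'rV[R]_n -> R) (C1 d3 h0 eps : R).
Hypothesis C10 : 0 <= C1.
Hypothesis d30 : 0 < d3.
Hypothesis eps0 : 0 < eps.
Hypothesis eps1 : eps <= 1.
Hypothesis th01 : forall x, 0 <= th x <= 1.
Hypothesis th_out : forall x, r / 4 <= D x -> th x = 0.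
Hypothesis V0 : forall x, 0 <= V x.
Hypothesis Vsupp : forall x, V x != 0 -> D x <= 3 / 2 * r.
Hypothesis Vlip : forall i (x : 'rV[R]_n) (h : R), 0 < h <= h0 ->
  `|V (x + h *: e i) - V x| <= h * LV d3 C1 x.
Hypothesis Plip : forall i (x : 'rV[R]_n) (h : R), 0 < h <= h0 ->
  forall mu, `|Phi th V mu (x + h *: e i) - Phi th V mu x| <= h * LP d3 C1 eps mu x.

Variables (m : nat) (A : R).
Hypothesis mh : lstep (R := R) m <= h0.
Hypothesis HA : lsum B m (LV d3 C1) <= A.

Let lst0 : 0 < lstep (R := R) m. Proof. by rewrite invr_gt0 exprn_gt0. Qed.
Let Vstep i : lip_step m i V (LV d3 C1).
Proof. by move=> x; apply: Vlip; rewrite lst0. Qed.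
Let Pstep mu i : lip_step m i (Phi th V mu) (LP d3 C1 eps mu).
Proof. by move=> x; apply: Plip; rewrite lst0. Qed.
Let LV0 x : 0 <= LV d3 C1 x. Proof. by apply: slopeV_ge0. Qed.

Let box2 (x : 'rV[R]_n) i : D x <= 2 * r -> x 0 i < B%:R.
Proof. exact: (supp_box r0 Hbox). Qed.

Let LVsupp x : LV d3 C1 x != 0 -> D x <= 2 * r.
Proof.
rewrite /slopeV; case: (boolP (_ <= D x <= _)) => [/andP[_ H] _|_]; last by rewrite mul0r eqxx.
by move: H r0; move: (D x) => u; lra.
Qed.

Lemma lsum_V : lsum B m V <= (2 * B)%:R * A.
Proof.
apply: (@le_trans _ _ (lsum B m (fun x => `|V x|))).
  by apply: ler_lsum => x; exact: ler_norm.
apply: le_trans (lsum_poincare (i := Ordinal n0) (f := V) LV0 (Vstep _) _ _) _.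
- by move=> x /LVsupp; exact: box2.
- move=> x /Vsupp H; apply: box2; move: H r0; move: (D x) => u; lra.
by apply: ler_wpM2l.
Qed.

Lemma Phi_ge0 mu x : 0 <= Phi th V mu x.
Proof. by rewrite /Phi le_max lexx. Qed.

Lemma Phi_le mu x : Phi th V mu x <= th x.
Proof.
have /andP[a _] := th01 x.
by rewrite /Phi ge_max a /= gerBl mulr_ge0 // expR_ge0.
Qed.

Lemma le_Phi mu x : th x <= Phi th V mu x + expR (- mu) * V x.
Proof. by rewrite -lerBlDr /Phi le_max [expR _ * _]mulrC lexx orbT. Qed.

(** Since theta is at most [Phi] + V / M, the Poincare inequality on the whole box bounds
the mass of theta by 1 / M and eps M^(1/sigma): it is small when M is chosen large
first and eps small afterwards. *)
Lemma lsum_th mu : lsum B m th <=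
  expR (- mu) * (2 * ((2 * B)%:R * A)) + eps * ((2 * B)%:R * (expR (lev mu) * vol)).
Proof.
have B0 : 0 <= (2 * B)%:R :> R by [].
have lth : lsum B m th <= lsum B m (Phi th V mu) + expR (- mu) * lsum B m V.
  by rewrite -lsumZ -lsumD; apply: ler_lsum => x; exact: le_Phi.
apply: le_trans lth _.
have PL : lsum B m (Phi th V mu) <= (2 * B)%:R * lsum B m (LP d3 C1 eps mu).
  apply: (@le_trans _ _ (lsum B m (fun x => `|Phi th V mu x|))).
    by apply: ler_lsum => x; exact: ler_norm.
  apply: (lsum_poincare (i := Ordinal n0) (f := Phi th V mu) _ (Pstep _ _)).
  - by move=> x; apply: slopePhi_ge0 => //; exact: ltW.
  - move=> x; rewrite /slopePhi => H; apply: box2; move: H.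
    case: (boolP (D x <= r / 2)) => [H _|_]; first by move: H r0; move: (D x) => u; lra.
    rewrite mul0r addr0 mulf_eq0 negb_or => /andP[/LVsupp H _]; exact: H.
  move=> x H; apply: box2; rewrite leNgt; apply: contra H => H.
  rewrite eq_le Phi_ge0 andbT; apply: le_trans (Phi_le _ _) _.
  rewrite th_out //; move: H r0; move: (D x) => u; lra.
have PL2 : lsum B m (LP d3 C1 eps mu) <= expR (- mu) * A + eps * (expR (lev mu) * vol).
  apply: (@le_trans _ _ (lsum B m (fun x => expR (- mu) * LV d3 C1 x + eps * expR (lev mu) * 1))).
    apply: ler_lsum => x; rewrite /slopePhi mulr1 [expR _ * _]mulrC.
    by apply: lerD => //; apply: ler_piMl; [by rewrite mulr_ge0 ?expR_ge0 // ltW|by case: (D x <= r / 2)].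
  rewrite lsumD !lsumZ lsum_cst mulrA lerD2r.
  by apply: ler_wpM2l => //; exact: expR_ge0.
have H1 := ler_wpM2l B0 PL2.
have H2 := ler_wpM2l (expR_ge0 (- mu)) lsum_V.
apply: le_trans (lerD (le_trans PL H1) H2) _.
by rewrite le_eqVlt; apply/orP; left; apply/eqP; move: (expR _) (expR _) (_%:R) (vol) => *; ring.
Qed.

Variables (y : 'rV[R]_n) (C d b : R) (j0 J : nat).
Hypothesis Sy : S y.
Hypothesis C0 : 0 <= C.
Hypothesis bE : p * (b + 1) = n%:R - d.
Hypothesis b0 : 0 < b.
Hypothesis j0r : 2 ^- j0 <= r / 4.
Hypothesis Jm : (J < m)%N.
Hypothesis HC : forall j, (j0 <= j <= J)%N ->
  lsum_on B m (same_cube j y) (fun x => (d3 / 2 <= D x <= r)%R%:R * dens x) <=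
    C * e2 (- (j%:R * d)).

Let cube_r j x : (j0 <= j)%N -> same_cube j y x -> D x <= r / 4.
Proof.
move=> jj /same_cube_dist H; apply: le_trans (sdist_le _ Sy) _ => //.
apply: le_trans H (le_trans _ j0r).
by rewrite lef_pV2 ?posrE ?exprn_gt0 // ler_eXn2l // ltr1n.
Qed.

Let yB := center_in_box r0 Hbox S0 cS Sy.

Let C4 := (1 + sig) * (1 + C) + C1.
Let K := 2 ^+ n / 2 * C4.
Let C6 := e2 (j0%:R * n%:R) * ((2 * B)%:R * A) + K / (e2 b - 1).

Let C40 : 0 <= C4.
Proof. by rewrite addr_ge0 // mulr_ge0 // addr_ge0 // ltW. Qed.
Let K0 : 0 <= K.
Proof. by rewrite mulr_ge0 // divr_ge0 // exprn_ge0. Qed.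
Let A0 : 0 <= A.
Proof. by apply: le_trans HA; apply: lsum_ge0 => x. Qed.

Let mean_slopeV j : (j0 <= j <= J)%N -> cavg B m j y (LV d3 C1) <= C4 * e2 (j%:R * (b + 1)).
Proof.
move=> /[dup] jj /andP[j0j jJ].
apply: (cavg_slopeV p2 t0 C10 C0 bE (ltW b0) _ yB _ (HC jj)).
  by apply: leq_trans jJ (ltnW Jm).
move=> x /(cube_r j0j) H; apply: le_trans H _; move: r0; lra.
Qed.

(** By [cavg_halving] the mean increases by at most K 2^(jb) from level j to j.+1, and
these increments form a geometric sum dominated by its last term. *)
Lemma mean_V j : (j0 <= j <= J)%N -> cavg B m j y V <= C6 * e2 (j%:R * b).
Proof.
move: j; apply: (chain_growth (A := fun j => cavg B m j y V)) => //.
- by rewrite mulr_ge0 ?e2_ge0 // mulr_ge0.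
- apply: ler_wpM2l; first exact: e2_ge0.
  apply: le_trans lsum_V; apply: ler_lsum => x.
  by apply: ler_piMl => //; case: same_cube.
move=> j /andP[jj jJ].
have jm : (j < m)%N by apply: ltn_trans Jm.
have := le_trans (ler_norm _) (cavg_halving jm yB LV0 Vstep).
rewrite lerBlDl => /le_trans; apply; rewrite lerD2l /K.
have H : cavg B m j y (LV d3 C1) <= C4 * e2 (j%:R * (b + 1)).
  by apply: mean_slopeV; rewrite jj ltnW.
apply: le_trans (ler_wpM2l _ H) _.
  by rewrite mulr_ge0 ?e2_ge0 // divr_ge0 // exprn_ge0.
have -> : e2 (j%:R * b) = e2 (- j%:R) * e2 (j%:R * (b + 1)) :> R.
  by rewrite -e2D; congr e2; ring.
by rewrite le_eqVlt; apply/orP; left; apply/eqP; move: (e2 _) (e2 _) C4 (_ / 2) => *; ring.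
Qed.

Variables (b' w : R).
Hypothesis bb' : b + w <= b'.
Hypothesis b's : b' / sig + w <= 1.

Let K7 := 2 ^+ n / 2 * (C4 + e2 ((sig + 1) / sig)) + C6 * e2 b.

(** Compare theta with [Phi] for M = 2^(j b').  The three errors, from the slope of V, the
slope of theta and V / M, are at most 2^(-jw) times a constant, with w the smaller
one of b' - b and 1 - b' / sig. *)
Lemma mean_th_step j : (j0 <= j < J)%N ->
  cavg B m j.+1 y th <= cavg B m j y th + K7 * e2 (- (j%:R * w)).
Proof.
move=> /andP[jj jJ]; have jm : (j < m)%N by apply: ltn_trans Jm.
pose mu := j%:R * b' * ln 2.
have muE : expR (- mu) = e2 (- (j%:R * b')) by rewrite /e2 /mu mulNr.
have lvE : expR (lev mu) = e2 ((sig + 1) / sig) * e2 (j%:R * (b' / sig)).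
  by rewrite -e2D /level /e2 /mu; congr expR; move: (ln 2) (sig) s0 => u v v0; field; rewrite gt_eqF.
have LP0 x : 0 <= LP d3 C1 eps mu x by apply: slopePhi_ge0 => //; exact: ltW.
have j0' : 0 <= j%:R :> R by [].
have n20 : 0 <= 2 ^+ n / 2 :> R by rewrite divr_ge0 // exprn_ge0.
have H1 : cavg B m j.+1 y th <= cavg B m j.+1 y (Phi th V mu) + e2 (- (j%:R * b')) * cavg B m j.+1 y V.
  rewrite -cavgZ -cavgD; apply: ler_cavg => x _; rewrite -muE; exact: le_Phi.
have H2 : cavg B m j y (Phi th V mu) <= cavg B m j y th.
  by apply: ler_cavg => x _; exact: Phi_le.
have H3 := le_trans (ler_norm _) (cavg_halving jm yB LP0 (Pstep mu)).
have H4 : cavg B m j y (LP d3 C1 eps mu) <=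
   e2 (- (j%:R * b')) * (C4 * e2 (j%:R * (b + 1))) + e2 ((sig + 1) / sig) * e2 (j%:R * (b' / sig)).
  apply: (@le_trans _ _ (cavg B m j y (fun x => e2 (- (j%:R * b')) * LV d3 C1 x +
     e2 ((sig + 1) / sig) * e2 (j%:R * (b' / sig))))).
    apply: ler_cavg => x _; rewrite /slopePhi muE lvE [e2 (- _) * _]mulrC lerD2l.
    have q0 : 0 <= e2 ((sig + 1) / sig) * e2 (j%:R * (b' / sig)) by rewrite mulr_ge0 ?e2_ge0.
    apply: le_trans (_ : eps * (e2 ((sig + 1) / sig) * e2 (j%:R * (b' / sig))) <= _).
      by apply: ler_piMl; [by rewrite mulr_ge0 // ltW|by case: (D x <= r / 2)].
    exact: ler_piMl.
  rewrite cavgD cavgZ cavg_cst ?(ltnW jm) // lerD2r; apply: ler_wpM2l; first exact: e2_ge0.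
  by apply: mean_slopeV; rewrite jj ltnW.
have H5 : cavg B m j.+1 y V <= C6 * e2 (j.+1%:R * b).
  by apply: mean_V; rewrite (leq_trans jj) ?leqnSn.
have C60 : 0 <= C6.
  by rewrite addr_ge0 ?mulr_ge0 ?e2_ge0 // invr_ge0 subr_ge0 e2_ge1 // ltW.
have T1 : e2 (- j%:R) * (e2 (- (j%:R * b')) * e2 (j%:R * (b + 1))) <= e2 (- (j%:R * w)) :> R.
  rewrite -!e2D e2_le; have := ler_wpM2l j0' bb'; lra.
have T2 : e2 (- j%:R) * e2 (j%:R * (b' / sig)) <= e2 (- (j%:R * w)) :> R.
  rewrite -!e2D e2_le; have := ler_wpM2l j0' b's; rewrite mulrDr; move: (_ / sig) => u; lra.
have T3 : e2 (- (j%:R * b')) * e2 (j.+1%:R * b) <= e2 b * e2 (- (j%:R * w)) :> R.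
  rewrite -!e2D e2_le -natr1; have := ler_wpM2l j0' bb'; lra.
have G1 := ler_wpM2l (mulr_ge0 n20 (e2_ge0 (- j%:R))) H4.
have G2 := ler_wpM2l (e2_ge0 (- (j%:R * b'))) H5.
have G3 := ler_wpM2l (mulr_ge0 n20 C40) T1.
have G4 := ler_wpM2l (mulr_ge0 n20 (e2_ge0 ((sig + 1) / sig))) T2.
have G5 := ler_wpM2l C60 T3.
move: H1 H2 H3 G1 G2 G3 G4 G5; rewrite /K7.
move: (cavg _ _ _ _ th) (cavg _ _ _ _ th) (cavg _ _ _ _ V) (cavg _ _ _ _ (LP _ _ _ _))
  (cavg _ _ _ _ (Phi _ _ _)) (cavg _ _ _ _ (Phi _ _ _)) => c1 c2 c3 c4 c5 c6.
move: (e2 _) (e2 _) (e2 _) (e2 _) (e2 _) (e2 _) (e2 _) (e2 _) => u1 u2 u3 u4 u5 u6 u7 u8.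
move: (2 ^+ n / 2) C4 C6 => k1 k2 k3 *; lra.
Qed.

End Chains.

Section GoodPointAbsurd.
Context {R : realType} {n : nat}.
Variables (S : set 'rV[R]_n) (r : R) (phi : 'rV[R]_n -> R).
Variables (p : R) (B : nat).
Hypothesis S0 : S !=set0.
Hypothesis cS : compact S.
Hypothesis r0 : 0 < r.
Local Notation D := (sdist S).
Local Notation collar := [set x : 'rV[R]_n | 0 < D x < 4 * r].
Hypothesis sphi : smooth_on collar phi.
Hypothesis p2 : 2 <= p.
Hypothesis n0 : (0 < n)%N.
Hypothesis Hbox : forall (x : 'rV[R]_n) i, D x < 4 * r -> `|x 0 i| + 2 <= B%:R.
Hypothesis Hcut : forall d eps, 0 < d -> 0 < eps ->
  exists eta d', cutoff_spec S r phi d eps eta d'.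
Variable t : R.
Hypothesis t0 : 0 < t.
Local Notation sig := (t / p).
Local Notation dens := (edens phi p t).
Variable E : R.
Hypothesis HE : forall d, 0 < d -> exists m0, forall m, (m0 <= m)%N ->
  lsum B m (fun x => (d <= D x <= r)%R%:R * dens x) <= E.

Let too_small : ~ (1 <= 1 / 8 + 1 / 8 + 1 / 4 :> R).
Proof. by rewrite leNgt => /negP; apply; lra. Qed.

(** The constants are fixed in the order C1, A, K7, then the level j1 beyond which the
errors of [mean_th_step] add up to 1/4, then mu and eps such that the mean of theta at
level j1 is at most 1/4, and last the functions theta and V.  At a level J such that
the cube lies inside the region theta = 1 the mean is 1, a contradiction.  Only
finitely many levels occur, so one lattice serves them all. *)
Lemma good_point_absurd (y : 'rV[R]_n) (C d b : R) (j0 : nat) (U : set_system nat) :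
  ProperFilter U -> (forall m0, U [set m | (m0 <= m)%N]) ->
  S y -> 0 <= C -> p * (b + 1) = n%:R - d -> 0 < b < sig -> 2 ^- j0 <= r / 4 ->
  (forall j del, (j0 <= j)%N -> 0 < del -> U [set m |
     lsum_on B m (same_cube j y) (fun x => (del <= D x <= r)%R%:R * dens x)
       <= C * e2 (- (j%:R * d))]) ->
  False.
Proof.
move=> FU Uoo Sy C0 bE /andP[b0 bs] j0r HC.
have s0 : 0 < sig := lt_trans b0 bs.
have [C1 C10 HB] := barriers S0 cS r0 sphi p2 t0 Hcut.
have [A A0 HA] := lsum_slopeV S0 cS r0 sphi p2 t0 HE C10.
pose b' := (b + sig) / 2.
pose w := Num.min (b' - b) (1 - b' / sig).
have w0 : 0 < w.
  rewrite lt_min !subr_gt0 ltr_pdivrMr // mul1r /b'.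
  by apply/andP; split; move: bs; move: (sig) => u; lra.
have bb' : b + w <= b' by rewrite -lerBrDl ge_min lexx.
have b's : b' / sig + w <= 1 by rewrite -lerBrDl ge_min lexx orbT.
pose C4 := (1 + sig) * (1 + C) + C1.
pose K := 2 ^+ n / 2 * C4.
pose C6 := e2 (j0%:R * n%:R) * ((2 * B)%:R * A) + K / (e2 b - 1).
pose K7 := 2 ^+ n / 2 * (C4 + e2 ((sig + 1) / sig)) + C6 * e2 b.
have C40 : 0 <= C4 by rewrite addr_ge0 // mulr_ge0 // addr_ge0 // ltW.
have n20 : 0 <= 2 ^+ n / 2 :> R by rewrite divr_ge0 // exprn_ge0.
have K0 : 0 <= K by rewrite mulr_ge0.
have C60 : 0 <= C6.
  by rewrite addr_ge0 ?mulr_ge0 ?e2_ge0 // invr_ge0 subr_ge0 e2_ge1 // ltW.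
have K70 : 0 <= K7.
  apply: addr_ge0; first by apply: (mulr_ge0 n20); exact: addr_ge0 C40 (e2_ge0 _).
  exact: mulr_ge0 C60 (e2_ge0 _).
pose q := K7 / (1 - e2 (- w)).
have q0 : 0 <= q by rewrite divr_ge0 // subr_ge0 -e20 e2_le oppr_le0 ltW.
have q40 : 0 < 1 / 4 / (q + 1) by rewrite !divr_gt0 // ltr_wpDl.
have [j1' Hj1] := e2_small w0 q40.
pose j1 := maxn j0 j1'.
have j01 : (j0 <= j1)%N by rewrite leq_maxl.
have qj : q * e2 (- (j1%:R * w)) <= 1 / 4.
  have := ler_wpM2l q0 (Hj1 j1 (leq_maxr _ _)) => /le_trans; apply.
  rewrite mulrCA -[leRHS]mulr1; apply: ler_wpM2l => //.
  by rewrite ler_pdivrMr ?ltr_wpDl // mul1r lerDl.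
pose X := e2 (j1%:R * n%:R) * (2 * ((2 * B)%:R * A)).
have X0 : 0 <= X by rewrite !mulr_ge0 ?e2_ge0.
(* e^mu >= 1 + 8 X makes e^-mu X at most 1/8 *)
pose mu := 8 * X.
have HX : expR (- mu) * X <= 1 / 8.
  rewrite expRN mulrC ler_pdivrMr ?expR_gt0 //.
  by have := expR_ge1Dx mu; rewrite /mu; move: (expR _) => u; lra.
pose vol : R := (2 * B)%:R ^+ n.
pose Y := e2 (j1%:R * n%:R) * ((2 * B)%:R * (expR (level p t mu) * vol)).
have Y0 : 0 <= Y.
  exact: mulr_ge0 (e2_ge0 _) (mulr_ge0 (ler0n _ _) (mulr_ge0 (expR_ge0 _) (exprn_ge0 _ (ler0n _ _)))).
have Y1 : 0 < Y + 1 by rewrite ltr_wpDl.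
pose eps := Num.min 1 (1 / 8 / (Y + 1)).
have eps0 : 0 < eps by rewrite lt_min ltr01 !divr_gt0.
have eps1 : eps <= 1 by rewrite ge_min lexx.
have HY : eps * Y <= 1 / 8.
  have e8 : eps <= 1 / 8 / (Y + 1) by rewrite ge_min lexx orbT.
  apply: le_trans (ler_wpM2r Y0 e8) _.
  rewrite mulrAC ler_pdivrMr //; apply: ler_wpM2l => //.
  by rewrite lerDl.
have [th [V [d3 [z [h0 [[d30 z0 h00] [[th01 thout thin V0 Vs] Hlip]]]]]]] := HB eps eps0.
have [J' HJ] := e2_small ltr01 (divr_gt0 z0 (ltr0n R 2)).
pose J := maxn j1 J'.
have Jz : 2 ^- J < z.
  have := HJ J (leq_maxr _ _); rewrite mulr1 e2_natN => /le_lt_trans; apply.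
  by rewrite ltr_pdivrMr // ltr_pMr // ltr1n.
have [m1 Hm1] := HA d3 d30.
have [m2 Hm2] := lstep_small h00.
have FJ k : U [set m | forall j, (j0 <= j <= k)%N ->
   lsum_on B m (same_cube j y) (fun x => (d3 / 2 <= D x <= r)%R%:R * dens x)
       <= C * e2 (- (j%:R * d))].
  have d32 : 0 < d3 / 2 by rewrite divr_gt0.
  elim: k => [|k IH].
    case: (leqP j0 0) => [j00|j00]; last first.
      apply: filterS (Uoo 0%N) => m _ j /andP[jj j0']; have := leq_trans jj j0'.
      by rewrite leqNgt j00.
    apply: filterS (HC 0%N _ j00 d32) => m H j /andP[_]; rewrite leqn0 => /eqP -> //.
  case: (leqP j0 k.+1) => [jk|jk].
    apply: filterS2 IH (HC _ _ jk d32) => m H1 H2 j /andP[jj].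
    by rewrite leq_eqVlt => /orP[/eqP -> //|jk']; apply: H1; rewrite jj.
  apply: filterS (Uoo 0%N) => m _ j /andP[jj j0']; have := leq_trans jj j0'.
  by rewrite leqNgt jk.
have [m [Hm Hmm]] : exists m, (forall j, (j0 <= j <= J)%N ->
   lsum_on B m (same_cube j y) (fun x => (d3 / 2 <= D x <= r)%R%:R * dens x)
       <= C * e2 (- (j%:R * d))) /\ (maxn J.+1 (maxn m1 m2) <= m)%N.
  by exact: filter_ex (filterI (FJ J) (Uoo (maxn J.+1 (maxn m1 m2)))).
move: Hmm; rewrite !geq_max => /and3P[Jm mm1 mm2].
have yB := center_in_box r0 Hbox S0 cS Sy.
have mh := Hm2 m mm2; have LA := Hm1 m mm1.
have Vlip i (x : 'rV[R]_n) (h : R) (hh : 0 < h <= h0) := (Hlip i x h hh).1.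
have Plip i (x : 'rV[R]_n) (h : R) (hh : 0 < h <= h0) := (Hlip i x h hh).2.
have step j : (j1 <= j < J)%N -> cavg B m j.+1 y th <= cavg B m j y th + K7 * e2 (- (j%:R * w)).
  move=> /andP[jj jJ]; apply: (mean_th_step (d3 := d3) (h0 := h0) (J := J) S0 cS r0 p2 n0 Hbox t0 C10 eps0 eps1 th01 V0 Vs Vlip Plip mh LA Sy C0 bE b0 j0r Jm Hm bb' b's).
  by rewrite (leq_trans j01 jj).
have dec := chain_decay w0 K70 step (leq_maxl _ _).
have one : 1 <= cavg B m J y th.
  rewrite -(cavg1 (ltnW Jm) yB); apply: ler_cavg => x /same_cube_dist H.
  rewrite thin //; apply: le_lt_trans Jz; apply: le_trans (sdist_le _ Sy) H => //.
have start : cavg B m j1 y th <= 1 / 8 + 1 / 8.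
  have Hth := lsum_th r0 p2 n0 Hbox t0 C10 eps0 th01 thout V0 Vs Vlip Plip mh LA mu.
  apply: (@le_trans _ _ (e2 (j1%:R * n%:R) * lsum B m th)).
    apply: ler_wpM2l; first exact: e2_ge0.
    apply: ler_lsum => x; apply: ler_piMl; first by case/andP: (th01 x).
    by case: same_cube.
  apply: le_trans (ler_wpM2l (e2_ge0 _) Hth) _.
  move: HX HY; rewrite /X /Y /vol.
  rewrite mulrDr => H1 H2; apply: lerD; rewrite mulrCA; [exact: H1|exact: H2].
exact: too_small (le_trans one (le_trans dec (lerD start qj))).
Qed.

End GoodPointAbsurd.

(** * Covering by cubes of large energy *)

Section Covering.
Context {R : realType} {n : nat}.
Implicit Types (x y : 'rV[R]_n).

Definition cube_key (j : nat) x : {ffun 'I_n -> int} := [ffun i => dfloor j (x 0 i)].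

Lemma same_cube_key j y x : same_cube j y x = (cube_key j x == cube_key j y).
Proof.
apply/forallP/eqP => [H|H i]; first by apply/ffunP => i; rewrite !ffunE; apply/eqP.
by move/ffunP/(_ i): H; rewrite !ffunE => ->.
Qed.

Lemma same_cubeS j y x : same_cube j.+1 y x -> same_cube j y x.
Proof.
move=> /forallP H; apply/forallP => i; have := H i => /eqP.
case: (dfloor_half j (x 0 i)) => ->; case: (dfloor_half j (y 0 i)) => -> E; apply/eqP; lia.
Qed.

Lemma same_cube_mono j k y x : (j <= k)%N -> same_cube k y x -> same_cube j y x.
Proof.
elim: k => [|k IH]; first by rewrite leqn0 => /eqP ->.
by rewrite leq_eqVlt => /orP[/eqP -> //|jk /same_cubeS]; apply: IH.
Qed.

Variables (S : set 'rV[R]_n) (B : nat) (U : set_system nat) (f : R -> 'rV[R]_n -> R).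
Hypothesis FU : ProperFilter U.
Hypothesis f0 : forall del x, 0 <= f del x.
Hypothesis f_anti : forall del del' x, del <= del' -> f del' x <= f del x.
Variables (E C d : R) (j0 : nat).
Hypothesis d0 : 0 < d.
Hypothesis C0 : 0 < C.
Hypothesis HE : forall del, 0 < del -> U [set m | lsum B m (f del) <= E].

(** The energy of the cube is large for U-almost all lattices, on some shell that
stays away from S. *)
Definition bad j y := exists2 del : R, 0 < del &
  U [set m | C * e2 (- (j%:R * d)) < lsum_on B m (same_cube j y) (f del)].

Hypothesis Hbad : forall y, S y -> exists2 j, (j0 <= j)%N & bad j y.

Lemma same_cube_eq j y y' : same_cube j y y' -> same_cube j y = same_cube j y'.
Proof.
rewrite same_cube_key => /eqP H; apply/funext => x; by rewrite !same_cube_key H.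
Qed.

Lemma bad_same j y y' : same_cube j y y' -> bad j y -> bad j y'.
Proof. by move=> /same_cube_eq H; rewrite /bad H. Qed.

(** The maximal bad cubes of level at least j0, represented by their level and the
integer parts of their points. *)
Definition selected (k : nat * {ffun 'I_n -> int}) := exists y,
  [/\ cube_key k.1 y = k.2, (j0 <= k.1)%N, bad k.1 y
    & forall i, (j0 <= i < k.1)%N -> ~ bad i y].

Lemma selected_cover y : S y -> exists2 j, selected (j, cube_key j y) & (j0 <= j)%N.
Proof.
move=> /Hbad[j jj bj].
have ex : exists j, (j0 <= j)%N && `[< bad j y >] by exists j; rewrite jj; apply/asboolP.
exists (ex_minn ex); case: ex_minnP => k /andP[kk /asboolP bk] km //.
exists y; split=> // i /andP[ii ik] bi.
have /km : (j0 <= i)%N && `[< bad i y >] by rewrite ii; apply/asboolP.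
by rewrite leqNgt ik.
Qed.

(** Dyadic cubes are nested or disjoint, and a bad cube strictly containing a selected
one would contradict maximality. *)
Lemma selected_disjoint k k' x : selected k -> selected k' ->
  cube_key k.1 x = k.2 -> cube_key k'.1 x = k'.2 -> k = k'.
Proof.
have keyE (a b : nat * {ffun 'I_n -> int}) : a.1 = b.1 ->
    cube_key a.1 x = a.2 -> cube_key b.1 x = b.2 -> a = b.
  by case: a b => [a a'] [b b'] /= -> <- <-.
wlog kk' : k k' / (k.1 <= k'.1)%N.
  move=> H; case: (leqP k.1 k'.1) => [/H|/ltnW/H G s s' h h']; first by apply.
  exact/esym/G.
move=> [y [ky jk bk mk]] [y' [ky' jk' bk' mk']] kx kx'.
have y'x : same_cube k'.1 y' x by rewrite same_cube_key kx' ky'.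
have y'x' := same_cube_mono kk' y'x.
have yy' : same_cube k.1 y y'.
  move: y'x'; rewrite !same_cube_key => /eqP <-; by rewrite kx ky.
have bk2 := bad_same yy' bk.
have e1 : k.1 = k'.1.
  apply/eqP; rewrite eqn_leq kk' leqNgt; apply/negP => lt.
  by apply: (mk' k.1); rewrite ?jk.
exact: keyE.
Qed.

Local Notation key := (nat * {ffun 'I_n -> int})%type.

(** The enumeration of all selected cubes through the countability of their keys; the
partial inverse [pickle_inv] never lists a cube twice. *)
Definition dcube (k : nat) : set 'rV[R]_n :=
  if @pickle_inv key k is Some u then
    [set x | selected u /\ cube_key u.1 x = u.2] else set0.

Definition dweight (k : nat) : R :=
  if @pickle_inv key k is Some u then
    if `[< @selected u >] then e2 (- (u.1%:R * d)) else 0 else 0.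

Lemma dcube_cover : S `<=` \bigcup_k dcube k.
Proof.
move=> y /selected_cover[j sj _]; exists (pickle (j, cube_key j y)) => //.
by rewrite /dcube pickleK_inv.
Qed.

(** Finitely many cubes have a common shell and, U being a filter, a common lattice. *)
Lemma dcube_mass K : exists2 del : R, 0 < del &
  U [set m | forall k, (k < K)%N ->
    C * dweight k <= lsum_on B m (fun x => x \in dcube k) (f del)].
Proof.
elim: K => [|K [del del0 H]]; first by exists 1 => //; apply: filterE.
have mono (P : pred 'rV[R]_n) m a b : a <= b -> lsum_on B m P (f b) <= lsum_on B m P (f a).
  move=> ab; apply: ler_lsum => x; apply: ler_wpM2l => //; exact: f_anti.
have [del' del'0 H'] : exists2 del', 0 < del' & U [set m | C * dweight K <=
    lsum_on B m (fun x => x \in dcube K) (f del')].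
  have triv : dweight K = 0 -> exists2 del', 0 < del' & U [set m | C * dweight K <=
    lsum_on B m (fun x => x \in dcube K) (f del')].
    move=> ->; exists 1 => //; apply: filterE => m; rewrite mulr0.
    by apply: lsum_ge0 => x; rewrite mulr_ge0.
  move: triv; rewrite /dweight /dcube; case: (pickle_inv K) => [u|]; last by apply.
  case: asboolP => [su _|_]; last by apply.
  have [y [uy ju [del' del'0 H'] _]] := su.
  exists del' => //; apply: filterS H' => m /= /ltW /le_trans; apply.
  rewrite le_eqVlt; apply/orP; left; apply/eqP; apply: eq_lsum => x; congr (_%:R * _).
  rewrite same_cube_key uy; congr nat_of_bool; apply/eqP/idP; rewrite inE /=; first by [].
  by case.
exists (Num.min del del'); first by rewrite lt_min del0.
apply: filterS2 H H' => m Hm Hm' k; rewrite ltnS leq_eqVlt => /orP[/eqP ->|kK].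
  by apply: le_trans Hm' _; apply: mono; rewrite ge_min lexx orbT.
by apply: le_trans (Hm k kK) _; apply: mono; rewrite ge_min lexx.
Qed.

Lemma dcube_disjoint k k' x : x \in dcube k -> x \in dcube k' -> k = k'.
Proof.
rewrite !inE /dcube.
have := pickle_invK (T := key) k.
have := pickle_invK (T := key) k'.
rewrite /oapp; case: (pickle_inv k) => [u|//]; case: (pickle_inv k') => [u'|//] <- <- [su ku] [su' ku'].
by rewrite (selected_disjoint su su' ku ku').
Qed.

Lemma dweight_ge0 k : 0 <= dweight k.
Proof.
by rewrite /dweight; case: (pickle_inv k) => [u|//]; case: asboolP => // _; exact: e2_ge0.
Qed.

(** The selected cubes are disjoint, so their energies add up to at most E. *)
Lemma sum_dweight K : C * (\sum_(k < K) dweight k) <= E.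
Proof.
have [del del0 H] := dcube_mass K.
have [m [Hm Em]] := filter_ex (filterI H (HE del0)).
apply: le_trans Em; rewrite mulr_sumr.
apply: (@le_trans _ _ (\sum_(k < K) lsum_on B m (fun x => x \in dcube k) (f del))).
  by apply: ler_sum => k _; exact: Hm.
rewrite /lsum_on -lsum_sum; apply: ler_lsum => x.
rewrite -mulr_suml; apply: ler_piMl => //.
case: (pselect (exists k : 'I_K, x \in dcube k)) => [[k xk]|nk].
  rewrite (bigD1 k) //= xk big1 ?addr0 // => k' k'k.
  case: (boolP (x \in dcube k')) => // xk'.
  by move: k'k; rewrite -val_eqE /= (dcube_disjoint xk' xk) eqxx.
rewrite big1 // => k _; case: (boolP (x \in dcube k)) => // xk.
by exfalso; apply: nk; exists k.
Qed.

Lemma diam_dcube k j : (exists u : key, [/\ @pickle_inv key k = Some u, u.1 = j & selected u]) ->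
  (diam (dcube k) <= (n%:R * 2 ^- j)%:E)%E.
Proof.
move=> [u [Eu uj su]]; apply: ge_ereal_sup => v [[x y] [/= Hx Hy] vE]; rewrite -vE lee_fin.
move: Hx Hy; rewrite /dcube Eu uj => -[_ xk] [_ yk].
apply: le_trans (enorm_le _) _; apply: ler_wpM2l => //.
by apply: same_cube_dist; rewrite same_cube_key xk yk.
Qed.

Lemma diam_set0 : (diam (set0 : set 'rV[R]_n) = -oo)%E.
Proof.
rewrite /diam; apply/eqP; rewrite -leeNy_eq; apply: ge_ereal_sup => v [[x y] [/= Hx _] _].
by case: Hx.
Qed.

Lemma dcube_cases k : dcube k = set0 \/
  exists u : key, [/\ @pickle_inv key k = Some u, (j0 <= u.1)%N & selected u].
Proof.
rewrite /dcube; case: (pickle_inv k) => [u|]; last by left.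
case: (pselect (selected u)) => su; last by left; apply/seteqP; split => x // [].
by right; exists u; split=> //; have [y []] := su.
Qed.

Lemma diam_dcube_le k (delta : R) : n%:R * 2 ^- j0 <= delta -> (diam (dcube k) <= delta%:E)%E.
Proof.
move=> H; have [->|[u [Eu ju su]]] := dcube_cases k; first by rewrite diam_set0 leNye.
apply: (@le_trans _ _ (n%:R * 2 ^- u.1)%:E); first by apply: diam_dcube; exists u.
rewrite lee_fin; apply: le_trans H; apply: ler_wpM2l => //.
by rewrite lef_pV2 ?posrE ?exprn_gt0 // ler_eXn2l // ltr1n.
Qed.

Lemma diam_weight_dcube k : (diam_weight d (dcube k) <= (n%:R `^ d * dweight k)%:E)%E.
Proof.
rewrite /diam_weight; case: eqP => [_|/eqP ne].
  by rewrite lee_fin mulr_ge0 ?powR_ge0 ?dweight_ge0.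
have [/eqP|[u [Eu ju su]]] := dcube_cases k; first by rewrite (negPf ne).
have dc : (diam (dcube k) <= (n%:R * 2 ^- u.1)%:E)%E by apply: diam_dcube; exists u.
have d0' : (0 <= diam (dcube k))%E.
  move/set0P: ne => [x kx]; apply: le_ereal_sup_tmp; exists (enorm (x - x))%:E; first by exists (x, x).
  by rewrite lee_fin sqrtr_ge0.
have q0 : 0 <= 2 ^- u.1 :> R by rewrite invr_ge0 exprn_ge0.
apply: (@le_trans _ _ ((n%:R * 2 ^- u.1)%:E `^ d)%E).
  apply: gt0_ler_poweR => //; first exact: ltW.
    by rewrite in_itv /= d0' leey.
  by rewrite in_itv /= leey andbT lee_fin mulr_ge0.
rewrite poweR_EFin lee_fin powRM // le_eqVlt; apply/orP; left; apply/eqP; congr (_ * _).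
rewrite /dweight Eu; case: asboolP => // _.
rewrite -e2_natN /powR gt_eqF ?e2_gt0 //; congr expR.
by rewrite /e2 expRK mulrA; congr (_ * _); ring.
Qed.

(** Cubes of side 2^-j have diameter at most n 2^-j, and the sum of their d-th powers is
bounded by [sum_dweight]. *)
Lemma premeasure_le (delta : R) : n%:R * 2 ^- j0 <= delta ->
  (hausdorff_premeasure d delta S <= (n%:R `^ d * (E / C))%:E)%E.
Proof.
move=> Hd; apply: (@le_trans _ _ (\sum_(0 <= k <oo) diam_weight d (dcube k))%E).
  apply: ereal_inf_lbound; exists dcube => //; split; first exact: dcube_cover.
  by move=> k; exact: diam_dcube_le.
apply: lime_le; first by apply: is_cvg_nneseries => k _ _; rewrite /diam_weight; case: ifP => // _; exact: poweR_ge0.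
apply: nearW => K; rewrite big_mkord.
apply: (@le_trans _ _ (\sum_(k < K) (n%:R `^ d * dweight k)%:E)%E).
  by apply: lee_sum => k _; exact: diam_weight_dcube.
rewrite sumEFin lee_fin -mulr_sumr; apply: ler_wpM2l; first exact: powR_ge0.
by rewrite ler_pdivlMr // mulrC sum_dweight.
Qed.

End Covering.

(** * The Hausdorff dimension *)

Section Dimension.
Context {R : realType} {n : nat}.
Implicit Types (S : set 'rV[R]_n) (d : R).

Lemma premeasure_ge0 d (delta : R) S : (0 <= hausdorff_premeasure d delta S)%E.
Proof.
apply: le_ereal_inf_tmp => _ [U _ <-]; apply: nneseries_ge0 => k _ _.
by rewrite /diam_weight; case: ifP => // _; exact: poweR_ge0.
Qed.

Lemma measure_eq0 d S :
  (forall delta eps : R, 0 < delta -> 0 < eps -> (hausdorff_premeasure d delta S <= eps%:E)%E) ->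
  hausdorff_measure d S = 0%E.
Proof.
move=> H; apply/eqP; rewrite eq_le; apply/andP; split.
  apply: ge_ereal_sup => _ [delta /= delta0 <-]; apply/lee_addgt0Pr => eps eps0.
  by rewrite add0e; exact: H.
apply: le_ereal_sup_tmp; exists (hausdorff_premeasure d 1 S); first by exists 1 => //=.
exact: premeasure_ge0.
Qed.

Lemma dim_le d S : 0 <= d -> hausdorff_measure d S = 0%E -> (hausdorff_dim S <= d%:E)%E.
Proof. by move=> d0 H; apply: ereal_inf_lbound; exists d. Qed.

Lemma dim_set0 d : 0 <= d -> (hausdorff_dim (set0 : set 'rV[R]_n) <= d%:E)%E.
Proof.
move=> d0; apply: dim_le => //; apply: measure_eq0 => delta eps delta0 eps0.
apply: (@le_trans _ _ 0%E); last by rewrite lee_fin ltW.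
apply: ereal_inf_lbound; exists (fun=> set0).
  by split=> [x //|k]; rewrite diam_set0 leNye.
by rewrite eseries0 // => k _ _; rewrite /diam_weight eqxx.
Qed.

End Dimension.

Section Collar.
Context {R : realType} {n : nat}.
Variables (S : set 'rV[R]_n) (r : R) (phi : 'rV[R]_n -> R) (g : 'rV[R]_n -> 'M[R]_n).
Variables (p : R) (B : nat).
Hypothesis S0 : S !=set0.
Hypothesis cS : compact S.
Hypothesis r0 : 0 < r.
Local Notation D := (sdist S).
Local Notation collar := [set x : 'rV[R]_n | 0 < D x < 4 * r].
Hypothesis sphi : smooth_on collar phi.
Hypothesis gE : forall x, collar x -> g x = expR (2 * phi x) *: 1%:M.
Hypothesis n3 : (2 < n)%N.
Hypothesis p2 : 2 <= p.
Hypothesis pn : p < n%:R.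
Hypothesis Ap : nonneg_tensor_on collar (intermediate_schouten p g).
Hypothesis Hbox : forall (x : 'rV[R]_n) i, D x < 4 * r -> `|x 0 i| + 2 <= B%:R.
Hypothesis Hcut : forall d eps, 0 < d -> 0 < eps ->
  exists eta d', cutoff_spec S r phi d eps eta d'.
Local Notation kappa := ((n%:R - p) / 2).

Lemma small_pow (eps : R) : 0 < eps -> exists j0 : nat, 2 ^- j0 <= eps.
Proof.
move=> /(e2_small ltr01)[j H]; exists j; have := H j (leqnn _).
by rewrite mulr1 e2_natN.
Qed.

Lemma pow_mono (i j : nat) : (i <= j)%N -> 2 ^- j <= 2 ^- i :> R.
Proof. by move=> ij; rewrite lef_pV2 ?posrE ?exprn_gt0 // ler_eXn2l // ltr1n. Qed.

(** Choose t in (2 kappa - d, kappa), so that b = (n - p - d) / p lies in (0, t / p).  For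
every C each point of S is in a bad cube: otherwise, U being an ultrafilter, all small
cubes around it have small energy for U-almost all lattices, against
[good_point_absurd].  Then let C tend to infinity. *)
Lemma null_above d : kappa < d < 2 * kappa -> hausdorff_measure d S = 0%E.
Proof.
move=> /andP[dk d2k].
have k0 : 0 < kappa by rewrite divr_gt0 // subr_gt0.
have p0 : 0 < p by exact: lt_le_trans p2.
(* the midpoint of the interval of admissible exponents *)
pose t := (2 * kappa - d + kappa) / 2.
have t0 : 0 < t by rewrite /t; move: k0 dk d2k; move: (kappa) => u; lra.
have tk : t < kappa by rewrite /t; move: k0 dk d2k; move: (kappa) => u; lra.
have td : 2 * kappa - d < t by rewrite /t; move: k0 dk d2k; move: (kappa) => u; lra.
have [E HE] := energy_bound S0 cS r0 sphi gE n3 p2 pn Ap Hbox Hcut t0 tk.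
have [U [UU Uoo]] := ultraFilterLemma (F := \oo) _.
have FU : ProperFilter U by exact: ultra_proper.
have U_ge m0 : U [set m | (m0 <= m)%N] by apply: Uoo; exact: nbhs_infty_ge.
pose f del (x : 'rV[R]_n) := (del <= D x <= r)%R%:R * edens phi p t x.
have f0 del x : 0 <= f del x by rewrite mulr_ge0 // edens_ge0.
have f_anti del del' x : del <= del' -> f del' x <= f del x.
  move=> dd; apply: ler_wpM2r; first exact: edens_ge0.
  case: (boolP (del' <= D x <= r)) => // /andP[a b].
  by rewrite (le_trans dd a) b.
have UE del : 0 < del -> U [set m | lsum B m (f del) <= E].
  by move=> /HE[m0 H]; apply: filterS (U_ge m0) => m; exact: H.
apply: measure_eq0 => delta eps delta0 eps0.
pose C := (n%:R `^ d * `|E| + 1) / eps.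
have nd0 : 0 <= n%:R `^ d :> R by exact: powR_ge0.
have C0 : 0 < C by rewrite divr_gt0 // ltr_wpDl // mulr_ge0.
have [j1 Hj1] := small_pow (divr_gt0 r0 (ltr0n R 4)).
have n0 : 0 < n%:R :> R by rewrite ltr0n (ltn_trans _ n3).
have [j2 Hj2] := small_pow (divr_gt0 delta0 n0).
pose j0 := maxn j1 j2.
have Hj0 : 2 ^- j0 <= r / 4 by apply: le_trans Hj1; apply: pow_mono; exact: leq_maxl.
have Hj0' : n%:R * 2 ^- j0 <= delta.
  rewrite mulrC -ler_pdivlMr //; apply: le_trans Hj2; apply: pow_mono; exact: leq_maxr.
pose b := (n%:R - p - d) / p.
have bE : p * (b + 1) = n%:R - d by rewrite /b; field; rewrite gt_eqF.
have bb : 0 < b < t / p.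
  have nd : 0 < n%:R - p - d by move: d2k; move: (n%:R) => u; lra.
  have ndt : n%:R - p - d < t by move: td; move: (n%:R) (t) => u v; lra.
  by rewrite /b ltr_pM2r ?invr_gt0 // ndt andbT divr_gt0.
have Hbad y : S y -> exists2 j, (j0 <= j)%N & bad B U f C d j y.
  move=> Sy; apply: contrapT => nbad.
  apply: (good_point_absurd S0 cS r0 sphi p2 (ltn_trans (ltn0Sn 1) n3) Hbox Hcut t0 HE FU U_ge Sy (ltW C0) bE bb Hj0).
  move=> j del jj del0.
  have [H|H] := in_ultra_setVsetC [set m | C * e2 (- (j%:R * d)) < lsum_on B m (same_cube j y) (f del)] UU.
    by exfalso; apply: nbad; exists j => //; exists del.
  by apply: filterS H => m /= /negP; rewrite -leNgt.
have d0 : 0 < d := lt_trans k0 dk.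
apply: le_trans (premeasure_le FU f0 f_anti d0 C0 UE Hbad Hj0') _.
rewrite lee_fin mulrA ler_pdivrMr // /C mulrCA mulfV ?gt_eqF // mulr1.
apply: le_trans (_ : n%:R `^ d * `|E| <= _); last by rewrite lerDl.
by apply: ler_wpM2l => //; exact: ler_norm.
Qed.

Lemma collar_dim_le : (hausdorff_dim S <= kappa%:E)%E.
Proof.
have k0 : 0 < kappa by rewrite divr_gt0 // subr_gt0.
apply/lee_addgt0Pr => eps eps0.
pose d := kappa + Num.min eps (kappa / 2).
have k2 : 0 < kappa / 2 by rewrite divr_gt0.
have m0 : 0 < Num.min eps (kappa / 2) by rewrite lt_min eps0.
have dk : kappa < d by rewrite ltrDl.
have d2 : d < 2 * kappa.
  have : Num.min eps (kappa / 2) <= kappa / 2 by rewrite ge_min lexx orbT.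
  by rewrite /d; move: k0; move: (kappa) (Num.min eps (kappa / 2)) => u v; lra.
apply: (@le_trans _ _ d%:E).
  by apply: dim_le; [exact: ltW (lt_trans k0 dk)|apply: null_above; rewrite dk].
by rewrite -EFinD lee_fin lerD2l ge_min lexx.
Qed.

End Collar.

(** The radius is divided by 4 because the estimates live in the collar D < 4 r. *)
Lemma compact_collar {R : realType} {n : nat} (S Omega : set 'rV[R]_n) :
  S !=set0 -> compact S -> open Omega -> S `<=` Omega ->
  exists2 r : R, 0 < r & forall x, sdist S x < 4 * r -> Omega x.
Proof.
move=> S0 cS oO SO.
have [d d0 H] : exists2 d : R, 0 < d & forall y, S y -> forall x, `|x - y| < d -> Omega x.
  apply: (compact_uniform (Q := fun y d => forall x, `|x - y| < d -> Omega x) cS).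
    move=> y d d' H /andP[_ dd] x xy; apply: H; exact: lt_le_trans dd.
  move=> z /SO Oz; have /nbhs_ballP[e /= e0 He] := open_nbhs_nbhs (conj oO Oz).
  exists (e / 2), (e / 2); split; rewrite ?divr_gt0 // => x Sx xz y yx.
  apply: He; rewrite -ball_normE /= distrC.
  have -> : y - z = (y - x) + (x - z) by rewrite addrA subrK.
  by apply: le_lt_trans (ler_normD _ _) _; rewrite [e]splitr; exact: ltrD.
exists (d / 4); first by rewrite divr_gt0.
move=> x; rewrite mulrCA mulfV ?pnatr_eq0 // mulr1 => /(sdist_lt S0)[y Sy xy].
exact: (H y).
Qed.

Theorem theorem1p1p2 (R : realType) (n : nat) (p : R)
    (Omega S : set 'rV[R]_n) (g : 'rV[R]_n -> 'M[R]_n) :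
  (3 <= n)%N ->
  2 <= p < n%:R ->
  domain Omega ->
  bounded_set Omega ->
  compact S ->
  S `<=` Omega ->
  riemannian_metric (Omega `\` S) g ->
  conformal (Omega `\` S) g euclidean_metric ->
  geodesically_complete_near Omega S g ->
  nonneg_tensor_on (Omega `\` S) (intermediate_schouten p g) ->
  (hausdorff_dim S <= ((n%:R - p) / 2)%:E)%E.
Proof.
move=> n3 /andP[p2 pn] [oO _ _] bO cS SO _ [phi sphi gE] complete Ap.
have [->|/set0P S0] := eqVneq S set0.
  by apply: dim_set0; rewrite divr_ge0 // subr_ge0 ltW.
have [r r0 HO] := compact_collar S0 cS oO SO.
have inM x : 0 < sdist S x < 4 * r -> (Omega `\` S) x.
  move=> /andP[x0 xr]; split; first exact: HO.
  by move=> /(sdist_eq0 S0) E; rewrite E ltxx in x0.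
have sphi' : smooth_on [set x | 0 < sdist S x < 4 * r] phi by move=> s x /inM; exact: sphi.
have gE' x : 0 < sdist S x < 4 * r -> g x = expR (2 * phi x) *: 1%:M by move=> /inM; exact: gE.
have Ap' : nonneg_tensor_on [set x | 0 < sdist S x < 4 * r] (intermediate_schouten p g).
  by move=> x v /inM; exact: Ap.
have phic x : 0 < sdist S x < 4 * r -> {for x, continuous phi} by move=> /inM/(sphi [::])[].
have nesc z a : 0 < sdist S z <= 2 * r -> ~ escapes S phi r z a.
  exact: (complete_no_escape S0 cS r0 phic HO gE' complete).
have Hcut d eps : 0 < d -> 0 < eps -> exists eta d', cutoff_spec S r phi d eps eta d'.
  move=> d0 eps0; have [eta [d' [h1 h2 h3 h4 h5]]] := cutoff S0 cS r0 phic d0 eps0 nesc.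
  by exists eta, d'; exact: CutoffSpec.
have [B HB] : exists B : nat, forall (x : 'rV[R]_n) i, sdist S x < 4 * r -> `|x 0 i| + 2 <= B%:R.
  have [M [Mr HM]] := bO; pose L := M + 1.
  exists (Num.truncn (L + 2)).+1 => x i /HO/(HM L) H.
  have ML : M < L by rewrite ltrDl.
  apply: (@le_trans _ _ (L + 2)).
    rewrite lerD2r; apply: le_trans (H ML).
    rewrite [leRHS]/Num.norm /= mx_normrE.
    by apply/bigmax_geP; right; exists (0, i).
  by apply: ltW; exact: truncnS_gt.
exact: (collar_dim_le S0 cS r0 sphi' gE' n3 p2 pn Ap' HB Hcut).
Qed.
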